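(* Let $\psi_1$ be a radiation solution of the Helmholtz equation in $\mathcal{U}$. The coefficients $F_n=F_n(\phi)$, $G_n=G_n(\phi)$ of its Karp expansion (see context) satisfy the recursive relations $$F_{n+1}=\frac{-\left((n+1)^2G_n+G_n''\right)}{2\kappa(n+1)},\qquad G_{n+1}=\frac{n^2F_n+F_n''}{2\kappa(n+1)},\qquad n\in\mathbb{N},$$ where $F_n'',G_n''$ denote second derivatives with respect to $\phi$.
   Context: $\mathbb{N}$ includes $0$. $\mathcal{U}$ is a region (open connected set) in $\mathbb{R}^2$ consisting of all points outside a closed bounded regular curve $S$. The Helmholtz equation is $\Delta\psi(x)+\kappa^2\psi(x)=0$, $x\in\mathcal{U}$, $\kappa>0$. A radiation solution is a complex-valued solution $\psi_1$ of the Helmholtz equation in $\mathcal{U}$ of class $C^2$ satisfying $\sqrt{|x|}\left(\frac{\partial}{\partial|x|}-i\kappa\right)\psi_1(x)\to0$ as $|x|\to+\infty$, uniformly in $x/|x|$. $(r,\phi)$ are the polar coordinates of $x$, $r=|x|$. $H_0,H_1$ are the Hankel functions of the first kind of orders $0$ and $1$. Let $\rho>0$ be such that $\mathbb{R}^2\setminus B_\rho\subset\mathcal{U}$, where $B_\rho=\{x\in\mathbb{R}^2:|x|<\rho\}$. Karp expansion (a known theorem of Karp): $$\psi_1(x)=H_0(\kappa|x|)\sum_{j=0}^{\infty}\frac{F_j(\phi)}{|x|^j}+H_1(\kappa|x|)\sum_{j=0}^{\infty}\frac{G_j(\phi)}{|x|^j},\quad x\in\mathbb{R}^2\setminus B_\rho,$$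 with the series converging absolutely and uniformly for $|x|\ge\rho_1$, for any $\rho_1>\rho$. *)

(* Defs.v *)
(* Stdlib real numbers with Coquelicot. *)
From Stdlib Require Import Reals Factorial.
From Coquelicot Require Import Coquelicot.
Open Scope R_scope.

(** * Plane-valued and complex-valued functions of real variables

    Both the plane and [C] are [R * R]; [C] carries its structure of normed
    space over [R], [C_R_NormedModule]. *)

Definition plane : Type := (R * R)%type.

Definition enorm (p : plane) : R := sqrt (fst p ^ 2 + snd p ^ 2).

Definition polar (r phi : R) : plane := (r * cos phi, r * sin phi).

Definition differentiable (f : R -> C) (t : R) : Prop :=
  @ex_derive R_AbsRing C_R_NormedModule f t.

(** The value is meaningful only where [f] is [differentiable]. *)
Definition CDerive (f : R -> C) (t : R) : C :=
  (Derive (fun s => fst (f s)) t, Derive (fun s => snd (f s)) t).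

Definition twice_differentiable (f : R -> C) : Prop :=
  forall t, differentiable f t /\ differentiable (CDerive f) t.

Definition partial1 (f : plane -> C) (p : plane) : C :=
  CDerive (fun s => f (s, snd p)) (fst p).

Definition partial2 (f : plane -> C) (p : plane) : C :=
  CDerive (fun s => f (fst p, s)) (snd p).

Definition laplacian (f : plane -> C) (p : plane) : C :=
  Cplus (partial1 (partial1 f) p) (partial2 (partial2 f) p).

(** [f] is of class C^k on the open set [U]; values outside [U] are irrelevant. *)
Fixpoint class_C (k : nat) (U : plane -> Prop) (f : plane -> C) : Prop :=
  (forall p, U p -> continuous f p) /\
  match k with
  | O => True
  | S k' =>
      (forall p, U p -> differentiable (fun s => f (s, snd p)) (fst p) /\
                        differentiable (fun s => f (fst p, s)) (snd p)) /\
      class_C k' U (partial1 f) /\ class_C k' U (partial2 f)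
  end.

(** * Exterior of a closed regular curve *)

Definition regular_arc (g : R -> plane) : Prop :=
  (forall t, differentiable g t /\ continuous (CDerive g) t) /\
  (forall t, 0 <= t <= 1 -> CDerive g t <> (0, 0)).

(** A finite cyclic chain of regular arcs: a single regular closed curve is the
    case [n = 0], and corners between consecutive arcs are allowed.  As the
    continuous image of compact intervals, [Gam] is automatically bounded. *)
Definition closed_regular_curve (Gam : plane -> Prop) : Prop :=
  exists (n : nat) (g : nat -> R -> plane),
    (forall i, (i <= n)%nat -> regular_arc (g i)) /\
    (forall i, (i < n)%nat -> g i 1 = g (S i) 0) /\
    g n 1 = g O 0 /\
    (forall p, Gam p <->
       exists i t, (i <= n)%nat /\ 0 <= t <= 1 /\ p = g i t).

(** The unbounded component of the complement of [Gam]; for a closed curve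
    it is open and connected. *)
Definition outside (Gam : plane -> Prop) (p : plane) : Prop :=
  forall M : R, exists c : R -> plane,
    (forall t, continuous c t) /\ c 0 = p /\
    (forall t, 0 <= t <= 1 -> ~ Gam (c t)) /\ M < enorm (c 1).

Definition exterior_region (U : plane -> Prop) : Prop :=
  exists Gam, closed_regular_curve Gam /\ forall p, U p <-> outside Gam p.

(** * Radiation solutions of the Helmholtz equation *)

Definition helmholtz (kappa : R) (U : plane -> Prop) (psi : plane -> C) : Prop :=
  forall p, U p ->
    Cplus (laplacian psi p) (Cmult (RtoC (kappa ^ 2)) (psi p)) = RtoC 0.

(** sqrt |x| (d/d|x| - i kappa) psi (x) -> 0 as |x| -> oo, uniformly in x/|x|. *)
Definition radiation_condition (kappa : R) (psi : plane -> C) : Prop :=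
  forall eps, 0 < eps -> exists M, forall r phi, M < r ->
    Cmod (Cmult (RtoC (sqrt r))
            (Cminus (CDerive (fun s => psi (polar s phi)) r)
                    (Cmult (Cmult Ci (RtoC kappa)) (psi (polar r phi))))) < eps.

Definition radiation_solution (kappa : R) (U : plane -> Prop)
    (psi : plane -> C) : Prop :=
  class_C 2 U psi /\ helmholtz kappa U psi /\ radiation_condition kappa psi.

(** * Hankel functions of the first kind and integer order, on x > 0 *)

Definition harmonic (k : nat) : R := sum_n_m (fun i => / INR i) 1 k.

Definition euler_gamma : R := real (Lim_seq (fun n => harmonic n - ln (INR n))).

(** The digamma function at the positive integer [k + 1]. *)
Definition digamma_S (k : nat) : R := - euler_gamma + harmonic k.

Definition bessel_J (n : nat) (x : R) : R :=
  (x / 2) ^ n *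
  PSeries (fun k => (-1) ^ k / (INR (fact k) * INR (fact (n + k)))) (x ^ 2 / 4).

(** The classical power-series representation at integer order (DLMF 10.8.1). *)
Definition bessel_Y (n : nat) (x : R) : R :=
  - (/ (x / 2) ^ n / PI *
     match n with
     | O => 0
     | S m => sum_n (fun k => INR (fact (m - k)) / INR (fact k) * (x ^ 2 / 4) ^ k) m
     end)
  + 2 / PI * ln (x / 2) * bessel_J n x
  - (x / 2) ^ n / PI *
    PSeries (fun k => (-1) ^ k * (digamma_S k + digamma_S (n + k))
                      / (INR (fact k) * INR (fact (n + k)))) (x ^ 2 / 4).

Definition hankel1 (n : nat) (x : R) : C := (bessel_J n x, bessel_Y n x).

(** * Karp expansion *)

Definition karp_term (F : nat -> R -> C) (r phi : R) (j : nat) : C :=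
  Cdiv (F j phi) (RtoC (r ^ j)).

Definition converges_pointwise (rho : R) (F : nat -> R -> C) (A : R -> R -> C) :=
  forall r phi, rho <= r ->
    @is_series R_AbsRing C_R_NormedModule (karp_term F r phi) (A r phi).

Definition converges_absolutely (rho : R) (F : nat -> R -> C) :=
  forall r phi, rho <= r -> ex_series (fun j => Cmod (karp_term F r phi j)).

Definition converges_uniformly (rho : R) (F : nat -> R -> C) (A : R -> R -> C) :=
  forall eps, 0 < eps -> exists N : nat, forall n r phi,
    (N <= n)%nat -> rho <= r ->
    Cmod (Cminus (sum_n (karp_term F r phi) n) (A r phi)) < eps.

(** Functions of the polar angle are 2 pi-periodic functions on [R]. *)
Definition angular (F : nat -> R -> C) : Prop :=
  forall n phi, F n (phi + 2 * PI) = F n phi.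

Definition karp_expansion (kappa rho : R) (psi : plane -> C)
    (F G : nat -> R -> C) : Prop :=
  angular F /\ angular G /\
  exists A B : R -> R -> C,
    converges_pointwise rho F A /\ converges_pointwise rho G B /\
    (forall r phi, rho <= r ->
       psi (polar r phi) =
         Cplus (Cmult (hankel1 0 (kappa * r)) (A r phi))
               (Cmult (hankel1 1 (kappa * r)) (B r phi))) /\
    (forall rho1, rho < rho1 ->
       converges_absolutely rho1 F /\ converges_uniformly rho1 F A /\
       converges_absolutely rho1 G /\ converges_uniformly rho1 G B).

(* Main.v *)
Require Import Defs.
From Stdlib Require Import Reals Lra Lia Arith Wf_nat Factorial Classical.
From Coquelicot Require Import Coquelicot.
Open Scope R_scope.

(** Write [T(a, b)(r)] for [H0(kappa r) sum a_n r^-n + H1(kappa r) sum b_n r^-n];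
    the Karp expansion says that [psi] on the ray of angle [phi] is
    [T(F(phi), G(phi))].  The classical system [H0' = -H1], [H1' = H0 - H1/x]
    shows that differentiating [T(a, b)] in [r] gives again an expansion of the
    same form, so every radial differential operator acts on pairs of
    coefficient sequences.  Substituting the expansion into the Helmholtz
    equation and comparing coefficients then gives the recursion, provided that
    (i) the pair [(a, b)] is determined by the function [T(a, b)], and
    (ii) the angular part of the Laplacian can be applied to coefficients that
    are not known in advance to be differentiable, or even continuous, in [phi].

    Uniqueness ([expansion_unique]).  If [T(a, b)] vanishes, so does its
    derivative; since [H0] and [H1] have no common zero, the determinant of the
    two linear relations vanishes.  The leading coefficients satisfy
    [a_0^2 + b_0^2 = 0], so if they are not both zero, the quotient [c = b/a] is
    a convergent power series in [1/r].  The determinant relation becomes the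
    Riccati equation [c' - c/r = kappa (1 + c^2)], whose formal solutions
    [c_n = eps^(n+1) kappa^-n e_n], [eps^2 = -1], have coefficients [e_n] that
    grow faster than any geometric sequence ([riccati_diverges]).  So
    [a_0 = b_0 = 0], and multiplying by [r] repeats the argument.

    Continuity ([coefficients_continuous]).  Uniform convergence bounds all but
    finitely many coefficients geometrically, uniformly in [phi].  If some
    coefficients did not tend to their values at [phi0], their differences,
    divided by the sum of the first few of them in absolute value, would
    have a coefficientwise cluster point; this is a nonzero pair [(a, b)] with
    [T(a, b) = 0], because [psi] is continuous.

    Second angular derivatives ([difference_recursion]).  A [C^2] function of
    the angle satisfies [f(p+h) - 2 f(p) + f(p-h) = int_0^h (h-s) (f''(p+s) +
    f''(p-s)) ds].  For [psi], the Helmholtz equation in polar coordinates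
    turns the right-hand side into a radial operator applied to the weighted
    mean of [psi]; this mean has an expansion whose coefficients are the
    weighted means of [F_n] and [G_n].  By uniqueness the second differences of
    [F_n] and [G_n] are the weighted means of the continuous functions predicted
    by the recursion, and a continuous function whose second differences are of
    this form is twice differentiable with the predicted second derivative
    ([second_difference_converse]). *)

(** * Growth of the coefficients of the Riccati solution *)

Lemma sum_n_m_le_loc (a b : nat -> R) (n m : nat) :
  (n <= S m)%nat -> (forall k, (n <= k <= m)%nat -> a k <= b k) ->
  sum_n_m a n m <= sum_n_m b n m.
Proof.
  intros Hnm H. induction m as [|m IH].
  - destruct n as [|n]. rewrite !sum_n_n. apply H; lia.
    rewrite !sum_n_m_zero by lia. lra.
  - destruct (Nat.eq_dec n (S (S m))) as [->|].
    rewrite !sum_n_m_zero by lia. lra.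
    rewrite !sum_n_Sm by lia. apply Rplus_le_compat.
    apply IH. lia. intros; apply H; lia. apply H; lia.
Qed.

(** The terms of the Cauchy square of [e] that do not involve [e 0]. *)
Definition inner_convolution (e : nat -> R) (n : nat) : R :=
  sum_n_m (fun k => e k * e (n - k)%nat) 1 (n - 1).

Section Growth.
Variable e : nat -> R.
Hypothesis e0 : e 0%nat = 1.
(** The equation [sum_(k <= n) e k * e (n - k) = n * e (n - 1)], solved for [e n] with
    [e 0 = 1]. *)
Hypothesis rec : forall n, 2 * e (S n) = INR (S n) * e n - inner_convolution e (S n).

Lemma coef_1 : e 1%nat = / 2.
Proof.
  generalize (rec 0); unfold inner_convolution; simpl.
  rewrite sum_n_m_zero by lia. unfold zero; simpl. rewrite e0; lra.
Qed.

Lemma coef_2 : e 2%nat = 3 / 8.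
Proof.
  generalize (rec 1); unfold inner_convolution; simpl.
  rewrite sum_n_n; simpl. rewrite coef_1; lra.
Qed.

(** Since [e] grows factorially, the recursion is dominated by its linear term;
    these explicit bounds are weak enough to be propagated by induction and
    strong enough to control the convolution. *)
Definition ratio_bounds (n : nat) : Prop :=
  0 < e n /\ INR (n + 2) / 4 * e n <= e (S n) <= INR n / 2 * e n.

(** A product of two coefficients is at most the most unbalanced product
    [e 1 * e (k + l - 1)].  By induction on [k]: raising [k] by one multiplies the
    left side by at most [k / 2] (by [3 / 4] when [k = 1]) and the right side by at
    least [(k + l + 1) / 4]. *)
Lemma product_bound (n : nat) (H : forall k, (1 < k <= n)%nat -> ratio_bounds k) :
  forall k l, (1 <= k <= l)%nat -> (k + l <= S (S n))%nat ->
  0 < e k /\ e k * e l <= e (k + l - 1) / 2.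
Proof.
  assert (P : forall k, (1 <= k <= S n)%nat -> 0 < e k).
  { intros k Hk. destruct (Nat.eq_dec k 1) as [->|]. rewrite coef_1; lra.
    destruct (Nat.eq_dec k 2) as [->|]. rewrite coef_2; lra.
    destruct (Nat.eq_dec k (S n)) as [->|].
    - destruct (H n) as (a & b & c). lia. eapply Rlt_le_trans. 2: exact b.
      apply Rmult_lt_0_compat; auto. assert (0 < INR (n + 2)) by (apply lt_0_INR; lia). lra.
    - apply H; lia. }
  induction k as [|k IH]; intros l Hk Hl. lia.
  split. apply P; lia.
  destruct (Nat.eq_dec k 0) as [->|Hk0].
  { rewrite coef_1. replace (1 + l - 1)%nat with l by lia. lra. }
  assert (Hk1 : (k = 1 \/ 1 < k)%nat) by lia.
  destruct (IH l) as (pk & IHl). lia. lia.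
  replace (S k + l - 1)%nat with (S (k + l - 1)) by lia.
  destruct (H (k + l - 1)%nat) as (a & b & c). lia.
  assert (pl : 0 < e l) by (apply P; lia).
  assert (B : e (S k) <= INR (k + l - 1 + 2) / 4 * e k).
  { replace (k + l - 1 + 2)%nat with (S k + l)%nat by lia. rewrite plus_INR.
    destruct Hk1 as [->|Hk1].
    - rewrite coef_1, coef_2. assert (INR 2 <= INR l) by (apply le_INR; lia).
      simpl in H0 |- *. lra.
    - destruct (H k) as (_ & _ & ck). lia.
      eapply Rle_trans. exact ck. apply Rmult_le_compat_r. lra.
      assert (INR (S k) <= INR l) by (apply le_INR; lia).
      rewrite S_INR in *. lra. }
  set (q := INR (k + l - 1 + 2)) in *.
  assert (0 <= q) by apply pos_INR.
  apply Rle_trans with (q / 4 * (e k * e l)).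
  - apply Rle_trans with ((q / 4 * e k) * e l). apply Rmult_le_compat_r; lra. lra.
  - apply Rle_trans with (q / 4 * (e (k + l - 1) / 2)). apply Rmult_le_compat_l; lra. lra.
Qed.

(** By [product_bound] each of the [n] terms of the convolution is at most
    [e n / 2], and its two extreme terms are equal to [e n / 2]. *)
Lemma all_ratio_bounds (n : nat) : (1 < n)%nat -> ratio_bounds n.
Proof.
  induction n as [n IHn] using lt_wf_ind; intros Hn.
  assert (IH : forall k, (1 < k <= n - 1)%nat -> ratio_bounds k) by (intros; apply IHn; lia).
  clear IHn.
  pose proof (product_bound (n - 1) IH) as Pr.
  assert (P : forall k, (1 <= k <= n)%nat -> 0 < e k).
  { intros k Hk. destruct (le_lt_dec (k + k) (S n)).
    - apply (Pr k k); lia.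
    - destruct (Nat.eq_dec k n) as [->|].
      + destruct (Nat.eq_dec n 2) as [->|]. rewrite coef_2; lra.
        destruct (IH (n - 1)%nat) as (a & b & _). lia.
        replace (S (n - 1)) with n in b by lia.
        eapply Rlt_le_trans. 2: exact b. apply Rmult_lt_0_compat; auto.
        assert (0 < INR (n - 1 + 2)) by (apply lt_0_INR; lia). lra.
      + apply IH. lia. }
  assert (U : inner_convolution e (S n) <= INR n * (e n / 2)).
  { unfold inner_convolution. replace (S n - 1)%nat with n by lia.
    apply Rle_trans with (sum_n_m (fun _ => e n / 2) 1 n).
    - apply sum_n_m_le_loc. lia. intros k Hk.
      destruct (le_lt_dec k (S n - k)).
      + destruct (Pr k (S n - k)%nat) as (_ & Q). lia. lia.
        replace (k + (S n - k) - 1)%nat with n in Q by lia. exact Q.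
      + destruct (Pr (S n - k)%nat k) as (_ & Q). lia. lia.
        replace (S n - k + k - 1)%nat with n in Q by lia. lra.
    - rewrite sum_n_m_const. replace (S n - 1)%nat with n by lia. lra. }
  assert (L : e n <= inner_convolution e (S n)).
  { unfold inner_convolution. replace (S n - 1)%nat with n by lia.
    destruct n as [|n]. lia. rewrite sum_Sn_m by lia. rewrite sum_n_Sm by lia.
    replace (S (S n) - 1)%nat with (S n) by lia.
    replace (S (S n) - S n)%nat with 1%nat by lia. rewrite coef_1. unfold plus; simpl.
    assert (0 <= sum_n_m (fun k => e k * e (S (S n) - k)%nat) 2 n).
    { apply Rle_trans with (sum_n_m (fun _ => 0) 2 n).
      rewrite sum_n_m_const. lra.
      destruct (le_lt_dec 2 n). apply sum_n_m_le_loc. lia.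
      intros k Hk. apply Rmult_le_pos; apply Rlt_le, P; lia.
      rewrite !sum_n_m_zero by lia. lra. }
    unfold plus in *; simpl in *. lra. }
  pose proof (rec n) as Rn. pose proof (P n ltac:(lia)).
  split. lra. rewrite S_INR in Rn. rewrite plus_INR; simpl. split; lra.
Qed.

(** The ratios [e (S n) / e n] tend to infinity, so [e] outgrows every geometric sequence. *)
Lemma coefs_not_geometric (K M : R) : ~ (forall n, Rabs (e n) <= K * M ^ n).
Proof.
  intros H.
  (* From index [4 L] on, consecutive ratios are at least [L], hence beat [M]. *)
  set (L := Rabs M + 1).
  assert (HL : 0 < L) by (unfold L; generalize (Rabs_pos M); lra).
  destruct (nfloor_ex (4 * L)) as (m & Hm). lra.
  set (N := (m + 2)%nat).
  assert (A : forall k, e N * L ^ k <= e (N + k)%nat).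
  { induction k. rewrite Nat.add_0_r; simpl; lra.
    destruct (all_ratio_bounds (N + k)) as (p & q & _). unfold N; lia.
    replace (N + S k)%nat with (S (N + k)) by lia.
    eapply Rle_trans. 2: exact q.
    apply Rle_trans with (L * e (N + k)%nat).
    simpl. replace (e N * (L * L ^ k)) with (L * (e N * L ^ k)) by ring.
    apply Rmult_le_compat_l; lra.
    apply Rmult_le_compat_r; try lra.
    assert (INR m + 1 <= INR (N + k + 2)). rewrite <- S_INR. apply le_INR. unfold N; lia.
    lra. }
  assert (pN : 0 < e N) by (apply all_ratio_bounds; unfold N; lia).
  set (q := Rabs M / L).
  assert (Hq : Rabs q < 1).
  { unfold q. rewrite Rabs_pos_eq. apply Rmult_lt_reg_r with L; auto.
    unfold Rdiv. rewrite Rmult_assoc, Rinv_l by lra. unfold L; lra.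
    apply Rdiv_le_0_compat; auto using Rabs_pos. }
  pose proof (is_lim_seq_geom q Hq) as Z.
  apply (is_lim_seq_scal_l _ (Rabs K * Rabs M ^ N)) in Z. simpl in Z. rewrite Rmult_0_r in Z.
  assert (e N <= 0); [|lra].
  apply (is_lim_seq_le (fun _ => e N) (fun n => Rabs K * Rabs M ^ N * q ^ n) (e N) 0); auto.
  2: apply is_lim_seq_const.
  intros k. specialize (A k). specialize (H (N + k)%nat).
  assert (B : e N * L ^ k <= Rabs K * Rabs M ^ N * Rabs M ^ k).
  { eapply Rle_trans. exact A. eapply Rle_trans. apply Rle_abs. eapply Rle_trans. exact H.
    eapply Rle_trans. apply Rle_abs. rewrite Rabs_mult, <- RPow_abs, pow_add. lra. }
  apply Rmult_le_reg_r with (L ^ k). apply pow_lt; auto.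
  eapply Rle_trans. exact B. right. unfold q, Rdiv. rewrite Rpow_mult_distr, pow_inv.
  field. apply pow_nonzero; lra.
Qed.
End Growth.

(** * Complex power series in the inverse of the radius *)

Lemma Cmod_le_abs (z : C) : Cmod z <= Rabs (fst z) + Rabs (snd z).
Proof.
  replace z with (Cplus (RtoC (fst z)) (Cmult Ci (RtoC (snd z)))) at 1.
  eapply Rle_trans. apply Cmod_triangle. rewrite Cmod_mult, Cmod_Ci, !Cmod_R. lra.
  destruct z; unfold Cplus, Cmult, Ci, RtoC; simpl; f_equal; ring.
Qed.

Lemma fst_le_Cmod (z : C) : Rabs (fst z) <= Cmod z.
Proof. eapply Rle_trans. 2: apply Rmax_Cmod. apply Rmax_l. Qed.

Lemma snd_le_Cmod (z : C) : Rabs (snd z) <= Cmod z.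
Proof. eapply Rle_trans. 2: apply Rmax_Cmod. apply Rmax_r. Qed.

Definition geometric (M : R) (a : nat -> C) : Prop :=
  exists K, forall n, Cmod (a n) <= K * M ^ n.

(** The sum of [a n / r ^ n], encoded through two real power series so that the
    theory of radii of convergence applies. *)
Definition inv_series (a : nat -> C) (r : R) : C :=
  (PSeries (fun n => fst (a n)) (/ r), PSeries (fun n => snd (a n)) (/ r)).

(** Componentwise differentiation: products and uniqueness of derivatives reduce
    to the real case. *)
Definition is_Cderive (f : R -> C) (t : R) (l : C) : Prop :=
  is_derive (fun s => fst (f s)) t (fst l) /\ is_derive (fun s => snd (f s)) t (snd l).

Lemma inv_in_disk (b : nat -> R) (K M r : R) :
  0 < M -> M < r -> (forall n, Rabs (b n) <= K * M ^ n) ->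
  Rbar_lt (Rabs (/ r)) (CV_radius b).
Proof.
  intros HM Hr H.
  apply Rbar_lt_le_trans with (/ M).
  - simpl. rewrite Rabs_pos_eq by (apply Rlt_le, Rinv_0_lt_compat; lra).
    apply Rinv_lt_contravar; auto. apply Rmult_lt_0_compat; lra.
  - destruct (CV_radius_bounded b) as [U _]. apply U. exists K. intros n.
    rewrite Rabs_mult, <- RPow_abs, (Rabs_pos_eq (/ M)) by (apply Rlt_le, Rinv_0_lt_compat; lra).
    apply Rle_trans with (K * M ^ n * (/ M) ^ n).
    apply Rmult_le_compat_r; auto. apply pow_le, Rlt_le, Rinv_0_lt_compat; lra.
    rewrite pow_inv, Rmult_assoc, Rinv_r. lra. apply pow_nonzero; lra.
Qed.

Lemma sum_n_m_fst (u : nat -> C) m n : fst (sum_n_m u m n) = sum_n_m (fun k => fst (u k)) m n.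
Proof.
  induction n as [|n IH].
  - destruct m. rewrite !sum_n_n. reflexivity. rewrite !sum_n_m_zero by lia. reflexivity.
  - destruct (le_lt_dec m (S n)).
    rewrite !sum_n_Sm by auto. rewrite <- IH. reflexivity.
    rewrite !sum_n_m_zero by auto. reflexivity.
Qed.

Lemma sum_n_m_snd (u : nat -> C) m n : snd (sum_n_m u m n) = sum_n_m (fun k => snd (u k)) m n.
Proof.
  induction n as [|n IH].
  - destruct m. rewrite !sum_n_n. reflexivity. rewrite !sum_n_m_zero by lia. reflexivity.
  - destruct (le_lt_dec m (S n)).
    rewrite !sum_n_Sm by auto. rewrite <- IH. reflexivity.
    rewrite !sum_n_m_zero by auto. reflexivity.
Qed.

Section Laws.
Variables M r : R.
Hypothesis HM : 0 < M.
Hypothesis Hr : M < r.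

Lemma in_disk_fst a : geometric M a -> Rbar_lt (Rabs (/ r)) (CV_radius (fun n => fst (a n))).
Proof.
  intros (K & H). apply (inv_in_disk _ K M); auto.
  intros n. eapply Rle_trans. apply fst_le_Cmod. apply H.
Qed.

Lemma in_disk_snd a : geometric M a -> Rbar_lt (Rabs (/ r)) (CV_radius (fun n => snd (a n))).
Proof.
  intros (K & H). apply (inv_in_disk _ K M); auto.
  intros n. eapply Rle_trans. apply snd_le_Cmod. apply H.
Qed.

Lemma inv_series_ext a b : (forall n, a n = b n) -> inv_series a r = inv_series b r.
Proof. intros H. unfold inv_series; f_equal; apply PSeries_ext; intros n; rewrite H; auto. Qed.

Lemma inv_series_plus a b : geometric M a -> geometric M b ->
  inv_series (fun n => Cplus (a n) (b n)) r = Cplus (inv_series a r) (inv_series b r).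
Proof.
  intros Ha Hb. unfold inv_series, Cplus; simpl; f_equal.
  - rewrite <- PSeries_plus by (apply CV_radius_inside, in_disk_fst; auto). reflexivity.
  - rewrite <- PSeries_plus by (apply CV_radius_inside, in_disk_snd; auto). reflexivity.
Qed.

Lemma inv_series_scal c a : geometric M a ->
  inv_series (fun n => Cmult c (a n)) r = Cmult c (inv_series a r).
Proof.
  intros Ha. unfold inv_series, Cmult; simpl. rewrite <- !PSeries_scal.
  assert (E1 : forall x, ex_pseries (PS_scal x (fun n => fst (a n))) (/ r)).
  { intros x. apply ex_pseries_scal. apply Rmult_comm. now apply CV_radius_inside, in_disk_fst. }
  assert (E2 : forall x, ex_pseries (PS_scal x (fun n => snd (a n))) (/ r)).
  { intros x. apply ex_pseries_scal. apply Rmult_comm. now apply CV_radius_inside, in_disk_snd. }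
  f_equal.
  - rewrite <- PSeries_minus by auto. reflexivity.
  - rewrite <- PSeries_plus by auto. reflexivity.
Qed.

Definition convolution (a b : nat -> C) (n : nat) : C :=
  sum_n (fun k => Cmult (a k) (b (n - k)%nat)) n.

Lemma inv_series_convolution a b : geometric M a -> geometric M b ->
  inv_series (convolution a b) r = Cmult (inv_series a r) (inv_series b r).
Proof.
  intros Ha Hb. unfold inv_series, Cmult; cbn [fst snd].
  pose proof (in_disk_fst a Ha). pose proof (in_disk_snd a Ha).
  pose proof (in_disk_fst b Hb). pose proof (in_disk_snd b Hb).
  rewrite <- !PSeries_mult by auto. f_equal.
  - rewrite <- PSeries_minus by (apply ex_pseries_mult; auto).
    apply PSeries_ext. intros n. unfold convolution, PS_minus, PS_plus, PS_opp, PS_mult.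
    unfold sum_n. rewrite sum_n_m_fst. fold (sum_n (fun k => fst (Cmult (a k) (b (n - k)%nat)))
      n). rewrite sum_n_Reals.
    change (plus ?x (opp ?y)) with (x - y). rewrite <- minus_sum.
    apply sum_eq. intros; reflexivity.
  - rewrite <- PSeries_plus by (apply ex_pseries_mult; auto).
    apply PSeries_ext. intros n. unfold convolution, PS_plus, PS_mult.
    unfold sum_n. rewrite sum_n_m_snd. fold (sum_n (fun k => snd (Cmult (a k) (b (n - k)%nat)))
      n). rewrite sum_n_Reals.
    change (plus ?x ?y) with (x + y). rewrite <- sum_plus.
    apply sum_eq. intros; reflexivity.
Qed.

(** Multiplication by [1 / r]. *)
Definition shift (a : nat -> C) (n : nat) : C := match n with O => RtoC 0 | S m => a m end.

(** Differentiation in [r]: [r ^ (- n)] has derivative [- n r ^ (- n - 1)]. *)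
Definition inv_deriv (a : nat -> C) (n : nat) : C :=
  match n with O => RtoC 0 | S m => Cmult (RtoC (- INR m)) (a m) end.

Lemma inv_series_shift a : inv_series (shift a) r = Cmult (RtoC (/ r)) (inv_series a r).
Proof.
  unfold inv_series. unfold Cmult; simpl.
  rewrite !Rmult_0_l, Rminus_0_r, Rplus_0_r, <- !PSeries_incr_1.
  f_equal; apply PSeries_ext; intros [|n]; reflexivity.
Qed.

Lemma PSeries_inv_derive (b : nat -> R) :
  Rbar_lt (Rabs (/ r)) (CV_radius b) ->
  is_derive (fun s => PSeries b (/ s)) r
    (PSeries (fun n => match n with O => 0 | S m => - INR m * b m end) (/ r)).
Proof.
  intros Hb.
  replace (PSeries _ _) with ((- / r ^ 2) * PSeries (PS_derive b) (/ r)).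
  - apply (is_derive_comp (PSeries b) Rinv). now apply is_derive_PSeries.
    auto_derive. lra. field; lra.
  - transitivity (PSeries (PS_opp (PS_incr_1 (PS_incr_1 (PS_derive b)))) (/ r)).
    rewrite PSeries_opp, !PSeries_incr_1. field; lra.
    apply PSeries_ext. intros [|[|n]]; unfold PS_opp, PS_incr_1, PS_derive; unfold opp, zero;
      simpl.
    ring. ring. unfold opp; simpl. ring.
Qed.

Lemma inv_series_derive a : geometric M a -> is_Cderive (inv_series a) r (inv_series (inv_deriv
  a) r).
Proof.
  intros Ha. split; simpl.
  - eapply is_derive_ext_loc. 2: evar_last. 2: apply (PSeries_inv_derive _ (in_disk_fst a Ha)).
    apply filter_forall; reflexivity.
    apply PSeries_ext. intros [|n]; simpl; ring.
  - eapply is_derive_ext_loc. 2: evar_last. 2: apply (PSeries_inv_derive _ (in_disk_snd a Ha)).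
    apply filter_forall; reflexivity.
    apply PSeries_ext. intros [|n]; simpl; ring.
Qed.

Definition unit_seq (n : nat) : C := match n with O => RtoC 1 | S _ => RtoC 0 end.

Lemma inv_series_unit : inv_series unit_seq r = RtoC 1.
Proof.
  assert (Z : forall (b : nat -> R) x, (forall n, b (S n) = 0) -> PSeries b x = b O).
  { intros b x H. rewrite <- (PSeries_0 b). unfold PSeries. apply Series_ext. intros [|n].
    simpl; ring. rewrite H; ring. }
  unfold inv_series. rewrite !Z by reflexivity. reflexivity.
Qed.

End Laws.

Lemma geometric_ge_0 M a : geometric M a -> exists K, 0 <= K /\ forall n, Cmod (a n) <= K * M ^ n.
Proof.
  intros (K & H). exists K. split; auto. generalize (H 0%nat) (Cmod_ge_0 (a 0%nat)); simpl; lra.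
Qed.

Lemma geometric_mono M M' a : 0 < M <= M' -> geometric M a -> geometric M' a.
Proof.
  intros HM Ha. destruct (geometric_ge_0 M a Ha) as (K & HK & H). exists K. intros n.
  eapply Rle_trans. apply H. apply Rmult_le_compat_l; auto. apply pow_incr; lra.
Qed.

(** Finitely many terms never prevent a geometric bound. *)
Lemma geometric_of_tail M a K N : 0 < M ->
  (forall n, (N <= n)%nat -> Cmod (a n) <= K * M ^ n) -> geometric M a.
Proof.
  intros HM H.
  assert (B : exists K', 0 <= K' /\ forall n, (n < N)%nat -> Cmod (a n) <= K' * M ^ n).
  { clear H. induction N as [|N (K' & HK & H)]. exists 0. split. lra. intros; lia.
    exists (K' + Cmod (a N) / M ^ N).
    assert (0 <= Cmod (a N) / M ^ N).
    { apply Rdiv_le_0_compat. apply Cmod_ge_0. now apply pow_lt. }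
    split. lra. intros n Hn. assert (0 < M ^ n) by now apply pow_lt.
    destruct (Nat.eq_dec n N) as [->|].
    - rewrite Rmult_plus_distr_r. unfold Rdiv. rewrite Rmult_assoc, Rinv_l by lra.
      assert (0 <= K' * M ^ N) by (apply Rmult_le_pos; lra). lra.
    - eapply Rle_trans. apply H; lia. apply Rmult_le_compat_r; lra. }
  destruct B as (K' & HK & B). exists (K' + Rabs K). intros n.
  assert (0 < M ^ n) by now apply pow_lt.
  destruct (le_lt_dec N n).
  - eapply Rle_trans. apply H; auto. apply Rmult_le_compat_r. lra.
    generalize (Rle_abs K); lra.
  - eapply Rle_trans. apply B; auto. apply Rmult_le_compat_r. lra.
    generalize (Rabs_pos K); lra.
Qed.

Lemma geometric_ext M a b : (forall n, a n = b n) -> geometric M a -> geometric M b.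
Proof. intros E (K & H). exists K. intros n. rewrite <- E; auto. Qed.

Lemma geometric_plus M a b : geometric M a -> geometric M b ->
  geometric M (fun n => Cplus (a n) (b n)).
Proof.
  intros (K & H) (K' & H'). exists (K + K'). intros n.
  eapply Rle_trans. apply Cmod_triangle. specialize (H n); specialize (H' n). lra.
Qed.

Lemma geometric_scal M c a : geometric M a -> geometric M (fun n => Cmult c (a n)).
Proof.
  intros (K & H). exists (Cmod c * K). intros n.
  rewrite Cmod_mult, Rmult_assoc. apply Rmult_le_compat_l; auto. apply Cmod_ge_0.
Qed.

Lemma geometric_shift M a : 0 < M -> geometric M a -> geometric M (shift a).
Proof.
  intros HM (K & H). apply (geometric_of_tail _ _ (K / M) 1); auto.
  intros [|n] Hn. lia. simpl. eapply Rle_trans. apply H. right. field. lra.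
Qed.

Lemma geometric_tail M a : geometric M a -> geometric M (fun n => a (S n)).
Proof.
  intros (K & H). exists (K * M). intros n. eapply Rle_trans. apply H. simpl; lra.
Qed.

Lemma INR_le_pow2 n : INR n <= 2 ^ n.
Proof.
  induction n. simpl; lra. rewrite S_INR. simpl. assert (1 <= 2 ^ n) by (apply pow_R1_Rle; lra).
    lra.
Qed.

(** The factor [n] is absorbed by doubling the ratio. *)
Lemma geometric_inv_deriv M a : 0 < M -> geometric M a -> geometric (2 * M) (inv_deriv a).
Proof.
  intros HM Ha. destruct (geometric_ge_0 M a Ha) as (K & HK & H).
  apply (geometric_of_tail _ _ (K / (2 * M)) 1). lra.
  intros [|n] Hn. lia. unfold inv_deriv. rewrite Cmod_mult, Cmod_R, Rabs_Ropp, Rabs_pos_eq by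
    apply pos_INR.
  apply Rle_trans with (2 ^ n * (K * M ^ n)).
  apply Rmult_le_compat; auto using pos_INR, Cmod_ge_0, INR_le_pow2.
  right. simpl. rewrite Rpow_mult_distr. field. lra.
Qed.

Lemma geometric_unit M : 0 < M -> geometric M unit_seq.
Proof.
  intros HM. exists 1. intros [|n]. simpl. rewrite Cmod_1; lra.
  simpl. rewrite Cmod_0. assert (0 < M ^ S n) by now apply pow_lt. simpl in *; lra.
Qed.

Lemma Cmod_sum_n (u : nat -> C) n : Cmod (sum_n u n) <= sum_n (fun k => Cmod (u k)) n.
Proof.
  induction n. rewrite !sum_O. lra.
  rewrite !sum_Sn. eapply Rle_trans. apply Cmod_triangle. unfold plus; simpl. lra.
Qed.

Lemma sum_n_le_loc (a b : nat -> R) n : (forall k, (k <= n)%nat -> a k <= b k) ->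
  sum_n a n <= sum_n b n.
Proof. intros H. apply sum_n_m_le_loc. lia. intros; apply H; lia. Qed.

Lemma geometric_convolution M a b : 0 < M -> geometric M a -> geometric M b ->
  geometric (2 * M) (convolution a b).
Proof.
  intros HM Ha Hb. destruct (geometric_ge_0 M a Ha) as (K & HK & H).
  destruct (geometric_ge_0 M b Hb) as (K' & HK' & H').
  exists (2 * (K * K')). intros n. unfold convolution. eapply Rle_trans. apply Cmod_sum_n.
  apply Rle_trans with (sum_n (fun k => K * K' * M ^ n) n).
  - apply sum_n_le_loc. intros k Hk. rewrite Cmod_mult.
    replace n with (k + (n - k))%nat at 2 by lia. rewrite pow_add.
    apply Rle_trans with ((K * M ^ k) * (K' * M ^ (n - k))).
    apply Rmult_le_compat; auto using Cmod_ge_0. right; ring.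
  - rewrite sum_n_const, Rpow_mult_distr.
    assert (0 < M ^ n) by now apply pow_lt.
    assert (0 <= K * K' * M ^ n) by (apply Rmult_le_pos; [apply Rmult_le_pos|]; lra).
    replace (2 * (K * K') * (2 ^ n * M ^ n)) with ((2 * 2 ^ n) * (K * K' * M ^ n)) by ring.
    apply Rmult_le_compat_r; auto. exact (INR_le_pow2 (S n)).
Qed.

(** The constant term is the limit as [r] tends to infinity. *)
Lemma PSeries_inv_eq0 (b : nat -> R) (M K : R) : 0 < M ->
  (forall n, Rabs (b n) <= K * M ^ n) ->
  (forall r, M < r -> PSeries b (/ r) = 0) -> b O = 0.
Proof.
  intros HM Hb H.
  assert (R0 : Rbar_lt (Rabs 0) (CV_radius b)).
  { eapply Rbar_le_lt_trans. 2: apply (inv_in_disk b K M (M + 1)); auto; lra.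
    simpl. rewrite Rabs_R0. apply Rabs_pos. }
  apply PSeries_continuity in R0. apply continuity_pt_filterlim in R0.
  rewrite PSeries_0 in R0.
  assert (L : is_lim_seq (fun n => PSeries b (/ (M + INR (S n)))) (b O)).
  { apply (filterlim_comp _ _ _ (fun n => / (M + INR (S n))) (PSeries b) _ (locally 0)); auto.
    apply (is_lim_seq_inv _ p_infty). 2: discriminate.
    eapply is_lim_seq_plus. apply is_lim_seq_const.
    apply (is_lim_seq_incr_1 INR). apply is_lim_seq_INR. reflexivity. }
  apply is_lim_seq_unique in L.
  rewrite (Lim_seq_ext _ (fun _ => 0)), Lim_seq_const in L. now inversion L.
  intros n. apply H. assert (0 < INR (S n)) by (apply lt_0_INR; lia). lra.
Qed.

Lemma inv_series_eq0_head M a : 0 < M -> geometric M a ->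
  (forall r, M < r -> inv_series a r = RtoC 0) -> a O = RtoC 0.
Proof.
  intros HM (K & Ha) H. rewrite (surjective_pairing (a O)).
  apply injective_projections; simpl.
  - apply (PSeries_inv_eq0 (fun n => fst (a n)) M K); auto.
    intros n; eapply Rle_trans. apply fst_le_Cmod. auto.
    intros r Hr. now injection (H r Hr).
  - apply (PSeries_inv_eq0 (fun n => snd (a n)) M K); auto.
    intros n; eapply Rle_trans. apply snd_le_Cmod. auto.
    intros r Hr. now injection (H r Hr).
Qed.

(** After the constant term is known to vanish, multiply by [r] and repeat. *)
Lemma inv_series_eq0 M a : 0 < M -> geometric M a ->
  (forall r, M < r -> inv_series a r = RtoC 0) -> forall n, a n = RtoC 0.
Proof.
  intros HM Ha H n. revert a Ha H.
  induction n as [|n IH]; intros a Ha H. now apply (inv_series_eq0_head M).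
  assert (a0 := inv_series_eq0_head M a HM Ha H).
  apply (IH (fun n => a (S n))). now apply geometric_tail.
  intros r Hr. specialize (H r Hr).
  rewrite (inv_series_ext r a (shift (fun n => a (S n)))) in H by (intros [|m]; auto).
  rewrite inv_series_shift in H.
  destruct (Ceq_dec (inv_series (fun n => a (S n)) r) 0) as [E|E]; auto.
  exfalso. revert H. apply Cmult_neq_0; auto. intros Z. apply RtoC_inj in Z.
  apply Rinv_neq_0_compat in Z; lra.
Qed.

(** * Derivatives of complex-valued functions and division of series *)

(** Algebraic structures hide the carrier of an equation from [ring] and [field];
    these two tactics expose it. *)
Ltac as_C_eq := match goal with |- @eq _ ?x ?y => change (@eq C x y) end.
Ltac as_R_eq := match goal with |- @eq _ ?x ?y => change (@eq R x y) end.

Lemma Cderive_unique f t l l' : is_Cderive f t l -> is_Cderive f t l' -> l = l'.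
Proof.
  intros [A B] [A' B']. apply injective_projections.
  - rewrite <- (is_derive_unique _ _ _ A). now apply is_derive_unique.
  - rewrite <- (is_derive_unique _ _ _ B). now apply is_derive_unique.
Qed.

Lemma Cderive_ext_loc f g t l : locally t (fun s => f s = g s) -> is_Cderive f t l -> is_Cderive
  g t l.
Proof.
  intros E [A B]. split; eapply is_derive_ext_loc; eauto;
  apply (filter_imp _ _ (fun s (H : f s = g s) => f_equal _ H) E).
Qed.

Lemma Cderive_ext_gt f g M t l : M < t -> (forall s, M < s -> f s = g s) -> is_Cderive f t l ->
  is_Cderive g t l.
Proof.
  intros Ht E. apply Cderive_ext_loc. apply (filter_imp _ _ E). apply (open_gt M t Ht).
Qed.

Lemma Cderive_plus f g t l l' : is_Cderive f t l -> is_Cderive g t l' ->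
  is_Cderive (fun s => Cplus (f s) (g s)) t (Cplus l l').
Proof. intros [A B] [A' B']. split; apply (@is_derive_plus R_AbsRing R_NormedModule); auto. Qed.

Lemma Cderive_mult f g t l l' : is_Cderive f t l -> is_Cderive g t l' ->
  is_Cderive (fun s => Cmult (f s) (g s)) t (Cplus (Cmult l (g t)) (Cmult (f t) l')).
Proof.
  intros [A B] [A' B'].
  assert (P : forall (p q : R -> R) dp dq, is_derive p t dp -> is_derive q t dq ->
    is_derive (fun s => p s * q s) t (dp * q t + p t * dq)).
  { intros p q dp dq Hp Hq. exact (is_derive_mult p q t dp dq Hp Hq Rmult_comm). }
  split; simpl.
  - replace (_ + _) with ((fst l * fst (g t) + fst (f t) * fst l')
      - (snd l * snd (g t) + snd (f t) * snd l')) by ring.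
    exact (is_derive_minus _ _ t _ _ (P _ _ _ _ A A') (P _ _ _ _ B B')).
  - replace (_ + _) with ((fst l * snd (g t) + fst (f t) * snd l')
      + (snd l * fst (g t) + snd (f t) * fst l')) by ring.
    exact (is_derive_plus _ _ t _ _ (P _ _ _ _ A B') (P _ _ _ _ B A')).
Qed.

Lemma Cderive_const (c : C) t : is_Cderive (fun _ => c) t (RtoC 0).
Proof. split; apply (@is_derive_const R_AbsRing R_NormedModule). Qed.

Lemma convolution_Sn a c n :
  convolution a c (S n) = Cplus (Cmult (a O) (c (S n))) (sum_n (fun j => Cmult (a (S j)) (c (n -
    j)%nat)) n).
Proof.
  unfold convolution, sum_n. rewrite sum_Sn_m by lia. rewrite <- sum_n_m_S. reflexivity.
Qed.

Section Quotient.
Variables a b : nat -> C.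
Hypothesis a0 : a O <> RtoC 0.

(** The recursion for the coefficients of [b / a] refers to all earlier values;
    [prefix n] is the function that is correct up to index [n]. *)
Fixpoint prefix (n : nat) : nat -> C :=
  match n with
  | O => fun _ => Cdiv (b O) (a O)
  | S m => fun k => if le_lt_dec k m then prefix m k else
      Cdiv (Cminus (b (S m)) (sum_n (fun j => Cmult (a (S j)) (prefix m (m - j)%nat)) m)) (a O)
  end.

Definition quotient (n : nat) : C := prefix n n.

Lemma prefix_quotient n k : (k <= n)%nat -> prefix n k = quotient k.
Proof.
  induction n as [|n IH]; intros Hk.
  - replace k with O by lia. reflexivity.
  - destruct (Nat.eq_dec k (S n)) as [->|]. reflexivity.
    simpl. destruct (le_lt_dec k n). apply IH; lia. lia.
Qed.

Lemma convolution_quotient n : convolution a quotient n = b n.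
Proof.
  destruct n as [|n].
  - unfold convolution. rewrite sum_O. unfold quotient; simpl. field. auto.
  - rewrite convolution_Sn. unfold quotient at 1; cbn [prefix]. destruct (le_lt_dec (S n) n). lia.
    rewrite (sum_n_ext_loc (fun j => Cmult (a (S j)) (prefix n (n - j)%nat))
      (fun j => Cmult (a (S j)) (quotient (n - j)%nat))).
    generalize (sum_n (fun j => Cmult (a (S j)) (quotient (n - j)%nat)) n).
    intros s. field. auto.
    intros k Hk. rewrite prefix_quotient by lia. reflexivity.
Qed.
End Quotient.

Lemma sum_n_Rmult (x : R) (u : nat -> R) n : sum_n (fun k => x * u k) n = x * sum_n u n.
Proof. exact (@sum_n_mult_l R_Ring x u n). Qed.

Lemma sum_n_Cmult (x : C) (u : nat -> C) n :
  sum_n (fun k => Cmult x (u k)) n = Cmult x (sum_n u n).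
Proof. exact (@sum_n_mult_l C_Ring x u n). Qed.

Lemma geom_sum q n : q * sum_n (fun j => (1 + q) ^ (n - j)) n = (1 + q) ^ S n - 1.
Proof.
  induction n.
  - rewrite sum_O. simpl; ring.
  - rewrite sum_Sn, Nat.sub_diag. change (plus ?x ?y) with (x + y).
    rewrite (sum_n_ext_loc _ (fun j => (1 + q) * ((1 + q) ^ (n - j)))).
    rewrite sum_n_Rmult. revert IHn. generalize (sum_n (fun j => (1 + q) ^ (n - j)) n). intros s
      IHn.
    transitivity ((1 + q) * (q * s) + q). simpl; ring. rewrite IHn. simpl. ring.
    intros j Hj. rewrite Nat.sub_succ_l by lia. reflexivity.
Qed.

(** Dividing by the ratio [M ^ n], the recursion bounds the coefficients by the
    solution [q (1 + q) ^ n] of [x_n = q + q (x_0 + ... + x_(n-1))]. *)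
Lemma geometric_quotient M a c : 0 < M -> a O <> RtoC 0 -> geometric M a ->
  geometric M (convolution a c) -> exists L, M <= L /\ geometric L c.
Proof.
  intros HM a0 Ha Hb.
  destruct (geometric_ge_0 M a Ha) as (K1 & HK1 & H1).
  destruct (geometric_ge_0 M _ Hb) as (K2 & HK2 & H2).
  apply Cmod_gt_0 in a0.
  set (K := K1 + K2). set (q := K / Cmod (a O)).
  assert (Hq : 0 <= q). { apply Rdiv_le_0_compat; auto. unfold K; lra. }
  exists (M * (1 + q)). split. assert (0 <= M * q) by (apply Rmult_le_pos; lra). lra.
  exists q. intros n.
  assert (EK : Cmod (a O) * q = K) by (unfold q; field; lra).
  assert (M0 : forall n, 0 < M ^ n) by (intros; now apply pow_lt).
  assert (B2 : forall n, Cmod (convolution a c n) <= K * M ^ n).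
  { intros m. eapply Rle_trans. apply H2. apply Rmult_le_compat_r. apply Rlt_le, M0. unfold K;
    lra. }
  assert (B1 : forall n, Cmod (a n) <= K * M ^ n).
  { intros m. eapply Rle_trans. apply H1. apply Rmult_le_compat_r. apply Rlt_le, M0. unfold K;
    lra. }
  induction n as [n IH] using lt_wf_ind.
  apply Rmult_le_reg_l with (Cmod (a O)); auto. rewrite <- Cmod_mult, <- Rmult_assoc, EK.
  destruct n as [|n].
  - specialize (B2 O). unfold convolution in B2. rewrite sum_O in B2. exact B2.
  - specialize (B2 (S n)). rewrite convolution_Sn in B2.
    set (s := sum_n (fun j => Cmult (a (S j)) (c (n - j)%nat)) n) in *.
    replace (Cmult (a O) (c (S n))) with (Cplus (Cplus (Cmult (a O) (c (S n))) s) (Copp s)) by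
      ring.
    eapply Rle_trans. apply Cmod_triangle. rewrite Cmod_opp.
    assert (Bs : Cmod s <= K * M ^ S n * ((1 + q) ^ S n - 1)).
    { rewrite <- geom_sum. eapply Rle_trans. apply Cmod_sum_n.
      rewrite <- Rmult_assoc, <- sum_n_Rmult. apply sum_n_le_loc. intros k Hk. rewrite Cmod_mult.
      apply Rle_trans with ((K * M ^ S k) * (q * (M * (1 + q)) ^ (n - k))).
      apply Rmult_le_compat; auto using Cmod_ge_0. apply IH; lia.
      right. simpl. rewrite Rpow_mult_distr.
      replace n with (k + (n - k))%nat at 3 by lia. rewrite pow_add. ring. }
    rewrite Rpow_mult_distr. lra.
Qed.

Lemma convolution_eq0 a b : a O <> RtoC 0 -> (forall n, convolution a b n = RtoC 0) -> forall n,
  b n = RtoC 0.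
Proof.
  intros a0 H n. induction n as [n IH] using lt_wf_ind.
  assert (E : Cmult (a O) (b n) = RtoC 0).
  { rewrite <- (H n). destruct n as [|n]. unfold convolution. now rewrite sum_O.
    rewrite convolution_Sn. rewrite (sum_n_ext_loc _ (fun k => Cmult (RtoC 0) (RtoC 0))).
    rewrite sum_n_Cmult. generalize (sum_n (fun _ : nat => RtoC 0) n). intros s. ring.
    intros k Hk. rewrite IH by lia. as_C_eq. ring. }
  destruct (Ceq_dec (b n) 0) as [|N]; auto. now destruct (Cmult_neq_0 _ _ a0 N).
Qed.

(** The two hypotheses are the Riccati equation [c' - c / r = kappa (1 + c ^ 2)]
    read off coefficientwise.  Rescaling by powers of [kappa] and of the
    square root [c 0] of [-1] turns [c] into the real sequence of
    [coefs_not_geometric], whichever root was taken. *)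
Lemma riccati_diverges (kappa M : R) (c : nat -> C) : 0 < kappa ->
  Cmult (c O) (c O) = RtoC (-1) ->
  (forall n, Cmult (RtoC kappa) (convolution c c (S n)) = Cmult (RtoC (- INR (S n))) (c n)) ->
  ~ geometric M c.
Proof.
  intros Hk c0 Hc (K & HK).
  assert (k0 : RtoC kappa <> RtoC 0) by (intros E; apply RtoC_inj in E; lra).
  assert (n0 : c O <> RtoC 0).
  { intros E. rewrite E in c0. rewrite Cmult_0_l in c0. apply RtoC_inj in c0. lra. }
  assert (m0 : Cmod (c O) = 1).
  { assert (E : Cmod (c O) * Cmod (c O) = 1). rewrite <- Cmod_mult, c0, Cmod_R.
    rewrite Rabs_left; lra. generalize (Cmod_ge_0 (c O)). nra. }
  (* The normalisation for which [e 0 = 1] and the recursion has integer coefficients. *)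
  set (e := fun n => Cdiv (Cmult (c n) (Cpow (RtoC kappa) n)) (Cpow (c O) (S n))).
  assert (p0 : forall n, Cpow (c O) n <> RtoC 0) by (intros; now apply Cpow_nz).
  assert (E0 : e O = RtoC 1). { unfold e; simpl. field. auto. }
  assert (Ee : forall n, convolution e e (S n) = Cmult (RtoC (INR (S n))) (e n)).
  { intros n.
    transitivity (Cdiv (Cmult (Cpow (RtoC kappa) (S n)) (convolution c c (S n))) (Cpow (c O) (S n
      + 2))).
    - unfold convolution. unfold Cdiv.
      transitivity (Cmult (Cdiv (Cpow (RtoC kappa) (S n)) (Cpow (c O) (S n + 2))) (sum_n (fun k
        => Cmult (c k) (c (S n - k)%nat)) (S n))).
      2: field; auto.
      rewrite <- sum_n_Cmult. apply sum_n_ext_loc. intros k Hk'.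
      unfold e. replace (S n + 2)%nat with (S k + S (S n - k))%nat by lia.
      replace (S n) with (k + (S n - k))%nat at 4 by lia. rewrite !Cpow_add_r. as_C_eq. field.
        auto.
    - replace (Cmult (Cpow (RtoC kappa) (S n)) (convolution c c (S n)))
       with (Cmult (Cpow (RtoC kappa) n) (Cmult (RtoC kappa) (convolution c c (S n)))) by (simpl;
         ring).
      rewrite Hc. rewrite Cpow_add_r. replace (Cpow (c O) 2) with (RtoC (-1)) by (rewrite <- c0;
        simpl; ring).
      unfold e. rewrite !RtoC_opp. field. auto. }
  assert (Er : forall n, Cmult (RtoC 2) (e (S n)) =
     Cminus (Cmult (RtoC (INR (S n))) (e n)) (sum_n_m (fun k => Cmult (e k) (e (S n - k)%nat)) 1
       n)).
  { intros n. rewrite <- Ee. unfold convolution, sum_n. rewrite sum_Sn_m, sum_n_Sm by lia.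
    rewrite Nat.sub_diag, Nat.sub_0_r, E0. change (@plus _) with Cplus.
    unfold plus; simpl. ring. }
  assert (Im0 : forall n, snd (e n) = 0).
  { intros n. induction n as [n IH] using lt_wf_ind. destruct n as [|n].
    now rewrite E0. specialize (Er n). apply (f_equal snd) in Er.
    cbn [Cmult Cminus Cplus Copp snd fst RtoC] in Er. rewrite sum_n_m_snd in Er.
    rewrite (sum_n_m_ext_loc _ (fun _ => zero)) in Er. rewrite sum_n_m_const_zero in Er.
    change (zero : R) with 0 in Er. rewrite (IH n) in Er by lia. lra.
    intros k Hk'. cbn [snd fst Cmult]. rewrite (IH k), (IH (S n - k)%nat) by lia.
    change (zero : R) with 0. as_R_eq. ring. }
  apply (coefs_not_geometric (fun n => fst (e n))) with K (M * kappa).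
  - now rewrite E0.
  - intros n. specialize (Er n). apply (f_equal fst) in Er.
    cbn [Cmult Cminus Cplus Copp snd fst RtoC] in Er. rewrite sum_n_m_fst in Er.
    unfold inner_convolution. replace (S n - 1)%nat with n by lia.
    rewrite (sum_n_m_ext_loc _ (fun k => fst (e k) * fst (e (S n - k)%nat))) in Er.
    lra. intros k Hk'. cbn [snd fst Cmult]. rewrite (Im0 k). as_R_eq. ring.
  - intros n. eapply Rle_trans. apply fst_le_Cmod. unfold e.
    rewrite Cmod_div, Cmod_mult, !Cmod_pow, m0, Cmod_R, pow1, Rabs_pos_eq, Rpow_mult_distr by
      (auto; lra).
    unfold Rdiv. rewrite Rinv_1, Rmult_1_r, <- Rmult_assoc. apply Rmult_le_compat_r; auto.
    apply pow_le; lra.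
Qed.

(** * Uniqueness of expansions along a Bessel-type system *)

(** The coefficients of the derivative of [u A + v B], when [u' = - kappa v] and
    [v' = kappa u - v / r]; [deriv_u] is the coefficient of [u], [deriv_v] that of
    [v]. *)
Definition deriv_u (kappa : R) (a b : nat -> C) (n : nat) : C :=
  Cplus (inv_deriv a n) (Cmult (RtoC kappa) (b n)).
Definition deriv_v (kappa : R) (a b : nat -> C) (n : nat) : C :=
  Cplus (inv_deriv b n) (Cplus (Cmult (RtoC (- kappa)) (a n)) (Cmult (RtoC (-1)) (shift b n))).

Lemma geometric_deriv_u kappa M a b : 0 < M -> geometric M a -> geometric M b ->
  geometric (2 * M) (deriv_u kappa a b).
Proof.
  intros HM Ha Hb. apply geometric_plus. now apply geometric_inv_deriv.
  apply geometric_scal, (geometric_mono M); auto; lra.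
Qed.

Lemma geometric_deriv_v kappa M a b : 0 < M -> geometric M a -> geometric M b ->
  geometric (2 * M) (deriv_v kappa a b).
Proof.
  intros HM Ha Hb. apply geometric_plus. now apply geometric_inv_deriv.
  apply geometric_plus; apply geometric_scal, (geometric_mono M); auto; try lra.
  now apply geometric_shift.
Qed.

Ltac solve_geometric := repeat first [assumption | apply geometric_plus | apply geometric_scal].

Section System.
Variable kappa : R.
Variables u v : R -> C.
Hypothesis Hk : 0 < kappa.
Hypothesis du : forall r, 0 < r -> is_Cderive u r (Cmult (RtoC (- kappa)) (v r)).
Hypothesis dv : forall r, 0 < r -> is_Cderive v r (Cminus (Cmult (RtoC kappa) (u r)) (Cdiv (v r)
  (RtoC r))).
Hypothesis uv0 : forall r, 0 < r -> u r = RtoC 0 -> v r = RtoC 0 -> False.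

Definition expansion (a b : nat -> C) (r : R) : C :=
  Cplus (Cmult (u r) (inv_series a r)) (Cmult (v r) (inv_series b r)).

Lemma expansion_derive M a b r : 0 < M -> geometric M a -> geometric M b -> 2 * M < r ->
  is_Cderive (expansion a b) r (expansion (deriv_u kappa a b) (deriv_v kappa a b) r).
Proof.
  intros HM Ha Hb Hr.
  replace (expansion _ _ _) with
    (Cplus (Cplus (Cmult (Cmult (RtoC (- kappa)) (v r)) (inv_series a r)) (Cmult (u r)
      (inv_series (inv_deriv a) r)))
       (Cplus (Cmult (Cminus (Cmult (RtoC kappa) (u r)) (Cdiv (v r) (RtoC r))) (inv_series b r))
          (Cmult (v r) (inv_series (inv_deriv b) r)))).
  - apply Cderive_plus; apply Cderive_mult.
    apply du; lra. apply (inv_series_derive M); auto; lra.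
    apply dv; lra. apply (inv_series_derive M); auto; lra.
  - assert (G1 := geometric_inv_deriv M a HM Ha). assert (G2 := geometric_inv_deriv M b HM Hb).
    assert (Ga : geometric (2 * M) a) by (apply (geometric_mono M); auto; lra).
    assert (Gb : geometric (2 * M) b) by (apply (geometric_mono M); auto; lra).
    assert (Gs : geometric (2 * M) (shift b)) by (apply geometric_shift; auto; lra).
    unfold expansion, deriv_u, deriv_v.
    rewrite !(inv_series_plus (2 * M)), !(inv_series_scal (2 * M)), inv_series_shift, RtoC_opp,
      RtoC_inv;
      solve_geometric; auto; try lra.
    unfold Cdiv. replace (RtoC (-1)) with (Copp (RtoC 1)) by (rewrite <- RtoC_opp; reflexivity).
      ring.
Qed.

Section Relation.
Variable M : R.
Variables a b : nat -> C.
Hypothesis HM : 0 < M.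
Hypothesis Ha : geometric M a.
Hypothesis Hb : geometric M b.
Hypothesis H : forall r, M < r -> expansion a b r = RtoC 0.

(** The expansion and its derivative are two linear relations between [u r] and
    [v r], which do not both vanish. *)
Lemma determinant r : 2 * M < r ->
  Cminus (Cmult (inv_series a r) (inv_series (deriv_v kappa a b) r)) (Cmult (inv_series b r)
    (inv_series (deriv_u kappa a b) r)) = RtoC 0.
Proof.
  intros Hr.
  assert (E1 := H r ltac:(lra)).
  assert (E2 : expansion (deriv_u kappa a b) (deriv_v kappa a b) r = RtoC 0).
  { apply (Cderive_unique (expansion a b) r). now apply (expansion_derive M).
    apply (Cderive_ext_gt (fun _ => RtoC 0) _ M). lra. intros; symmetry; auto. apply
      Cderive_const. }
  unfold expansion in E1, E2.
  set (p := inv_series (deriv_u kappa a b) r) in *. set (q := inv_series (deriv_v kappa a b) r)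
    in *.
  set (A := inv_series a r) in *. set (B := inv_series b r) in *.
  set (d := Cminus (Cmult A q) (Cmult B p)).
  destruct (Ceq_dec d 0) as [|N]; auto. exfalso.
  apply (uv0 r). lra.
  - destruct (Ceq_dec (u r) 0) as [|N']; auto. destruct (Cmult_neq_0 _ _ N N').
    transitivity (Cminus (Cmult q (Cplus (Cmult (u r) A) (Cmult (v r) B)))
       (Cmult B (Cplus (Cmult (u r) p) (Cmult (v r) q)))). unfold d; ring.
    rewrite E1, E2. ring.
  - destruct (Ceq_dec (v r) 0) as [|N']; auto. destruct (Cmult_neq_0 _ _ N N').
    transitivity (Cminus (Cmult A (Cplus (Cmult (u r) p) (Cmult (v r) q)))
       (Cmult p (Cplus (Cmult (u r) A) (Cmult (v r) B)))). unfold d; ring.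
    rewrite E1, E2. ring.
Qed.

(** The constant term of [determinant]. *)
Lemma leading_isotropic : Cplus (Cmult (a O) (a O)) (Cmult (b O) (b O)) = RtoC 0.
Proof.
  (* The coefficients of the determinant. *)
  set (X := fun n => Cplus (convolution a (deriv_v kappa a b) n) (Cmult (RtoC (-1)) (convolution
    b (deriv_u kappa a b) n))).
  assert (Ga : geometric (2 * M) a) by (apply (geometric_mono M); auto; lra).
  assert (Gb : geometric (2 * M) b) by (apply (geometric_mono M); auto; lra).
  assert (G1 := geometric_deriv_u kappa M a b HM Ha Hb).
  assert (G2 := geometric_deriv_v kappa M a b HM Ha Hb).
  assert (C1 : geometric (2 * (2 * M)) (convolution a (deriv_v kappa a b))) by (apply
    geometric_convolution; auto; lra).
  assert (C2 : geometric (2 * (2 * M)) (convolution b (deriv_u kappa a b))) by (apply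
    geometric_convolution; auto; lra).
  assert (X0 : X O = RtoC 0).
  { apply (inv_series_eq0 (2 * (2 * M))). lra. now apply geometric_plus; [|apply geometric_scal].
    intros r Hr. unfold X. rewrite (inv_series_plus (2 * (2 * M))), (inv_series_scal (2 * (2 *
      M))), !(inv_series_convolution (2 * M)); auto; try lra.
    rewrite <- (determinant r) by lra.
    replace (RtoC (-1)) with (Copp (RtoC 1)) by (rewrite <- RtoC_opp; reflexivity). ring.
    now apply geometric_scal. }
  unfold X, convolution in X0. rewrite !sum_O in X0. unfold deriv_u, deriv_v, inv_deriv, shift in
    X0. simpl in X0.
  assert (k0 : RtoC (- kappa) <> RtoC 0) by (intros E; apply RtoC_inj in E; lra).
  destruct (Ceq_dec (Cplus (Cmult (a O) (a O)) (Cmult (b O) (b O))) 0) as [|N]; auto.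
  destruct (Cmult_neq_0 _ _ k0 N). rewrite <- X0.
  replace (RtoC (-1)) with (Copp (RtoC 1)) by (rewrite <- RtoC_opp; reflexivity).
  rewrite RtoC_opp. ring.
Qed.

(** Otherwise [b / a] is a convergent solution of the Riccati equation; its
    equation is [determinant] divided by the square of [inv_series a r]. *)
Lemma leading_zero : a O = RtoC 0.
Proof.
  destruct (Ceq_dec (a O) 0) as [|a0]; auto. exfalso.
  set (c := quotient a b).
  assert (Ec : forall n, convolution a c n = b n) by now apply convolution_quotient.
  destruct (geometric_quotient M a c HM a0 Ha) as (L & HL & Gc).
  apply (geometric_ext M b); auto.
  assert (L0 : 0 < L) by lra. set (N := 2 * L).
  assert (GaL : geometric L a) by (apply (geometric_mono M); auto; lra).
  assert (GbL : geometric L b) by (apply (geometric_mono M); auto; lra).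
  (* The coefficients of [c' - kappa - c / r - kappa c ^ 2]. *)
  set (Y := fun n => Cplus (inv_deriv c n) (Cplus (Cmult (RtoC (- kappa)) (unit_seq n))
     (Cplus (Cmult (RtoC (-1)) (shift c n)) (Cmult (RtoC (- kappa)) (convolution c c n))))).
  assert (Gd : geometric N (inv_deriv c)) by now apply geometric_inv_deriv.
  assert (Gu : geometric N unit_seq) by (apply geometric_unit; unfold N; lra).
  assert (Gs : geometric N (shift c)) by (apply (geometric_mono L); [unfold N; lra | now apply
    geometric_shift]).
  assert (Gcc : geometric N (convolution c c)) by now apply geometric_convolution.
  assert (GY : geometric N Y) by (solve_geometric; auto).
  assert (Ga : geometric N a) by (apply (geometric_mono L); auto; unfold N; lra).
  assert (GaY : geometric (2 * N) (convolution a Y)) by (apply geometric_convolution; auto;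
    unfold N; lra).
  assert (Y0 : forall n, Y n = RtoC 0).
  (* It suffices that [a * (a * Y)] vanishes, which is the determinant relation. *)
  { apply (convolution_eq0 a); auto. apply (convolution_eq0 a); auto.
    apply (inv_series_eq0 (2 * (2 * N))). unfold N; lra. apply geometric_convolution; auto.
      unfold N; lra.
    apply (geometric_mono L); auto; unfold N; lra.
    intros r Hr. unfold N in Hr.
    assert (EB : forall s, L < s -> inv_series b s = Cmult (inv_series a s) (inv_series c s)).
    { intros s Hs. rewrite <- (inv_series_convolution L) by auto. apply inv_series_ext. auto. }
    assert (EB' : inv_series (inv_deriv b) r = Cplus (Cmult (inv_series (inv_deriv a) r)
      (inv_series c r)) (Cmult (inv_series a r) (inv_series (inv_deriv c) r))).
    { apply (Cderive_unique (inv_series b) r). apply (inv_series_derive L); auto; lra.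
      apply (Cderive_ext_gt (fun s => Cmult (inv_series a s) (inv_series c s)) _ L). lra. intros;
        symmetry; auto.
      apply Cderive_mult; apply (inv_series_derive L); auto; lra. }
    assert (Det := determinant r ltac:(lra)).
    unfold deriv_u, deriv_v in Det.
    assert (Ba := geometric_inv_deriv L a L0 GaL). assert (Bb := geometric_inv_deriv L b L0 GbL).
    assert (Gb : geometric N b) by (apply (geometric_mono L); auto; unfold N; lra).
    assert (Gsb : geometric N (shift b)) by (apply geometric_shift; auto; unfold N; lra).
    fold N in Ba, Bb.
    rewrite !(inv_series_plus N), !(inv_series_scal N), inv_series_shift, EB', EB in Det;
      solve_geometric; auto; try (unfold N; lra).
    rewrite (inv_series_convolution (2 * N)), (inv_series_convolution N); auto; try (unfold N;
      lra).
    2: apply (geometric_mono L); auto; unfold N; lra.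
    unfold Y.
    rewrite !(inv_series_plus N), !(inv_series_scal N), inv_series_shift, inv_series_unit,
      (inv_series_convolution L);
      solve_geometric; auto; try (unfold N; lra).
    rewrite <- Det. rewrite !RtoC_opp.
    replace (RtoC (-1)) with (Copp (RtoC 1)) by (rewrite <- RtoC_opp; reflexivity). ring. }
  assert (k0 : RtoC (- kappa) <> RtoC 0) by (intros E; apply RtoC_inj in E; lra).
  apply (riccati_diverges kappa L c); auto.
  - specialize (Y0 O). unfold Y, convolution in Y0. rewrite sum_O in Y0. unfold inv_deriv, shift,
    unit_seq in Y0. simpl in Y0.
    destruct (Ceq_dec (Cplus (RtoC 1) (Cmult (c O) (c O))) 0) as [E|N0].
    + replace (Cmult (c O) (c O)) with (Cminus (Cplus (RtoC 1) (Cmult (c O) (c O))) (RtoC 1)) by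
      ring.
      rewrite E. rewrite <- RtoC_minus. f_equal; ring.
    + destruct (Cmult_neq_0 _ _ k0 N0). rewrite <- Y0. ring.
  - intros n. specialize (Y0 (S n)). unfold Y in Y0. unfold inv_deriv, shift, unit_seq in Y0.
    rewrite S_INR. rewrite RtoC_opp in *. rewrite RtoC_plus.
    replace (RtoC (-1)) with (Copp (RtoC 1)) in Y0 by (rewrite <- RtoC_opp; reflexivity).
    transitivity (Cminus (Cmult (Copp (Cplus (RtoC (INR n)) (RtoC 1))) (c n)) (RtoC 0)). 2: ring.
    rewrite <- Y0. rewrite RtoC_opp. ring.
Qed.
End Relation.

(** The order of the first nonzero coefficient cannot be [0] by [leading_zero], and
    multiplication by [r] lowers it. *)
Theorem expansion_unique M a b : 0 < M -> geometric M a -> geometric M b ->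
  (forall r, M < r -> expansion a b r = RtoC 0) -> forall n, a n = RtoC 0 /\ b n = RtoC 0.
Proof.
  intros HM Ha Hb H n. revert a b Ha Hb H.
  assert (P : forall a b, geometric M a -> geometric M b ->
    (forall r, M < r -> expansion a b r = RtoC 0) -> a O = RtoC 0 /\ b O = RtoC 0).
  { intros a b Ha Hb H. assert (a0 := leading_zero M a b HM Ha Hb H). split; auto.
    assert (E := leading_isotropic M a b HM Ha Hb H). rewrite a0 in E.
    destruct (Ceq_dec (b O) 0) as [|N]; auto. destruct (Cmult_neq_0 _ _ N N).
    rewrite <- E; ring. }
  induction n as [|n IH]; intros a b Ha Hb H. now apply P.
  destruct (P a b Ha Hb H) as (a0 & b0).
  apply (IH (fun n => a (S n)) (fun n => b (S n))); try now apply geometric_tail.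
  intros r Hr. specialize (H r Hr). unfold expansion in *.
  rewrite (inv_series_ext r a (shift (fun n => a (S n)))), (inv_series_ext r b (shift (fun n => b
    (S n)))), !inv_series_shift in H
    by (intros [|m]; auto).
  assert (r0 : RtoC r <> RtoC 0) by (intros E; apply RtoC_inj in E; lra).
  rewrite RtoC_inv in H by lra.
  transitivity (Cmult (RtoC r) (RtoC 0)). 2: ring. rewrite <- H. field. auto.
Qed.
End System.

(** * The Hankel functions of orders 0 and 1 *)

Lemma radius_of_factorial_bound (b : nat -> R) (K : R) : (forall k, Rabs (b k) <= K / INR (fact
  k)) ->
  forall x, Rbar_lt (Rabs x) (CV_radius b).
Proof.
  intros H x. apply Rbar_lt_le_trans with (Rabs x + 1). simpl; lra.
  assert (r0 : 0 <= Rabs x + 1) by (generalize (Rabs_pos x); lra).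
  destruct (CV_radius_bounded b) as [U _]. apply U.
  exists (K * exp (Rabs x + 1)). intros n.
  set (r := Rabs x + 1) in *.
  assert (f0 := INR_fact_lt_0 n).
  assert (HK : 0 <= K / INR (fact n)) by (eapply Rle_trans; [apply Rabs_pos | apply H]).
  rewrite Rabs_mult, <- RPow_abs, (Rabs_pos_eq r) by auto.
  apply Rle_trans with (K / INR (fact n) * r ^ n). apply Rmult_le_compat_r; auto. now apply
    pow_le.
  replace (K / INR (fact n) * r ^ n) with (K * (r ^ n / INR (fact n))) by (field; lra).
  apply Rmult_le_compat_l.
  - replace K with (K / INR (fact n) * INR (fact n)) by (field; lra). apply Rmult_le_pos; lra.
  - eapply Rle_trans. 2: apply (exp_ge_taylor r n r0).
    assert (P : forall m, 0 <= sum_f_R0 (fun k => r ^ k / INR (fact k)) m).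
    { intros m. apply cond_pos_sum. intros k. apply Rdiv_le_0_compat. now apply pow_le. apply
      INR_fact_lt_0. }
    destruct n as [|n]. simpl; lra. rewrite tech5. specialize (P n). lra.
Qed.

Lemma fact_ge_1 k : 1 <= INR (fact k).
Proof. apply (le_INR 1). apply lt_O_fact. Qed.

Lemma fact_ge k : INR k <= INR (fact k).
Proof.
  apply le_INR. induction k. simpl; lia. simpl. assert (H := lt_O_fact k). nia.
Qed.

Definition coef_J (n k : nat) : R := (-1) ^ k / (INR (fact k) * INR (fact (n + k))).
Definition coef_Y (n k : nat) : R :=
  (-1) ^ k * (digamma_S k + digamma_S (n + k)) / (INR (fact k) * INR (fact (n + k))).

Lemma fact_le_shift n k : INR (fact k) <= INR (fact (n + k)).
Proof. apply le_INR, fact_le. lia. Qed.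

Lemma coef_J_radius n x : Rbar_lt (Rabs x) (CV_radius (coef_J n)).
Proof.
  apply (radius_of_factorial_bound _ 1). intros k. unfold coef_J.
  assert (F := INR_fact_lt_0 k). assert (F' := INR_fact_lt_0 (n + k)).
  unfold Rdiv. rewrite Rabs_mult, pow_1_abs, Rmult_1_l, Rabs_pos_eq.
  rewrite Rinv_mult. rewrite Rmult_1_l. rewrite <- (Rmult_1_r (/ INR (fact k))) at 2.
  apply Rmult_le_compat_l. apply Rlt_le, Rinv_0_lt_compat; auto.
  rewrite <- Rinv_1. apply Rinv_le_contravar. lra. apply fact_ge_1.
  apply Rlt_le, Rinv_0_lt_compat, Rmult_lt_0_compat; auto.
Qed.

Lemma harmonic_S k : harmonic (S k) = harmonic k + / INR (S k).
Proof. unfold harmonic. rewrite sum_n_Sm by lia. reflexivity. Qed.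

Lemma digamma_SS k : digamma_S (S k) = digamma_S k + / INR (S k).
Proof. unfold digamma_S. rewrite harmonic_S. ring. Qed.

Lemma harmonic_bounds k : 0 <= harmonic k <= INR k.
Proof.
  induction k. unfold harmonic. rewrite sum_n_m_zero by lia. unfold zero; simpl; lra.
  rewrite harmonic_S, S_INR. assert (H := pos_INR k).
  assert (0 < / (INR k + 1) <= 1). split. apply Rinv_0_lt_compat; lra.
  rewrite <- Rinv_1. apply Rinv_le_contravar; lra. lra.
Qed.

Lemma coef_Y_radius n x : Rbar_lt (Rabs x) (CV_radius (coef_Y n)).
Proof.
  apply (radius_of_factorial_bound _ (2 * Rabs euler_gamma + 2 + INR n)). intros k. unfold coef_Y.
  assert (F := INR_fact_lt_0 k). assert (F' := INR_fact_lt_0 (n + k)).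
  unfold Rdiv. rewrite !Rabs_mult, pow_1_abs, Rmult_1_l, (Rabs_pos_eq (/ _)) by
    (apply Rlt_le, Rinv_0_lt_compat, Rmult_lt_0_compat; auto).
  rewrite Rinv_mult. rewrite (Rmult_comm (/ INR (fact k))), <- Rmult_assoc.
  apply Rmult_le_compat_r. apply Rlt_le, Rinv_0_lt_compat; auto.
  apply Rmult_le_reg_r with (INR (fact (n + k))); auto.
  rewrite Rmult_assoc, Rinv_l, Rmult_1_r by lra.
  assert (H1 := harmonic_bounds k). assert (H2 := harmonic_bounds (n + k)). rewrite plus_INR in
    H2.
  assert (A : Rabs (digamma_S k + digamma_S (n + k)) <= 2 * Rabs euler_gamma + (2 * INR k + INR
    n)).
  { unfold digamma_S.
    assert (P := Rabs_pos euler_gamma). assert (Q := pos_INR n).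
    assert (Q1 := Rle_abs euler_gamma). assert (Q2 := Rle_abs (- euler_gamma)). rewrite Rabs_Ropp
      in Q2.
    apply Rabs_le. lra. }
  eapply Rle_trans. exact A.
  assert (B := fact_ge_1 (n + k)). assert (B' : INR k <= INR (fact (n + k))).
  eapply Rle_trans. apply fact_ge. apply fact_le_shift.
  assert (P := Rabs_pos euler_gamma). assert (Q := pos_INR n). nra.
Qed.

Definition series_J n x := PSeries (coef_J n) x.
Definition series_Y n x := PSeries (coef_Y n) x.

Lemma S_fact k : INR (fact (S k)) = (INR k + 1) * INR (fact k).
Proof. change (fact (S k)) with (S k * fact k)%nat. rewrite mult_INR, S_INR. ring. Qed.

Lemma series_J0_derive t : is_derive (series_J 0) t (- series_J 1 t).
Proof.
  evar_last. apply is_derive_PSeries, coef_J_radius.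
  unfold series_J. rewrite <- PSeries_opp. apply PSeries_ext. intros k.
  unfold PS_derive, PS_opp, coef_J. change (opp ?x) with (- x).
  replace (0 + S k)%nat with (S k) by lia. replace (1 + k)%nat with (S k) by lia.
  rewrite S_fact. rewrite S_INR. simpl pow. assert (F := INR_fact_lt_0 k). assert (P := pos_INR
    k).
  field. lra.
Qed.

Lemma series_J1_derive t : is_derive (fun t => t * series_J 1 t) t (series_J 0 t).
Proof.
  apply (is_derive_ext (PSeries (PS_incr_1 (coef_J 1)))).
  intros s. apply PSeries_incr_1.
  evar_last. apply is_derive_PSeries. rewrite CV_radius_incr_1. apply coef_J_radius.
  apply PSeries_ext. intros k. unfold PS_derive. change (PS_incr_1 (coef_J 1) (S k)) with (coef_J
    1 k). unfold coef_J.
  replace (1 + k)%nat with (S k) by lia. replace (0 + k)%nat with k by lia.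
  rewrite S_fact, S_INR. assert (F := INR_fact_lt_0 k). assert (P := pos_INR k).
  field. lra.
Qed.

(** The digamma values at consecutive integers differ by a rational term, which is
    what the derivative of the logarithm in [bessel_Y] compensates. *)
Lemma series_Y0_derive t : is_derive (series_Y 0) t (Derive (series_Y 0) t) /\
  t * (Derive (series_Y 0) t + series_Y 1 t) = series_J 0 t - 1.
Proof.
  assert (D : is_derive (series_Y 0) t (PSeries (PS_derive (coef_Y 0)) t)) by apply
    is_derive_PSeries, coef_Y_radius.
  rewrite (is_derive_unique _ _ _ D). split; auto.
  unfold series_Y, series_J.
  assert (E0 : Rbar_lt (Rabs t) (CV_radius (PS_derive (coef_Y 0)))) by (rewrite CV_radius_derive;
    apply coef_Y_radius).
  rewrite <- PSeries_plus; try (apply CV_radius_inside; auto; apply coef_Y_radius).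
  rewrite (PSeries_decr_1 (coef_J 0)) by (apply CV_radius_inside, coef_J_radius).
  replace (coef_J 0 0) with 1 by (unfold coef_J; simpl; field).
  replace (1 + t * PSeries (PS_decr_1 (coef_J 0)) t - 1) with (t * PSeries (PS_decr_1 (coef_J 0))
    t) by ring.
  f_equal. apply PSeries_ext. intros k. unfold PS_derive, PS_plus, PS_decr_1, coef_J, coef_Y.
  change (plus ?x ?y) with (x + y).
  replace (0 + S k)%nat with (S k) by lia. replace (1 + k)%nat with (S k) by lia.
  rewrite !S_fact, digamma_SS, S_INR. simpl pow. assert (F := INR_fact_lt_0 k). assert (P :=
    pos_INR k).
  field. lra.
Qed.

Lemma series_Y1_derive t : is_derive (fun t => t * series_Y 1 t) t (series_Y 0 t + series_J 1 t).
Proof.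
  apply (is_derive_ext (PSeries (PS_incr_1 (coef_Y 1)))).
  intros s. apply PSeries_incr_1.
  evar_last. apply is_derive_PSeries. rewrite CV_radius_incr_1. apply coef_Y_radius.
  unfold series_Y, series_J. rewrite <- PSeries_plus; try (apply CV_radius_inside; apply
    coef_Y_radius || apply coef_J_radius).
  apply PSeries_ext. intros k. unfold PS_derive, PS_plus. change (PS_incr_1 (coef_Y 1) (S k))
    with (coef_Y 1 k). unfold coef_J, coef_Y.
  change (plus ?x ?y) with (x + y).
  replace (1 + k)%nat with (S k) by lia. replace (0 + k)%nat with k by lia.
  rewrite S_fact, digamma_SS, S_INR. assert (F := INR_fact_lt_0 k). assert (P := pos_INR k).
  field. lra.
Qed.

Lemma J0_eq x : bessel_J 0 x = series_J 0 (x ^ 2 / 4).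
Proof. unfold bessel_J. rewrite pow_O, Rmult_1_l. reflexivity. Qed.
Lemma J1_eq x : bessel_J 1 x = x / 2 * series_J 1 (x ^ 2 / 4).
Proof. unfold bessel_J. rewrite pow_1. reflexivity. Qed.
Lemma Y0_eq x : bessel_Y 0 x = 2 / PI * ln (x / 2) * bessel_J 0 x - series_Y 0 (x ^ 2 / 4) / PI.
Proof.
  unfold bessel_Y. rewrite pow_O. change (PSeries _ (x ^ 2 / 4)) with (series_Y 0 (x ^ 2 / 4)).
  field. apply PI_neq0.
Qed.
Lemma Y1_eq x : 0 < x -> bessel_Y 1 x =
  - 2 / (PI * x) + 2 / PI * ln (x / 2) * bessel_J 1 x - x / 2 * series_Y 1 (x ^ 2 / 4) / PI.
Proof.
  intros Hx. unfold bessel_Y. rewrite pow_1, sum_O.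
  change (PSeries _ (x ^ 2 / 4)) with (series_Y 1 (x ^ 2 / 4)).
  simpl. assert (P := PI_neq0). field. repeat split; (lra || auto).
Qed.

Lemma sq_derive x : is_derive (fun x => x ^ 2 / 4) x (x / 2).
Proof. auto_derive; auto. field. Qed.

Lemma J0_derive x : is_derive (bessel_J 0) x (- bessel_J 1 x).
Proof.
  apply (is_derive_ext (fun x => series_J 0 (x ^ 2 / 4))). intros; now rewrite J0_eq.
  rewrite J1_eq. evar_last. apply (is_derive_comp (series_J 0)). apply series_J0_derive. apply
    sq_derive.
  change (scal ?x ?y) with (x * y). ring.
Qed.

Lemma J1_derive x : 0 < x -> is_derive (bessel_J 1) x (bessel_J 0 x - bessel_J 1 x / x).
Proof.
  intros Hx.
  apply (is_derive_ext_loc (fun x => 2 / x * (x ^ 2 / 4 * series_J 1 (x ^ 2 / 4)))).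
  { apply (filter_imp (fun y => 0 < y)). intros y Hy. rewrite J1_eq. as_R_eq. field. lra. now
    apply (open_gt 0). }
  assert (D : is_derive (fun x => 2 / x) x (- 2 / x ^ 2)) by (auto_derive; [lra | field; lra]).
  assert (D' : is_derive (fun x => x ^ 2 / 4 * series_J 1 (x ^ 2 / 4)) x (x / 2 * series_J 0 (x ^
    2 / 4))).
  { apply (is_derive_comp (fun t => t * series_J 1 t)). apply series_J1_derive. apply sq_derive. }
  replace (bessel_J 0 x - bessel_J 1 x / x) with
   (- 2 / x ^ 2 * (x ^ 2 / 4 * series_J 1 (x ^ 2 / 4)) + 2 / x * (x / 2 * series_J 0 (x ^ 2 /
     4))).
  exact (is_derive_mult _ _ x _ _ D D' Rmult_comm).
  rewrite J1_eq, J0_eq. field. lra.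
Qed.

Lemma Y0_derive x : 0 < x -> is_derive (bessel_Y 0) x (- bessel_Y 1 x).
Proof.
  intros Hx.
  apply (is_derive_ext (fun x => 2 / PI * ln (x / 2) * bessel_J 0 x - series_Y 0 (x ^ 2 / 4) /
    PI)).
  intros; now rewrite Y0_eq.
  destruct (series_Y0_derive (x ^ 2 / 4)) as (D & E).
  assert (P := PI_neq0).
  assert (D1 : is_derive (fun x => 2 / PI * ln (x / 2)) x (2 / PI / x)).
  { auto_derive. lra. field. repeat split; (lra || auto). }
  assert (D2 : is_derive (fun x => / PI * series_Y 0 (x ^ 2 / 4)) x (/ PI * (x / 2 * Derive
    (series_Y 0) (x ^ 2 / 4)))).
  { apply is_derive_scal. apply (is_derive_comp (series_Y 0)); auto. apply sq_derive. }
  apply (is_derive_ext (fun x => 2 / PI * ln (x / 2) * bessel_J 0 x - / PI * series_Y 0 (x ^ 2 /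
    4))).
  intros t. as_R_eq. field. auto.
  replace (- bessel_Y 1 x) with ((2 / PI / x * bessel_J 0 x + 2 / PI * ln (x / 2) * (- bessel_J 1
    x))
    - / PI * (x / 2 * Derive (series_Y 0) (x ^ 2 / 4))).
  exact (is_derive_minus _ _ x _ _ (is_derive_mult _ _ x _ _ D1 (J0_derive x) Rmult_comm) D2).
  rewrite Y1_eq, J1_eq, J0_eq by auto.
  replace (Derive (series_Y 0) (x ^ 2 / 4)) with ((series_J 0 (x ^ 2 / 4) - 1) / (x ^ 2 / 4) -
    series_Y 1 (x ^ 2 / 4)).
  field. repeat split; (lra || auto).
  rewrite <- E. field. lra.
Qed.

Lemma Y1_derive x : 0 < x -> is_derive (bessel_Y 1) x (bessel_Y 0 x - bessel_Y 1 x / x).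
Proof.
  intros Hx. assert (P := PI_neq0).
  assert (D1 : is_derive (fun x => 2 / PI * ln (x / 2)) x (2 / PI / x)).
  { auto_derive. lra. field. repeat split; (lra || auto). }
  assert (D2 : is_derive (fun x => 2 / (PI * x)) x (- 2 / (PI * x ^ 2))).
  { auto_derive. apply Rmult_integral_contrapositive; split; [auto | lra]. field. repeat split;
    (lra || auto). }
  assert (D3 : is_derive (fun x => x ^ 2 / 4 * series_Y 1 (x ^ 2 / 4)) x (x / 2 * (series_Y 0 (x
    ^ 2 / 4) + series_J 1 (x ^ 2 / 4)))).
  { apply (is_derive_comp (fun t => t * series_Y 1 t)). apply series_Y1_derive. apply sq_derive. }
  apply (is_derive_ext_loc (fun x => 2 / PI * ln (x / 2) * bessel_J 1 x
    - (2 / (PI * x) + 2 / (PI * x) * (x ^ 2 / 4 * series_Y 1 (x ^ 2 / 4))))).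
  { apply (filter_imp (fun y => 0 < y)). intros y Hy. rewrite Y1_eq by auto. as_R_eq. field.
    repeat split; (lra || auto). now apply (open_gt 0). }
  replace (bessel_Y 0 x - bessel_Y 1 x / x) with
   ((2 / PI / x * bessel_J 1 x + 2 / PI * ln (x / 2) * (bessel_J 0 x - bessel_J 1 x / x)) -
    (- 2 / (PI * x ^ 2) + (- 2 / (PI * x ^ 2) * (x ^ 2 / 4 * series_Y 1 (x ^ 2 / 4))
       + 2 / (PI * x) * (x / 2 * (series_Y 0 (x ^ 2 / 4) + series_J 1 (x ^ 2 / 4)))))).
  exact (is_derive_minus _ _ x _ _ (is_derive_mult _ _ x _ _ D1 (J1_derive x Hx) Rmult_comm)
    (is_derive_plus _ _ x _ _ D2 (is_derive_mult _ _ x _ _ D2 D3 Rmult_comm))).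
  rewrite Y0_eq, Y1_eq, J1_eq by auto. field. repeat split; (lra || auto).
Qed.

(** The function [x ^ 2 (J0 ^ 2 + J1 ^ 2)] has derivative [2 x J0 ^ 2], so it is
    nondecreasing; a common zero would force [J0] to vanish on an interval
    ending at [0], where its value is [1]. *)
Lemma J_not_both_zero x : 0 < x -> bessel_J 0 x = 0 -> bessel_J 1 x = 0 -> False.
Proof.
  intros Hx H0 H1.
  (* The weight [x ^ 2] absorbs the damping term of the Bessel equation. *)
  set (E := fun x => x ^ 2 * (bessel_J 0 x ^ 2 + bessel_J 1 x ^ 2)).
  assert (DE : forall y, 0 < y -> is_derive E y (2 * y * bessel_J 0 y ^ 2)).
  { intros y Hy. unfold E. assert (A := J0_derive y). assert (B := J1_derive y Hy).
    auto_derive. repeat split; eexists; eauto.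
    change (fun x => bessel_J 0 x) with (bessel_J 0). change (fun x => bessel_J 1 x) with
      (bessel_J 1).
    rewrite (is_derive_unique _ _ _ A), (is_derive_unique _ _ _ B). field. lra. }
  assert (Mono : forall y, 0 < y -> y <= x -> E y = 0).
  { intros y Hy Hyx. apply Rle_antisym.
    - destruct (Rle_lt_or_eq_dec y x Hyx) as [L| ->]. 2: unfold E; rewrite H0, H1; lra.
      destruct (MVT_gen E y x (fun z => 2 * z * bessel_J 0 z ^ 2)) as (c & Hc & EE).
      + intros z. rewrite Rmin_left, Rmax_right by lra. intros. apply DE; lra.
      + intros z. rewrite Rmin_left, Rmax_right by lra. intros.
        apply continuity_pt_filterlim. apply (ex_derive_continuous (V := R_NormedModule)).
        eexists; apply DE; lra.
      + rewrite Rmin_left, Rmax_right in Hc by lra.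
        assert (E x = 0) by (unfold E; rewrite H0, H1; ring).
        assert (0 <= 2 * c * bessel_J 0 c ^ 2 * (x - y)).
        { apply Rmult_le_pos; try lra. apply Rmult_le_pos; try lra. apply pow2_ge_0. }
        lra.
    - unfold E. apply Rmult_le_pos. apply pow2_ge_0. generalize (pow2_ge_0 (bessel_J 0 y))
      (pow2_ge_0 (bessel_J 1 y)); lra. }
  assert (Z : forall y, 0 < y -> y <= x -> bessel_J 0 y = 0).
  { intros y Hy Hyx. specialize (Mono y Hy Hyx). unfold E in Mono.
    apply Rmult_integral in Mono. destruct Mono as [M|M]. apply pow_nonzero in M; lra.
    generalize (pow2_ge_0 (bessel_J 0 y)) (pow2_ge_0 (bessel_J 1 y)); intros.
    destruct (Req_dec (bessel_J 0 y) 0) as [|N]; auto. apply (pow_nonzero _ 2) in N. lra. }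
  assert (C0 : continuous (bessel_J 0) 0).
  { apply (ex_derive_continuous (V := R_NormedModule)). eexists; apply J0_derive. }
  assert (J00 : bessel_J 0 0 = 1).
  { rewrite J0_eq. replace (0 ^ 2 / 4) with 0 by field. unfold series_J. rewrite PSeries_0.
    unfold coef_J; simpl. field. }
  specialize (C0 (fun y => 0 < y)). rewrite J00 in C0.
  destruct C0 as (d & Hd). apply (open_gt 0 1). lra.
  assert (dp := cond_pos d).
  set (y := Rmin x (d / 2)).
  assert (y0 : 0 < y) by (apply Rmin_glb_lt; lra).
  assert (y1 : y <= x) by apply Rmin_l. assert (y2 : y <= d / 2) by apply Rmin_r.
  specialize (Hd y). rewrite (Z y) in Hd by auto. apply (Rlt_irrefl 0), Hd.
  unfold ball; simpl. unfold AbsRing_ball, abs, minus, plus, opp; simpl. rewrite Rabs_pos_eq; lra.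
Qed.

Lemma hankel_system kappa r : 0 < kappa -> 0 < r ->
  is_Cderive (fun s => hankel1 0 (kappa * s)) r (Cmult (RtoC (- kappa)) (hankel1 1 (kappa * r)))
    /\
  is_Cderive (fun s => hankel1 1 (kappa * s)) r
    (Cminus (Cmult (RtoC kappa) (hankel1 0 (kappa * r))) (Cdiv (hankel1 1 (kappa * r)) (RtoC r))).
Proof.
  intros Hk Hr. assert (P : 0 < kappa * r) by now apply Rmult_lt_0_compat.
  assert (K : is_derive (fun s => kappa * s) r kappa) by (auto_derive; auto; ring).
  assert (L : forall f l, is_derive f (kappa * r) l -> is_derive (fun s => f (kappa * s)) r
    (kappa * l)).
  { intros f l Hf. exact (is_derive_comp f (fun s => kappa * s) r _ _ Hf K). }
  unfold Cdiv. rewrite <- RtoC_inv by lra.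
  split; split; cbn [fst snd Cmult Cminus Cplus Copp RtoC hankel1].
  - replace (_ - _) with (kappa * - bessel_J 1 (kappa * r)) by ring. apply L, J0_derive.
  - replace (_ + _) with (kappa * - bessel_Y 1 (kappa * r)) by ring. apply (L (bessel_Y 0)),
    Y0_derive; auto.
  - replace (_ + _) with (kappa * (bessel_J 0 (kappa * r) - bessel_J 1 (kappa * r) / (kappa *
    r))) by (field; lra).
    apply L, J1_derive; auto.
  - replace (_ + _) with (kappa * (bessel_Y 0 (kappa * r) - bessel_Y 1 (kappa * r) / (kappa *
    r))) by (field; lra).
    apply (L (bessel_Y 1)), Y1_derive; auto.
Qed.

Lemma hankel_not_both_zero x : 0 < x ->
  hankel1 0 x = RtoC 0 -> hankel1 1 x = RtoC 0 -> False.
Proof.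
  intros Hx E0 E1. injection E0 as A _. injection E1 as B _. exact (J_not_both_zero x Hx A B).
Qed.

(** * Compactness of sets of coefficient sequences *)

Section Refine.
Context {T : Type}.

Definition limsup_along (f : T -> R) (F : (T -> Prop) -> Prop) : R :=
  real (Lub_Rbar (fun t => ~ F (fun x => f x < t))).

(** The filter generated by [F] and the sets where [f] is close to its upper limit
    along [F]. *)
Definition refine (f : T -> R) (F : (T -> Prop) -> Prop) (P : T -> Prop) : Prop :=
  exists eps : posreal, F (fun x => Rabs (f x - limsup_along f F) < eps -> P x).

Lemma refine_finer f F {FF : Filter F} P : F P -> refine f F P.
Proof. intros H. exists (mkposreal 1 Rlt_0_1). apply (filter_imp P); auto. Qed.

Lemma refine_filterlim f F {FF : Filter F} : filterlim f (refine f F) (locally (limsup_along f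
  F)).
Proof.
  intros P (eps & H). exists eps. apply filter_forall. intros x Hx. apply H. exact Hx.
Qed.

(** This is what makes [refine f F] a proper filter: [f] is frequently, along [F],
    close to its upper limit. *)
Lemma limsup_frequently f F {FF : ProperFilter F} (B : R) (eps : posreal) :
  F (fun x => Rabs (f x) <= B) -> ~ F (fun x => ~ Rabs (f x - limsup_along f F) < eps).
Proof.
  intros HB HF. assert (ep := cond_pos eps).
  set (E := fun t => ~ F (fun x => f x < t)).
  assert (L : is_lub_Rbar E (Lub_Rbar E)) by apply Lub_Rbar_correct.
  assert (E1 : E (- B - 1)).
  { intros H. destruct (filter_ex _ (filter_and _ _ HB H)) as (x & H1 & H2).
    apply Rabs_le_between in H1. lra. }
  assert (U : is_ub_Rbar E (B + 1)).
  { intros t Ht. simpl. destruct (Rle_lt_dec t (B + 1)); auto. exfalso. apply Ht.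
    revert HB. apply filter_imp. intros x H. generalize (Rle_abs (f x)); lra. }
  destruct L as [L1 L2]. assert (L2' := L2). specialize (L2 _ U). assert (L3 := L1 _ E1).
  unfold limsup_along in HF. fold E in HF.
  destruct (Lub_Rbar E) as [l| |]; simpl in *; try easy.
  assert (A : F (fun x => f x < l + eps)).
  { apply NNPP. intros N. specialize (L1 (l + eps) N). simpl in L1. lra. }
  assert (A' : F (fun x => f x < l - eps / 2)).
  { generalize (filter_and _ _ A HF). apply filter_imp. intros x [H1 H2].
    apply Rnot_lt_le in H2. unfold Rabs in H2. destruct (Rcase_abs (f x - l)); lra. }
  assert (L4 : is_ub_Rbar E (l - eps / 2)).
  { intros t Ht. simpl. destruct (Rle_lt_dec t (l - eps / 2)); auto. exfalso. apply Ht.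
    revert A'. apply filter_imp. intros; lra. }
  assert (L5 : Rbar_le l (l - eps / 2)) by (apply (L2' (Finite (l - eps / 2))); exact L4).
  simpl in L5; lra.
Qed.

Lemma refine_filter f F {FF : Filter F} : Filter (refine f F).
Proof.
  split.
  - apply refine_finer; auto. apply filter_true.
  - intros P Q (e1 & H1) (e2 & H2).
    assert (m0 : 0 < Rmin e1 e2) by (apply Rmin_glb_lt; apply cond_pos).
    exists (mkposreal _ m0). simpl. generalize (filter_and _ _ H1 H2). apply filter_imp.
    intros x [A B] Hx. split.
    apply A. eapply Rlt_le_trans. exact Hx. apply Rmin_l.
    apply B. eapply Rlt_le_trans. exact Hx. apply Rmin_r.
  - intros P Q H (e & HP). exists e. revert HP. apply filter_imp. auto.
Qed.

Lemma refine_proper f F {FF : ProperFilter F} B :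
  F (fun x => Rabs (f x) <= B) -> ProperFilter (refine f F).
Proof.
  intros HB. split. 2: apply refine_filter, FF.
  intros P (e & HP). apply NNPP. intros N.
  apply (limsup_frequently f F B e HB). revert HP. apply filter_imp.
  intros x Hx Hl. apply N. exists x. auto.
Qed.

Fixpoint refinements (f : nat -> T -> R) F (n : nat) : (T -> Prop) -> Prop :=
  match n with O => F | S m => refine (f m) (refinements f F m) end.

(** A diagonal extraction with filters in place of subsequences: refine once for each
    coordinate and take the union of the increasing chain of filters. *)
Lemma simultaneous_limits (f : nat -> T -> R) F {FF : ProperFilter F} :
  (forall j, exists B, F (fun x => Rabs (f j x) <= B)) ->
  exists (G : (T -> Prop) -> Prop) (l : nat -> R), ProperFilter G /\ (forall P, F P -> G P) /\
    forall j, filterlim (f j) G (locally (l j)).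
Proof.
  intros HB.
  assert (Pr : forall n, ProperFilter (refinements f F n) /\ forall P, F P -> refinements f F n
    P).
  { induction n as [|n [IH1 IH2]]. auto. simpl. split.
    - destruct (HB n) as (B & H). apply (refine_proper _ _ B). auto.
    - intros P HP. apply refine_finer. apply IH1. auto. }
  assert (Mono : forall m n P, (m <= n)%nat -> refinements f F m P -> refinements f F n P).
  { intros m n P Hmn H. induction Hmn; auto. simpl. apply refine_finer; auto. apply Pr. }
  exists (fun P => exists n, refinements f F n P), (fun j => limsup_along (f j) (refinements f F
    j)).
  repeat split.
  - intros P (n & H). destruct (Pr n) as [Q _]. apply (filter_ex P H).
  - exists O. apply filter_true.
  - intros P Q (m & HP) (n & HQ). exists (max m n). destruct (Pr (max m n)) as [A _]. apply
    filter_and.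
    apply (Mono m); auto. lia. apply (Mono n); auto. lia.
  - intros P Q H (n & HP). exists n. destruct (Pr n) as [A _]. revert HP. now apply filter_imp.
  - intros P HP. exists O. exact HP.
  - intros j P HP. exists (S j). destruct (Pr j) as [A _]. exact (refine_filterlim (f j) _ P HP).
Qed.

Lemma PSeries_remainder (b : nat -> R) K M r N : 0 < M -> M < r -> (forall n, Rabs (b n) <= K * M
  ^ n) ->
  Rabs (PSeries b (/ r) - sum_f_R0 (fun k => b k * (/ r) ^ k) N) <= K * ((M / r) ^ S N / (1 - M /
    r)).
Proof.
  intros HM Hr Hb.
  assert (q1 : 0 <= M / r < 1).
  { split. apply Rdiv_le_0_compat; lra. apply Rmult_lt_reg_r with r. lra. field_simplify; lra. }
  set (q := M / r) in *.
  assert (T0 : forall n, Rabs (b n * (/ r) ^ n) <= K * q ^ n).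
  { intros n. rewrite Rabs_mult. rewrite (Rabs_pos_eq ((/ r) ^ n)) by (apply pow_le, Rlt_le,
    Rinv_0_lt_compat; lra).
    unfold q, Rdiv. rewrite Rpow_mult_distr, <- Rmult_assoc. apply Rmult_le_compat_r; auto.
    apply pow_le, Rlt_le, Rinv_0_lt_compat; lra. }
  assert (Gq : ex_series (fun n => K * q ^ n)).
  { apply (ex_series_scal (V := R_NormedModule) K (fun n => q ^ n)). apply ex_series_geom.
    rewrite Rabs_pos_eq; lra. }
  assert (Ga : ex_series (fun n => Rabs (b n * (/ r) ^ n))).
  { apply (ex_series_le (V := R_CompleteNormedModule) _ (fun n => K * q ^ n)); auto.
    intros n. unfold norm; simpl. unfold abs; simpl. rewrite Rabs_Rabsolu. auto. }
  unfold PSeries. rewrite (Series_incr_n _ (S N)) by (lia || now apply ex_series_Rabs). simpl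
    pred.
  replace (_ + _ - _) with (Series (fun k => b (S N + k)%nat * (/ r) ^ (S N + k))) by ring.
  assert (Ga' : ex_series (fun n => Rabs (b (S N + n)%nat * (/ r) ^ (S N + n)))).
  { apply (ex_series_incr_n (fun n => Rabs (b n * (/ r) ^ n)) (S N)). exact Ga. }
  eapply Rle_trans. apply Series_Rabs. exact Ga'.
  eapply Rle_trans. apply (Series_le _ (fun n => (K * q ^ S N) * q ^ n)).
  - intros n. split. apply Rabs_pos. eapply Rle_trans. apply T0. rewrite pow_add. right; ring.
  - apply (ex_series_scal (V := R_NormedModule) (K * q ^ S N) (fun n => q ^ n)). apply
    ex_series_geom. rewrite Rabs_pos_eq; lra.
  - rewrite Series_scal_l, Series_geom by (rewrite Rabs_pos_eq; lra). right. field. lra.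
Qed.

(** Dominated convergence for power series, along an arbitrary filter. *)
Lemma PSeries_dominated (G : (T -> Prop) -> Prop) {FG : ProperFilter G} (b : T -> nat -> R) (l :
  nat -> R) K M r :
  0 < M -> M < r -> G (fun t => forall n, Rabs (b t n) <= K * M ^ n) ->
  (forall n, Rabs (l n) <= K * M ^ n) ->
  (forall n, filterlim (fun t => b t n) G (locally (l n))) ->
  filterlim (fun t => PSeries (b t) (/ r)) G (locally (PSeries l (/ r))).
Proof.
  intros HM Hr Hb Hl Hlim.
  assert (q1 : 0 <= M / r < 1).
  { split. apply Rdiv_le_0_compat; lra. apply Rmult_lt_reg_r with r. lra. field_simplify; lra. }
  apply filterlim_locally. intros eps. assert (ep := cond_pos eps).
  assert (Z : is_lim_seq (fun N => K * ((M / r) ^ S N / (1 - M / r))) 0).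
  { replace (Finite 0) with (Rbar_mult (K * / (1 - M / r)) 0) by (simpl; f_equal; ring).
    apply (is_lim_seq_ext (fun N => K * / (1 - M / r) * (M / r) ^ S N)). intros; field; lra.
    apply is_lim_seq_scal_l. apply (is_lim_seq_incr_1 (fun n => (M / r) ^ n)), is_lim_seq_geom.
    rewrite Rabs_pos_eq; lra. }
  (* Two remainders after rank [N] and a finite sum of [N + 1] terms. *)
  assert (e3 : 0 < eps / 3) by lra.
  apply is_lim_seq_spec in Z. destruct (Z (mkposreal _ e3)) as (N & HN). specialize (HN N (le_n
    N)). cbn [pos] in HN.
  rewrite Rminus_0_r in HN.
  assert (S0 : filterlim (fun t => sum_f_R0 (fun k => b t k * (/ r) ^ k) N) G
     (locally (sum_f_R0 (fun k => l k * (/ r) ^ k) N))).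
  { assert (Tm : forall n, filterlim (fun t => b t n * (/ r) ^ n) G (locally (l n * (/ r) ^ n))).
    { intros n. apply (filterlim_comp _ _ _ (fun t => b t n) (fun x => x * (/ r) ^ n) G (locally
      (l n))); auto.
      apply (continuous_mult (K := R_AbsRing) (fun x : R => x) (fun _ => (/ r) ^ n) (l n)).
      apply continuous_id. apply continuous_const. }
    clear HN. induction N; simpl sum_f_R0. apply Tm.
    eapply filterlim_comp_2. exact IHN. exact (Tm (S N)).
    exact (filterlim_plus (V := R_NormedModule) _ _). }
  apply filterlim_locally with (eps := mkposreal _ e3) in S0.
  generalize (filter_and _ _ Hb S0). apply filter_imp. intros t [H1 H2].
  assert (A1 := PSeries_remainder (b t) K M r N HM Hr H1).
  assert (A2 := PSeries_remainder l K M r N HM Hr Hl).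
  assert (A3 := Rle_abs (K * ((M / r) ^ S N / (1 - M / r)))).
  change (Rabs (sum_f_R0 (fun k => b t k * (/ r) ^ k) N - sum_f_R0 (fun k => l k * (/ r) ^ k) N)
    < eps / 3) in H2.
  change (Rabs (PSeries (b t) (/ r) - PSeries l (/ r)) < eps).
  revert HN A1 A2 A3 H2. generalize (K * ((M / r) ^ S N / (1 - M / r))). simpl.
  intros x HN A1 A2 A3 H2.
  apply Rabs_le_between in A1, A2. apply Rabs_lt_between in H2. apply Rabs_lt_between. lra.
Qed.
End Refine.

Section Stability.
Context {T : Type}.

Lemma filterlim_Rabs_le (G : (T -> Prop) -> Prop) {FG : ProperFilter G} (f : T -> R) l B :
  filterlim f G (locally l) -> G (fun t => Rabs (f t) <= B) -> Rabs l <= B.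
Proof.
  intros H HB. apply Rnot_lt_le. intros N.
  assert (e : 0 < Rabs l - B) by lra.
  apply filterlim_locally with (eps := mkposreal _ e) in H.
  destruct (filter_ex _ (filter_and _ _ H HB)) as (t & H1 & H2).
  change (Rabs (f t - l) < Rabs l - B) in H1.
  assert (A := Rabs_triang_inv l (f t)). rewrite Rabs_minus_sym in A. lra.
Qed.

Lemma filterlim_lincomb (G : (T -> Prop) -> Prop) {FG : Filter G} (f g : T -> R) (x y l m : R) :
  filterlim f G (locally l) -> filterlim g G (locally m) ->
  filterlim (fun t => x * f t + y * g t) G (locally (x * l + y * m)).
Proof.
  intros Hf Hg. eapply filterlim_comp_2 with (f := fun t => x * f t) (g := fun t => y * g t).
  - eapply filterlim_comp. exact Hf. exact (filterlim_scal_r (V := R_NormedModule) x l).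
  - eapply filterlim_comp. exact Hg. exact (filterlim_scal_r (V := R_NormedModule) y m).
  - exact (filterlim_plus (V := R_NormedModule) _ _).
Qed.

Lemma simultaneous_limits_C (a : T -> nat -> C) K M F {FF : ProperFilter F} :
  F (fun t => forall n, Cmod (a t n) <= K * M ^ n) ->
  exists (G : (T -> Prop) -> Prop) (l : nat -> C), ProperFilter G /\ (forall P, F P -> G P) /\
    forall j, filterlim (fun t => fst (a t j)) G (locally (fst (l j))) /\
              filterlim (fun t => snd (a t j)) G (locally (snd (l j))).
Proof.
  intros HB.
  destruct (simultaneous_limits (fun n t => fst (a t n)) F) as (G1 & l1 & P1 & F1 & L1).
  { intros j. exists (K * M ^ j). revert HB. apply filter_imp. intros t H.
    eapply Rle_trans. apply fst_le_Cmod. apply H. }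
  destruct (simultaneous_limits (fun n t => snd (a t n)) G1) as (G2 & l2 & P2 & F2 & L2).
  { intros j. exists (K * M ^ j). apply F1. revert HB. apply filter_imp. intros t H.
    eapply Rle_trans. apply snd_le_Cmod. apply H. }
  exists G2, (fun j => (l1 j, l2 j)). split; [|split]; auto. intros j. split.
  intros P HP. apply F2. exact (L1 j P HP). exact (L2 j).
Qed.

Lemma inv_series_dominated (G : (T -> Prop) -> Prop) {FG : ProperFilter G} (a : T -> nat -> C) (l
  : nat -> C) K M r :
  0 < M -> M < r -> G (fun t => forall n, Cmod (a t n) <= K * M ^ n) ->
  (forall j, filterlim (fun t => fst (a t j)) G (locally (fst (l j))) /\
              filterlim (fun t => snd (a t j)) G (locally (snd (l j)))) ->
  geometric M l /\
  filterlim (fun t => fst (inv_series (a t) r)) G (locally (fst (inv_series l r))) /\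
  filterlim (fun t => snd (inv_series (a t) r)) G (locally (snd (inv_series l r))).
Proof.
  intros HM Hr HB HL.
  assert (B1 : forall n, Rabs (fst (l n)) <= K * M ^ n).
  { intros n. apply (filterlim_Rabs_le G (fun t => fst (a t n))). apply HL.
    revert HB. apply filter_imp. intros t H. eapply Rle_trans. apply fst_le_Cmod. apply H. }
  assert (B2 : forall n, Rabs (snd (l n)) <= K * M ^ n).
  { intros n. apply (filterlim_Rabs_le G (fun t => snd (a t n))). apply HL.
    revert HB. apply filter_imp. intros t H. eapply Rle_trans. apply snd_le_Cmod. apply H. }
  split; [|split].
  - exists (2 * K). intros n. eapply Rle_trans. apply Cmod_le_abs. specialize (B1 n); specialize
    (B2 n); lra.
  - apply (PSeries_dominated G (fun t n => fst (a t n)) (fun n => fst (l n)) K M r); auto.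
    revert HB. apply filter_imp. intros t H n. eapply Rle_trans. apply fst_le_Cmod. apply H.
    intros n. apply HL.
  - apply (PSeries_dominated G (fun t n => snd (a t n)) (fun n => snd (l n)) K M r); auto.
    revert HB. apply filter_imp. intros t H n. eapply Rle_trans. apply snd_le_Cmod. apply H.
    intros n. apply HL.
Qed.

Section Sys.
Variable kappa : R.
Variables u v : R -> C.
Hypothesis Hk : 0 < kappa.
Hypothesis du : forall r, 0 < r -> is_Cderive u r (Cmult (RtoC (- kappa)) (v r)).
Hypothesis dv : forall r, 0 < r -> is_Cderive v r (Cminus (Cmult (RtoC kappa) (u r)) (Cdiv (v r)
  (RtoC r))).
Hypothesis uv0 : forall r, 0 < r -> u r = RtoC 0 -> v r = RtoC 0 -> False.

(** A quantitative form of [expansion_unique]: coefficients with a common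
    geometric bound and not tending to zero would have a nonzero cluster point,
    and the expansion of that point would vanish. *)
Lemma expansion_stable F {FF : ProperFilter F} (a b : T -> nat -> C) K M N delta :
  0 < M -> 0 < delta ->
  F (fun t => forall n, Cmod (a t n) <= K * M ^ n) ->
  F (fun t => forall n, Cmod (b t n) <= K * M ^ n) ->
  (forall r eps, M < r -> 0 < eps -> F (fun t => Cmod (expansion u v (a t) (b t) r) < eps)) ->
  F (fun t => delta <= sum_n (fun j => Cmod (a t j) + Cmod (b t j)) N) -> False.
Proof.
  intros HM Hd Ha Hb Hlin Hsum.
  destruct (simultaneous_limits_C a K M F Ha) as (G1 & al & P1 & F1 & L1).
  destruct (simultaneous_limits_C b K M G1 (F1 _ Hb)) as (G & bl & P & F2 & L2).
  assert (L1' : forall j, filterlim (fun t => fst (a t j)) G (locally (fst (al j))) /\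
              filterlim (fun t => snd (a t j)) G (locally (snd (al j)))).
  { intros j. destruct (L1 j) as (A & B). split; intros Q HQ; apply F2; auto.
    exact (A Q HQ). exact (B Q HQ). }
  assert (FG : forall Q, F Q -> G Q) by auto.
  destruct (inv_series_dominated G a al K M (M + 1) HM ltac:(lra) (FG _ Ha) L1') as (Ga & _).
  destruct (inv_series_dominated G b bl K M (M + 1) HM ltac:(lra) (FG _ Hb) L2) as (Gb & _).
  assert (Z : forall n, al n = RtoC 0 /\ bl n = RtoC 0).
  { apply (expansion_unique kappa u v Hk du dv uv0 M); auto. intros r Hr.
    destruct (inv_series_dominated G a al K M r HM Hr (FG _ Ha) L1') as (_ & A1 & A2).
    destruct (inv_series_dominated G b bl K M r HM Hr (FG _ Hb) L2) as (_ & B1 & B2).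
    assert (Small : forall x, (forall eps, 0 < eps -> Rabs x <= eps) -> x = 0).
    { intros x Hx. destruct (Req_dec x 0); auto. assert (0 < Rabs x) by now apply Rabs_pos_lt.
      specialize (Hx (Rabs x / 2)). lra. }
    assert (C1 := filterlim_lincomb G _ _ 1 1 _ _ (filterlim_lincomb G _ _ (fst (u r)) (- snd (u
      r)) _ _ A1 A2)
        (filterlim_lincomb G _ _ (fst (v r)) (- snd (v r)) _ _ B1 B2)).
    assert (C2 := filterlim_lincomb G _ _ 1 1 _ _ (filterlim_lincomb G _ _ (snd (u r)) (fst (u
      r)) _ _ A1 A2)
        (filterlim_lincomb G _ _ (snd (v r)) (fst (v r)) _ _ B1 B2)).
    apply injective_projections; apply Small; intros eps He.
    - eapply filterlim_Rabs_le. apply P.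
      + revert C1. match goal with |- filterlim _ _ (locally ?x) -> _ => replace x with (fst
        (expansion u v al bl r)) end.
        intros C1; exact C1. unfold expansion; simpl. ring.
      + generalize (FG _ (Hlin r eps Hr He)). apply filter_imp. intros t Ht.
        apply Rlt_le. eapply Rle_lt_trans. 2: exact Ht. eapply Rle_trans. 2: apply fst_le_Cmod.
        right. f_equal. unfold expansion; simpl. ring.
    - eapply filterlim_Rabs_le. apply P.
      + revert C2. match goal with |- filterlim _ _ (locally ?x) -> _ => replace x with (snd
        (expansion u v al bl r)) end.
        intros C2; exact C2. unfold expansion; simpl. ring.
      + generalize (FG _ (Hlin r eps Hr He)). apply filter_imp. intros t Ht.
        apply Rlt_le. eapply Rle_lt_trans. 2: exact Ht. eapply Rle_trans. 2: apply snd_le_Cmod.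
        right. f_equal. unfold expansion; simpl. ring. }
  assert (Sm : forall (c : T -> nat -> C) l j eta, 0 < eta -> l j = RtoC 0 ->
     (filterlim (fun t => fst (c t j)) G (locally (fst (l j))) /\
              filterlim (fun t => snd (c t j)) G (locally (snd (l j)))) ->
     G (fun t => Cmod (c t j) < eta)).
  { intros c l j eta He Hl [A1 A2]. rewrite Hl in A1, A2.
    assert (e2 : 0 < eta / 2) by lra.
    apply filterlim_locally with (eps := mkposreal _ e2) in A1.
    apply filterlim_locally with (eps := mkposreal _ e2) in A2.
    generalize (filter_and _ _ A1 A2). apply filter_imp. intros t [H1 H2].
    change (Rabs (fst (c t j) - 0) < eta / 2) in H1. change (Rabs (snd (c t j) - 0) < eta / 2) in
      H2.
    rewrite Rminus_0_r in H1, H2. eapply Rle_lt_trans. apply Cmod_le_abs. lra. }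
  assert (Fin : forall eta, 0 < eta -> G (fun t => sum_n (fun j => Cmod (a t j) + Cmod (b t j)) N
    < eta)).
  { clear Hsum. induction N as [|n IH]; intros eta He.
    - assert (A := Sm a al O (eta / 2) ltac:(lra) (proj1 (Z O)) (L1' O)).
      assert (B := Sm b bl O (eta / 2) ltac:(lra) (proj2 (Z O)) (L2 O)).
      generalize (filter_and _ _ A B). apply filter_imp. intros t [H1 H2]. rewrite sum_O. lra.
    - assert (A := Sm a al (S n) (eta / 4) ltac:(lra) (proj1 (Z _)) (L1' _)).
      assert (B := Sm b bl (S n) (eta / 4) ltac:(lra) (proj2 (Z _)) (L2 _)).
      assert (D := IH (eta / 2) ltac:(lra)).
      generalize (filter_and _ _ D (filter_and _ _ A B)). apply filter_imp. intros t (H1 & H2 &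
        H3).
      rewrite sum_Sn. change (plus ?x ?y) with (x + y). lra. }
  destruct (filter_ex _ (filter_and _ _ (Fin delta Hd) (FG _ Hsum))) as (t & H1 & H2). lra.
Qed.
End Sys.
End Stability.

(** * Second differences and second derivatives *)

Definition continuous_fun (f : R -> R) : Prop := forall x, continuous f x.

(** The kernel that recovers a second difference of a function from its second
    derivative. *)
Definition second_average (h : R) (q : R -> R) (p : R) : R :=
  RInt (fun s => (h - s) * (q (p + s) + q (p - s))) 0 h.

Lemma continuous_fun_kernel h q p : continuous_fun q -> continuous_fun (fun s => (h - s) * (q (p
  + s) + q (p - s))).
Proof.
  intros Hq x. apply (continuous_mult (K := R_AbsRing)).
  - apply (continuous_minus (V := R_NormedModule)). apply continuous_const. apply continuous_id.
  - apply (continuous_plus (V := R_NormedModule)).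
    + apply (continuous_comp (fun s => p + s) q). 2: apply Hq.
      apply (continuous_plus (V := R_NormedModule)). apply continuous_const. apply continuous_id.
    + apply (continuous_comp (fun s => p - s) q). 2: apply Hq.
      apply (continuous_minus (V := R_NormedModule)). apply continuous_const. apply continuous_id.
Qed.

Lemma ex_RInt_continuous_fun f a b : continuous_fun f -> ex_RInt f a b.
Proof. intros H. apply (ex_RInt_continuous (V := R_CompleteNormedModule)). auto. Qed.

Lemma second_average_lincomb h f g x y p : continuous_fun f -> continuous_fun g ->
  second_average h (fun t => x * f t + y * g t) p = x * second_average h f p + y * second_average
    h g p.
Proof.
  intros Hf Hg. unfold second_average.
  assert (Kf := ex_RInt_continuous_fun _ 0 h (continuous_fun_kernel h f p Hf)).
  assert (Kg := ex_RInt_continuous_fun _ 0 h (continuous_fun_kernel h g p Hg)).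
  apply is_RInt_unique.
  apply (is_RInt_ext (fun s => x * ((h - s) * (f (p + s) + f (p - s))) + y * ((h - s) * (g (p +
    s) + g (p - s))))).
  intros s _. as_R_eq. ring.
  apply (is_RInt_plus (V := R_NormedModule)); apply (is_RInt_scal (V := R_NormedModule)).
  exact (RInt_correct (V := R_CompleteNormedModule) _ 0 h Kf).
  exact (RInt_correct (V := R_CompleteNormedModule) _ 0 h Kg).
Qed.

Lemma second_average_ext h f g p : (forall t, f t = g t) -> second_average h f p = second_average
  h g p.
Proof. intros E. apply RInt_ext. intros s _. now rewrite !E. Qed.

Lemma second_average_bound h f p B : 0 <= h -> continuous_fun f -> (forall t, Rabs (f t) <= B) ->
  Rabs (second_average h f p) <= h * (h * (2 * B)).
Proof.
  intros Hh Hf HB. unfold second_average.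
  assert (K := ex_RInt_continuous_fun _ 0 h (continuous_fun_kernel h f p Hf)).
  replace (h * (h * (2 * B))) with ((h - 0) * (h * (2 * B))) by ring.
  refine (norm_RInt_le_const (V := R_NormedModule) (fun s => (h - s) * (f (p + s) + f (p - s)))
    0 h _ (h * (2 * B)) Hh _ (RInt_correct (V := R_CompleteNormedModule) _ 0 h K)).
  intros s Hs. change (Rabs ((h - s) * (f (p + s) + f (p - s))) <= h * (2 * B)).
  rewrite Rabs_mult, (Rabs_pos_eq (h - s)) by lra.
  apply Rmult_le_compat; try lra. apply Rabs_pos.
  eapply Rle_trans. apply Rabs_triang. assert (A := HB (p + s)). assert (A' := HB (p - s)). lra.
Qed.

(** Integration by parts, twice on each side of [p]. *)
Lemma second_difference f f1 f2 h p : 0 <= h -> (forall t, is_derive f t (f1 t)) ->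
  (forall t, is_derive f1 t (f2 t)) -> continuous_fun f2 ->
  f (p + h) - 2 * f p + f (p - h) = second_average h f2 p.
Proof.
  intros Hh H1 H2 Hc. symmetry. apply is_RInt_unique.
  (* A primitive of the kernel times the second derivative. *)
  set (Phi := fun s => (h - s) * (f1 (p + s) - f1 (p - s)) + (f (p + s) + f (p - s))).
  replace (f (p + h) - 2 * f p + f (p - h)) with (minus (Phi h) (Phi 0)).
  - apply (is_RInt_derive (V := R_CompleteNormedModule)). intros s _. 2: intros; now apply
    continuous_fun_kernel.
    unfold Phi.
    assert (A1 := H1 (p + s)). assert (A2 := H1 (p - s)). assert (B1 := H2 (p + s)). assert (B2
      := H2 (p - s)).
    auto_derive. repeat split; eexists; eauto.
    change (fun x => f x) with f. change (fun x => f1 x) with f1.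
    unfold Rminus in *.
    rewrite (is_derive_unique _ _ _ A1), (is_derive_unique _ _ _ A2), (is_derive_unique _ _ _
      B1), (is_derive_unique _ _ _ B2).
    ring.
  - unfold minus, plus, opp, Phi; simpl. rewrite !Rplus_0_r, !Rminus_0_r. ring.
Qed.

(** At an interior maximum point the midpoint identity makes the maximum value also
    attained at the nearer end of the interval. *)
Lemma midpoint_max g a b : continuous_fun g -> g a = 0 -> g b = 0 -> a <= b ->
  (forall x h, 0 < h -> g (x + h) - 2 * g x + g (x - h) = 0) ->
  forall x, a <= x <= b -> g x <= 0.
Proof.
  intros Hg Ha Hb Hab Hm x Hx.
  destruct (continuity_ab_maj g a b Hab) as (m & Hmax & Hmm).
  { intros c _. apply continuity_pt_filterlim, Hg. }
  apply Rle_trans with (g m). now apply Hmax.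
  destruct (Rlt_le_dec a m) as [A|A]. 2: replace m with a by lra; lra.
  destruct (Rlt_le_dec m b) as [B|B]. 2: replace m with b by lra; lra.
  assert (h0 : 0 < Rmin (m - a) (b - m)) by (apply Rmin_glb_lt; lra).
  assert (E := Hm m _ h0).
  assert (U1 := Hmax (m + Rmin (m - a) (b - m))). assert (U2 := Hmax (m - Rmin (m - a) (b - m))).
  assert (M1 := Rmin_l (m - a) (b - m)). assert (M2 := Rmin_r (m - a) (b - m)).
  specialize (U1 ltac:(lra)). specialize (U2 ltac:(lra)).
  destruct (Rmin_case_strong (m - a) (b - m) (fun z => z = m - a \/ z = b - m)) as [Z|Z]; auto;
  rewrite Z in *.
  - replace (m - (m - a)) with a in * by ring. lra.
  - replace (m + (b - m)) with b in * by ring. lra.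
Qed.

Lemma continuous_fun_affine c d : continuous_fun (fun x => c + d * x).
Proof. intros x. apply (ex_derive_continuous (V := R_NormedModule)). auto_derive. auto. Qed.

Lemma midpoint_interpolation g a x b : continuous_fun g -> a < x < b ->
  (forall x h, 0 < h -> g (x + h) - 2 * g x + g (x - h) = 0) ->
  (b - a) * g x = (b - x) * g a + (x - a) * g b.
Proof.
  intros Hg Hx Hm.
  set (d := (g b - g a) / (b - a)).
  set (l := fun x => (g a - d * a) + d * x).
  assert (Z : g x = l x).
  { apply Rle_antisym.
    - assert (A := midpoint_max (fun t => g t - l t) a b).
      cut (g x - l x <= 0). lra. apply A; clear A; try lra.
      + intros t. apply (continuous_minus (V := R_NormedModule)). apply Hg. apply
        continuous_fun_affine.
      + unfold l; ring.
      + unfold l, d; field; lra.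
      + intros t h Hh. specialize (Hm t h Hh). unfold l. lra.
    - assert (A := midpoint_max (fun t => l t - g t) a b).
      cut (l x - g x <= 0). lra. apply A; clear A; try lra.
      + intros t. apply (continuous_minus (V := R_NormedModule)). apply continuous_fun_affine.
        apply Hg.
      + unfold l; ring.
      + unfold l, d; field; lra.
      + intros t h Hh. specialize (Hm t h Hh). unfold l. lra. }
  rewrite Z. unfold l, d. field. lra.
Qed.

Lemma midpoint_affine g : continuous_fun g ->
  (forall x h, 0 < h -> g (x + h) - 2 * g x + g (x - h) = 0) ->
  forall x, g x = g 0 + (g 1 - g 0) * x.
Proof.
  intros Hg Hm x.
  destruct (Rtotal_order x 0) as [H|[->|H]].
  - assert (E := midpoint_interpolation g x 0 1 Hg ltac:(lra) Hm). lra.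
  - ring.
  - destruct (Rtotal_order x 1) as [H'|[->|H']].
    + assert (E := midpoint_interpolation g 0 x 1 Hg ltac:(lra) Hm). lra.
    + ring.
    + assert (E := midpoint_interpolation g 0 1 x Hg ltac:(lra) Hm). lra.
Qed.

Lemma primitive q : continuous_fun q -> forall x, is_derive (fun t => RInt q 0 t) x (q x).
Proof.
  intros Hq x. apply (is_derive_RInt (V := R_CompleteNormedModule) q _ 0 x). 2: apply Hq.
  apply filter_forall. intros t. exact (RInt_correct (V := R_CompleteNormedModule) _ 0 t
    (ex_RInt_continuous_fun _ _ _ Hq)).
Qed.

Lemma is_derive_continuous_fun f f1 : (forall t, is_derive f t (f1 t)) -> continuous_fun f.
Proof. intros H x. apply (ex_derive_continuous (V := R_NormedModule)). eexists; apply H. Qed.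

(** The difference between [f] and a double primitive of [q] has vanishing second
    differences, hence is affine. *)
Lemma second_difference_converse f q : continuous_fun f -> continuous_fun q ->
  (forall p h, 0 < h -> f (p + h) - 2 * f p + f (p - h) = second_average h q p) ->
  exists f1, (forall t, is_derive f t (f1 t)) /\ (forall t, is_derive f1 t (q t)).
Proof.
  intros Hf Hq H.
  set (Q := fun t => RInt q 0 t). set (P := fun t => RInt Q 0 t).
  assert (DQ : forall t, is_derive Q t (q t)) by (intros; now apply primitive).
  assert (HQ := is_derive_continuous_fun _ _ DQ).
  assert (DP : forall t, is_derive P t (Q t)) by (intros; now apply primitive).
  assert (HP := is_derive_continuous_fun _ _ DP).
  set (g := fun t => f t - P t).
  assert (Hg : continuous_fun g). { intros t. apply (continuous_minus (V := R_NormedModule)).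
    apply Hf. apply HP. }
  assert (Ag := midpoint_affine g Hg).
  assert (E : forall x, g x = g 0 + (g 1 - g 0) * x).
  { apply Ag. intros x h Hh. assert (A := H x h Hh).
    assert (B := second_difference P Q q h x (Rlt_le _ _ Hh) DP DQ Hq). unfold g. lra. }
  exists (fun t => Q t + (g 1 - g 0)). split; intros t.
  - apply (is_derive_ext (fun x => P x + (g 0 + (g 1 - g 0) * x))).
    intros x. rewrite <- E. unfold g. as_R_eq. ring.
    apply (is_derive_plus (V := R_NormedModule)). apply DP. auto_derive; auto. ring.
  - evar_last. apply (is_derive_plus (V := R_NormedModule)). apply DQ. apply is_derive_const.
    apply plus_zero_r.
Qed.

(** * The Helmholtz equation in polar coordinates *)

Definition outer (rho : R) (p : plane) : Prop := rho < enorm p.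

Lemma enorm_polar r p : 0 <= r -> enorm (polar r p) = r.
Proof.
  intros Hr. unfold enorm, polar; simpl.
  replace (_ + _) with (r * r * ((sin p)² + (cos p)²)) by (unfold Rsqr; ring).
  rewrite sin2_cos2, Rmult_1_r. now apply sqrt_square.
Qed.

Lemma outer_polar rho r p : 0 <= rho -> rho < r -> outer rho (polar r p).
Proof. intros H Hr. unfold outer. rewrite enorm_polar; lra. Qed.

Lemma outer_open rho p : outer rho p -> locally p (outer rho).
Proof.
  intros H.
  assert (C : continuous enorm p).
  { unfold enorm. apply continuous_comp. 2: apply continuous_sqrt.
    destruct p as [x y].
    apply (continuous_plus (V := R_NormedModule) (fun z : plane => fst z ^ 2) (fun z => snd z ^
      2));
    [apply (continuous_comp fst (fun x => x ^ 2)) | apply (continuous_comp snd (fun x => x ^ 2))];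
    try apply continuous_fst; try apply continuous_snd;
    apply (ex_derive_continuous (V := R_NormedModule)); auto_derive; auto. }
  apply (C (fun t => rho < t)). apply (open_gt rho). exact H.
Qed.

Section Chain.
Variable rho : R.
Variables f f1 f2 : plane -> R.
Hypothesis D1 : forall p, outer rho p -> is_derive (fun z => f (z, snd p)) (fst p) (f1 p).
Hypothesis D2 : forall p, outer rho p -> is_derive (fun z => f (fst p, z)) (snd p) (f2 p).
Hypothesis C1 : forall p, outer rho p -> continuous f1 p.

(** One continuous partial derivative and the existence of the other suffice for
    differentiability at the point. *)
Lemma chain_rule (X Y : R -> R) t dX dY : outer rho (X t, Y t) ->
  is_derive X t dX -> is_derive Y t dY ->
  is_derive (fun s => f (X s, Y s)) t (f1 (X t, Y t) * dX + f2 (X t, Y t) * dY).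
Proof.
  intros HO HX HY.
  apply is_derive_Reals.
  apply (derivable_pt_lim_comp_2d (fun x y => f (x, y))); try now apply is_derive_Reals.
  apply filterdiff_differentiable_pt_lim.
  assert (F := is_derive_filterdiff (fun x y => f (x, y)) (X t) (Y t) (fun x y => f1 (x, y)) (f2
    (X t, Y t))).
  eapply filterdiff_ext_lin. apply F.
  - generalize (outer_open rho _ HO). apply filter_imp. intros [x y] Hu. apply (D1 (x, y) Hu).
  - apply (D2 (X t, Y t) HO).
  - apply (continuous_ext f1). intros [x y]; auto. now apply C1.
  - intros [x y]. reflexivity.
Qed.
End Chain.

Section Polar.
Variables rho kappa : R.
Hypothesis Hrho : 0 < rho.
Variables w w1 w2 w11 w12 w21 w22 : plane -> R.
Hypothesis D1 : forall p, outer rho p -> is_derive (fun z => w (z, snd p)) (fst p) (w1 p).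
Hypothesis D2 : forall p, outer rho p -> is_derive (fun z => w (fst p, z)) (snd p) (w2 p).
Hypothesis D11 : forall p, outer rho p -> is_derive (fun z => w1 (z, snd p)) (fst p) (w11 p).
Hypothesis D12 : forall p, outer rho p -> is_derive (fun z => w1 (fst p, z)) (snd p) (w12 p).
Hypothesis D21 : forall p, outer rho p -> is_derive (fun z => w2 (z, snd p)) (fst p) (w21 p).
Hypothesis D22 : forall p, outer rho p -> is_derive (fun z => w2 (fst p, z)) (snd p) (w22 p).
Hypothesis C0 : forall p, outer rho p -> continuous w p.
Hypothesis C1 : forall p, outer rho p -> continuous w1 p.
Hypothesis C2 : forall p, outer rho p -> continuous w2 p.
Hypothesis C11 : forall p, outer rho p -> continuous w11 p.
Hypothesis C12 : forall p, outer rho p -> continuous w12 p.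
Hypothesis C21 : forall p, outer rho p -> continuous w21 p.
Hypothesis C22 : forall p, outer rho p -> continuous w22 p.
Hypothesis Helm : forall p, outer rho p -> w11 p + w22 p + kappa ^ 2 * w p = 0.

Definition polar_fun r p := w (polar r p).
Definition polar_dr r p := w1 (polar r p) * cos p + w2 (polar r p) * sin p.
Definition polar_drr r p := w11 (polar r p) * (cos p * cos p) +
  (w12 (polar r p) + w21 (polar r p)) * (cos p * sin p) + w22 (polar r p) * (sin p * sin p).
Definition polar_dphi r p := r * (w2 (polar r p) * cos p - w1 (polar r p) * sin p).
(** The second angular derivative, already rewritten with the Helmholtz equation in
    terms of radial derivatives. *)
Definition polar_dphi2 r p := - r ^ 2 * kappa ^ 2 * polar_fun r p + (- r ^ 2 * polar_drr r p + -
  r * polar_dr r p).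

Lemma radial_chain (f f1 f2 : plane -> R) r p :
  (forall p, outer rho p -> is_derive (fun z => f (z, snd p)) (fst p) (f1 p)) ->
  (forall p, outer rho p -> is_derive (fun z => f (fst p, z)) (snd p) (f2 p)) ->
  (forall p, outer rho p -> continuous f1 p) -> rho < r ->
  is_derive (fun r => f (polar r p)) r (f1 (polar r p) * cos p + f2 (polar r p) * sin p).
Proof.
  intros H1 H2 H3 Hr.
  apply (chain_rule rho f f1 f2 H1 H2 H3 (fun r => r * cos p) (fun r => r * sin p)).
  apply outer_polar; lra. auto_derive; auto; ring. auto_derive; auto; ring.
Qed.

Lemma angular_chain (f f1 f2 : plane -> R) r p :
  (forall p, outer rho p -> is_derive (fun z => f (z, snd p)) (fst p) (f1 p)) ->
  (forall p, outer rho p -> is_derive (fun z => f (fst p, z)) (snd p) (f2 p)) ->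
  (forall p, outer rho p -> continuous f1 p) -> rho < r ->
  is_derive (fun p => f (polar r p)) p (f1 (polar r p) * (- r * sin p) + f2 (polar r p) * (r *
    cos p)).
Proof.
  intros H1 H2 H3 Hr.
  apply (chain_rule rho f f1 f2 H1 H2 H3 (fun p => r * cos p) (fun p => r * sin p)).
  apply outer_polar; lra. auto_derive; auto; ring. auto_derive; auto; ring.
Qed.

Lemma is_derive_lincomb (a b : R -> R) t da db x y : is_derive a t da -> is_derive b t db ->
  is_derive (fun s => a s * x + b s * y) t (da * x + db * y).
Proof.
  intros A B. apply (is_derive_plus (V := R_NormedModule)).
  exact (is_derive_scal_l a t da x A). exact (is_derive_scal_l b t db y B).
Qed.

Lemma polar_fun_radial r p : rho < r -> is_derive (fun r => polar_fun r p) r (polar_dr r p).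
Proof. intros Hr. exact (radial_chain w w1 w2 r p D1 D2 C1 Hr). Qed.

Lemma polar_dr_radial r p : rho < r -> is_derive (fun r => polar_dr r p) r (polar_drr r p).
Proof.
  intros Hr. evar_last. apply is_derive_lincomb.
  exact (radial_chain w1 w11 w12 r p D11 D12 C11 Hr). exact (radial_chain w2 w21 w22 r p D21 D22
    C21 Hr).
  unfold polar_drr. ring.
Qed.

Lemma polar_fun_angular r p : rho < r -> is_derive (polar_fun r) p (polar_dphi r p).
Proof.
  intros Hr. evar_last. exact (angular_chain w w1 w2 r p D1 D2 C1 Hr). unfold polar_dphi; ring.
Qed.

(** The mixed derivatives enter the radial and the angular second derivatives with
    opposite signs and only through the sum [w12 + w21], so they cancel in the
    Laplacian. *)
Lemma polar_dphi_angular r p : rho < r -> is_derive (polar_dphi r) p (polar_dphi2 r p).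
Proof.
  intros Hr.
  assert (A1 := angular_chain w1 w11 w12 r p D11 D12 C11 Hr).
  assert (A2 := angular_chain w2 w21 w22 r p D21 D22 C21 Hr).
  assert (Cc : is_derive cos p (- sin p)) by (auto_derive; auto; ring).
  assert (Cs : is_derive sin p (cos p)) by (auto_derive; auto; ring).
  evar_last.
  - apply (is_derive_scal (fun p => w2 (polar r p) * cos p - w1 (polar r p) * sin p)).
    exact (is_derive_minus _ _ p _ _ (is_derive_mult _ _ p _ _ A2 Cc Rmult_comm)
      (is_derive_mult _ _ p _ _ A1 Cs Rmult_comm)).
  - unfold minus, plus, opp, mult; simpl. unfold polar_dphi2, polar_fun, polar_dr, polar_drr.
    assert (E := Helm (polar r p) (outer_polar rho r p ltac:(lra) Hr)).
    assert (S : sin p * sin p = 1 - cos p * cos p) by (generalize (sin2_cos2 p); unfold Rsqr;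
      lra).
    replace (kappa ^ 2 * w (polar r p)) with (- w11 (polar r p) - w22 (polar r p)) by lra.
    transitivity (- r ^ 2 * (- w11 (polar r p) - w22 (polar r p))
      + (- r ^ 2 * (w11 (polar r p) * (cos p * cos p) + (w12 (polar r p) + w21 (polar r p)) *
        (cos p * sin p)
         + w22 (polar r p) * (sin p * sin p)) - r * (w1 (polar r p) * cos p + w2 (polar r p) *
           sin p))).
    + replace (w22 (polar r p)) with (w22 (polar r p) * (sin p * sin p + cos p * cos p)) at 2 by
      (rewrite S; ring).
      replace (w11 (polar r p)) with (w11 (polar r p) * (sin p * sin p + cos p * cos p)) at 2 by
        (rewrite S; ring).
      ring.
    + replace (- w11 (polar r p) - w22 (polar r p)) with (kappa ^ 2 * w (polar r p)) by lra. ring.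
Qed.

Lemma continuous_polar (f : plane -> R) (z : R * R) : (forall p, outer rho p -> continuous f p)
  -> rho < fst z ->
  continuous (fun z : R * R => f (polar (fst z) (snd z))) z.
Proof.
  intros Hf Hz. apply (continuous_comp (fun z : R * R => polar (fst z) (snd z)) f).
  2: apply Hf, outer_polar; lra.
  unfold polar.
  apply (continuous_comp_2 (fun z : R * R => fst z * cos (snd z)) (fun z : R * R => fst z * sin
    (snd z)) (fun a b => (a, b))).
  - apply (continuous_mult (K := R_AbsRing) (fun z : R * R => fst z) (fun z => cos (snd z))).
    apply continuous_fst. apply (continuous_comp snd cos). apply continuous_snd. apply
      continuous_cos.
  - apply (continuous_mult (K := R_AbsRing) (fun z : R * R => fst z) (fun z => sin (snd z))).
    apply continuous_fst. apply (continuous_comp snd sin). apply continuous_snd. apply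
      continuous_sin.
  - apply (continuous_ext (fun x => x)). intros [a b]; reflexivity. apply continuous_id.
Qed.

Lemma continuous_snd_comp (h : R -> R) (z : R * R) : (forall t, continuous h t) ->
  continuous (fun z : R * R => h (snd z)) z.
Proof. intros H. apply (continuous_comp snd h). apply continuous_snd. apply H. Qed.

Definition polar_continuous (k : R -> R -> R) : Prop :=
  forall z : R * R, rho < fst z -> continuous (fun z => k (fst z) (snd z)) z.

Lemma polar_fun_continuous : polar_continuous polar_fun.
Proof. intros z Hz. now apply continuous_polar. Qed.

Lemma polar_continuous_plus k k' : polar_continuous k -> polar_continuous k' -> polar_continuous
  (fun r p => k r p + k' r p).
Proof. intros H H' z Hz. apply (continuous_plus (V := R_NormedModule)). now apply H. now apply
  H'. Qed.

Lemma polar_continuous_mult k k' : polar_continuous k -> polar_continuous k' -> polar_continuous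
  (fun r p => k r p * k' r p).
Proof. intros H H' z Hz. apply (continuous_mult (K := R_AbsRing)). now apply H. now apply H'. Qed.

Lemma polar_continuous_comp (f : plane -> R) : (forall p, outer rho p -> continuous f p) ->
  polar_continuous (fun r p => f (polar r p)).
Proof. intros H z Hz. now apply continuous_polar. Qed.

Lemma polar_continuous_cos : polar_continuous (fun _ p => cos p).
Proof. intros z Hz. apply (continuous_snd_comp cos). apply continuous_cos. Qed.
Lemma polar_continuous_sin : polar_continuous (fun _ p => sin p).
Proof. intros z Hz. apply (continuous_snd_comp sin). apply continuous_sin. Qed.

Lemma polar_dr_continuous : polar_continuous polar_dr.
Proof.
  unfold polar_dr. apply polar_continuous_plus; apply polar_continuous_mult; auto using
    polar_continuous_cos, polar_continuous_sin; now apply polar_continuous_comp.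
Qed.

Lemma polar_drr_continuous : polar_continuous polar_drr.
Proof.
  unfold polar_drr. repeat (apply polar_continuous_plus || apply polar_continuous_mult); auto
    using polar_continuous_cos, polar_continuous_sin; now apply polar_continuous_comp.
Qed.

Lemma polar_continuous_slice k r : polar_continuous k -> rho < r -> continuous_fun (k r).
Proof.
  intros H Hr p. apply (continuous_comp_2 (fun _ => r) (fun p => p) k p).
  apply continuous_const. apply continuous_id. exact (H (r, p) Hr).
Qed.

Lemma second_average_derive (k k' : R -> R -> R) h p r :
  polar_continuous k -> polar_continuous k' -> (forall r p, rho < r -> is_derive (fun r => k r p)
    r (k' r p)) ->
  rho < r -> is_derive (fun r => second_average h (k r) p) r (second_average h (k' r) p).
Proof.
  intros Hk Hk' D Hr. unfold second_average.
  assert (D' : forall r s, rho < r -> is_derive (fun r => (h - s) * (k r (p + s) + k r (p - s))) r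
     ((h - s) * (k' r (p + s) + k' r (p - s)))).
  { intros r' s Hr'. apply is_derive_scal. apply (is_derive_plus (V := R_NormedModule)); now
    apply D. }
  evar_last.
  - apply (is_derive_RInt_param (fun r s => (h - s) * (k r (p + s) + k r (p - s)))).
    + apply (filter_imp (fun r => rho < r)). 2: now apply (open_gt rho).
      intros r' Hr' t _. eexists. now apply D'.
    + intros s _. apply (continuity_2d_pt_ext_loc (fun r s => (h - s) * (k' r (p + s) + k' r (p -
      s)))).
      * assert (d0 : 0 < r - rho) by lra. exists (mkposreal _ d0). simpl. intros u v Hu _.
        symmetry. apply is_derive_unique, D'. apply Rabs_lt_between in Hu. lra.
      * apply continuity_2d_pt_filterlim.
        apply (continuous_mult (K := R_AbsRing) (fun z : R * R => h - snd z)
          (fun z : R * R => k' (fst z) (p + snd z) + k' (fst z) (p - snd z)) (r, s)).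
        apply (continuous_comp snd (fun s => h - s)). apply continuous_snd.
        apply (continuous_minus (V := R_NormedModule)). apply continuous_const. apply
          continuous_id.
        apply (continuous_plus (V := R_NormedModule)).
        -- apply (continuous_comp_2 (fun z : R * R => fst z) (fun z : R * R => p + snd z) k' (r,
          s)).
           apply continuous_fst. apply (continuous_plus (V := R_NormedModule)). apply
             continuous_const. apply continuous_snd.
           exact (Hk' (r, p + s) Hr).
        -- apply (continuous_comp_2 (fun z : R * R => fst z) (fun z : R * R => p - snd z) k' (r,
          s)).
           apply continuous_fst. apply (continuous_minus (V := R_NormedModule)). apply
             continuous_const. apply continuous_snd.
           exact (Hk' (r, p - s) Hr).
    + apply (filter_imp (fun r => rho < r)). 2: now apply (open_gt rho).
      intros r' Hr'. apply ex_RInt_continuous_fun. apply (continuous_fun_kernel h (k r') p). now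
        apply polar_continuous_slice.
  - apply RInt_ext. intros s _. apply is_derive_unique. now apply D'.
Qed.

(** [second_difference] in the angle, where the second angular derivative has been
    traded for radial ones; those commute with the averaging. *)
Lemma polar_second_difference r p h : rho < r -> 0 <= h ->
  polar_fun r (p + h) - 2 * polar_fun r p + polar_fun r (p - h) =
   - r ^ 2 * kappa ^ 2 * second_average h (polar_fun r) p + (- r ^ 2 * second_average h
     (polar_drr r) p + - r * second_average h (polar_dr r) p).
Proof.
  intros Hr Hh.
  assert (K0 := polar_continuous_slice _ r polar_fun_continuous Hr). assert (K1 :=
    polar_continuous_slice _ r polar_dr_continuous Hr).
  assert (K2 := polar_continuous_slice _ r polar_drr_continuous Hr).
  assert (K3 : continuous_fun (fun t => - r ^ 2 * polar_drr r t + - r * polar_dr r t)).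
  { intros t. apply (continuous_plus (V := R_NormedModule)); apply (continuous_mult (K :=
    R_AbsRing));
    try apply continuous_const. apply K2. apply K1. }
  rewrite (second_difference (polar_fun r) (polar_dphi r) (polar_dphi2 r) h p); auto.
  - rewrite <- (second_average_lincomb h (polar_drr r) (polar_dr r)) by auto.
    rewrite <- (Rmult_1_l (second_average h (fun t => - r ^ 2 * polar_drr r t + - r * polar_dr r
      t) p)).
    rewrite <- (second_average_lincomb h (polar_fun r) (fun t => - r ^ 2 * polar_drr r t + - r *
      polar_dr r t)) by auto.
    apply second_average_ext. intros t. unfold polar_dphi2. ring.
  - intros; now apply polar_fun_angular.
  - intros; now apply polar_dphi_angular.
  - unfold polar_dphi2. intros t. apply (continuous_plus (V := R_NormedModule)). 2: apply K3.
    apply (continuous_mult (K := R_AbsRing)). apply continuous_const. apply K0.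
Qed.
End Polar.

(** * Complex-valued functions of the angle *)

Lemma differentiable_components (f : R -> C) t : differentiable f t -> is_Cderive f t (CDerive f
  t).
Proof.
  intros (l & Hl). unfold CDerive.
  assert (A : is_derive (fun s => fst (f s)) t (fst l)).
  { evar_last. apply (filterdiff_comp (U := R_NormedModule) (V := C_R_NormedModule) (W :=
    R_NormedModule) f fst _ fst Hl).
    apply filterdiff_linear. apply (is_linear_fst (U := R_NormedModule) (V := R_NormedModule)).
      reflexivity. }
  assert (B : is_derive (fun s => snd (f s)) t (snd l)).
  { evar_last. apply (filterdiff_comp (U := R_NormedModule) (V := C_R_NormedModule) (W :=
    R_NormedModule) f snd _ snd Hl).
    apply filterdiff_linear. apply (is_linear_snd (U := R_NormedModule) (V := R_NormedModule)).
      reflexivity. }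
  split; simpl; apply Derive_correct; eexists; eauto.
Qed.

Lemma Cderive_differentiable (f : R -> C) t l : is_Cderive f t l -> differentiable f t /\ CDerive
  f t = l.
Proof.
  intros [A B]. split.
  - exists l.
    apply (is_derive_ext (V := C_R_NormedModule) (fun s => plus (scal (fst (f s)) ((1, 0) :
      C_R_NormedModule)) (scal (snd (f s)) ((0, 1) : C_R_NormedModule)))).
    intros s. unfold plus, scal; simpl. unfold prod_plus, prod_scal, scal; simpl. unfold plus,
      mult; simpl.
    apply injective_projections; simpl; ring.
    assert (D := is_derive_plus (V := C_R_NormedModule) _ _ t _ _ (is_derive_scal_l (V :=
      C_R_NormedModule) _ t _ ((1, 0) : C_R_NormedModule) A) (is_derive_scal_l (V :=
        C_R_NormedModule) _ t _ ((0, 1) : C_R_NormedModule) B)).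
    evar_last. exact D.
    unfold plus, scal; simpl. unfold prod_plus, prod_scal, scal; simpl. unfold plus, mult; simpl.
    apply injective_projections; simpl; ring.
  - unfold CDerive. apply injective_projections; simpl; now apply is_derive_unique.
Qed.

Lemma twice_of_Cderive (f f1 f2 : R -> C) : (forall t, is_Cderive f t (f1 t)) -> (forall t,
  is_Cderive f1 t (f2 t)) ->
  twice_differentiable f /\ forall t, CDerive (CDerive f) t = f2 t.
Proof.
  intros H1 H2.
  assert (E : forall t, f1 t = CDerive f t) by (intros t; now destruct (Cderive_differentiable _
    _ _ (H1 t))).
  assert (D : forall t, is_Cderive (CDerive f) t (f2 t)).
  { intros t. apply (Cderive_ext_loc f1). now apply filter_forall. auto. }
  split.
  - intros t. split. now destruct (Cderive_differentiable _ _ _ (H1 t)). now destruct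
    (Cderive_differentiable _ _ _ (D t)).
  - intros t. now destruct (Cderive_differentiable _ _ _ (D t)).
Qed.

Definition Ccontinuous_fun (q : R -> C) : Prop := continuous_fun (fun t => fst (q t)) /\
  continuous_fun (fun t => snd (q t)).

Definition Csecond_average (h : R) (q : R -> C) (p : R) : C :=
  (second_average h (fun t => fst (q t)) p, second_average h (fun t => snd (q t)) p).

Lemma continuous_fun_lincomb f g x y : continuous_fun f -> continuous_fun g -> continuous_fun
  (fun t => x * f t + y * g t).
Proof.
  intros Hf Hg t. apply (continuous_plus (V := R_NormedModule)); apply (continuous_mult (K :=
    R_AbsRing));
  try apply continuous_const; auto.
Qed.

Lemma continuous_fun_ext f g : (forall t, f t = g t) -> continuous_fun f -> continuous_fun g.
Proof. intros E H t. apply (continuous_ext f); auto. Qed.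

Lemma Ccontinuous_lincomb q q' x y : Ccontinuous_fun q -> Ccontinuous_fun q' ->
  Ccontinuous_fun (fun t => Cplus (Cmult x (q t)) (Cmult y (q' t))).
Proof.
  intros [A B] [A' B']. split.
  - apply (continuous_fun_ext (fun t => 1 * (fst x * fst (q t) + (- snd x) * snd (q t)) + 1 *
    (fst y * fst (q' t) + (- snd y) * snd (q' t)))).
    intros t; simpl; ring. repeat apply continuous_fun_lincomb; auto.
  - apply (continuous_fun_ext (fun t => 1 * (fst x * snd (q t) + snd x * fst (q t)) + 1 * (fst y
    * snd (q' t) + snd y * fst (q' t)))).
    intros t; simpl; ring. repeat apply continuous_fun_lincomb; auto.
Qed.

Lemma Csecond_average_lincomb h q q' x y p : Ccontinuous_fun q -> Ccontinuous_fun q' ->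
  Csecond_average h (fun t => Cplus (Cmult x (q t)) (Cmult y (q' t))) p
    = Cplus (Cmult x (Csecond_average h q p)) (Cmult y (Csecond_average h q' p)).
Proof.
  intros [A B] [A' B']. apply injective_projections.
  - simpl. rewrite (second_average_ext h _ (fun t => 1 * (fst x * fst (q t) + (- snd x) * snd (q
    t)) + 1 * (fst y * fst (q' t) + (- snd y) * snd (q' t)))).
    rewrite !second_average_lincomb by (auto; now apply continuous_fun_lincomb). ring.
    intros t; simpl; ring.
  - simpl. rewrite (second_average_ext h _ (fun t => 1 * (fst x * snd (q t) + snd x * fst (q t))
    + 1 * (fst y * snd (q' t) + snd y * fst (q' t)))).
    rewrite !second_average_lincomb by (auto; now apply continuous_fun_lincomb). ring.
    intros t; simpl; ring.
Qed.

Lemma Csecond_average_ext h q q' p : (forall t, q t = q' t) -> Csecond_average h q p =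
  Csecond_average h q' p.
Proof. intros E. unfold Csecond_average. f_equal; apply second_average_ext; intros; now rewrite
  E. Qed.

Lemma Ccontinuous_ext q q' : (forall t, q t = q' t) -> Ccontinuous_fun q -> Ccontinuous_fun q'.
Proof.
  intros E [A B]. split.
  - apply (continuous_fun_ext (fun t => fst (q t))); auto. intros t; now rewrite E.
  - apply (continuous_fun_ext (fun t => snd (q t))); auto. intros t; now rewrite E.
Qed.

Lemma Csecond_average_bound h q p B : 0 <= h -> Ccontinuous_fun q -> (forall t, Cmod (q t) <= B)
  ->
  Cmod (Csecond_average h q p) <= 4 * h * h * B.
Proof.
  intros Hh [A A'] HB. eapply Rle_trans. apply Cmod_le_abs. simpl.
  assert (B1 := second_average_bound h _ p B Hh A (fun t => Rle_trans _ _ _ (fst_le_Cmod _) (HB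
    t))).
  assert (B2 := second_average_bound h _ p B Hh A' (fun t => Rle_trans _ _ _ (snd_le_Cmod _) (HB
    t))).
  lra.
Qed.

Lemma Ccontinuous_sum (F : nat -> R -> C) (z : nat -> C) n : (forall j, Ccontinuous_fun (F j)) ->
  Ccontinuous_fun (fun t => sum_n (fun j => Cmult (F j t) (z j)) n).
Proof.
  intros HF. induction n as [|n IH].
  - apply (Ccontinuous_ext (fun t => Cplus (Cmult (z O) (F O t)) (Cmult (RtoC 0) (F O t)))).
    intros t. rewrite sum_O. ring. now apply Ccontinuous_lincomb.
  - apply (Ccontinuous_ext (fun t => Cplus (Cmult (RtoC 1) (sum_n (fun j => Cmult (F j t) (z j))
    n)) (Cmult (z (S n)) (F (S n) t)))).
    intros t. rewrite sum_Sn. change (plus ?x ?y) with (Cplus x y). ring. now apply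
      Ccontinuous_lincomb.
Qed.

Lemma Csecond_average_sum h (F : nat -> R -> C) (z : nat -> C) p n : (forall j, Ccontinuous_fun
  (F j)) ->
  Csecond_average h (fun t => sum_n (fun j => Cmult (F j t) (z j)) n) p = sum_n (fun j => Cmult
    (Csecond_average h (F j) p) (z j)) n.
Proof.
  intros HF. induction n as [|n IH].
  - rewrite (Csecond_average_ext h _ (fun t => Cplus (Cmult (z O) (F O t)) (Cmult (RtoC 0) (F O
    t)))).
    rewrite Csecond_average_lincomb by auto. rewrite sum_O. ring.
    intros t. rewrite sum_O. ring.
  - rewrite (Csecond_average_ext h _ (fun t => Cplus (Cmult (RtoC 1) (sum_n (fun j => Cmult (F j
    t) (z j)) n)) (Cmult (z (S n)) (F (S n) t)))).
    rewrite Csecond_average_lincomb by (auto using Ccontinuous_sum). rewrite IH, sum_Sn. change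
      (plus ?x ?y) with (Cplus x y). ring.
    intros t. rewrite sum_Sn. change (plus ?x ?y) with (Cplus x y). ring.
Qed.

Lemma inv_series_partial_sums M a r eps : 0 < M -> M < r -> geometric M a -> 0 < eps ->
  exists N, forall n, (N <= n)%nat ->
    Cmod (Cminus (sum_n (fun j => Cmult (a j) (RtoC (/ r ^ j))) n) (inv_series a r)) < eps.
Proof.
  intros HM Hr Ha He.
  assert (Pt : forall b : nat -> R, Rbar_lt (Rabs (/ r)) (CV_radius b) ->
    is_lim_seq (fun n => sum_n (fun j => b j * / r ^ j) n) (PSeries b (/ r))).
  { intros b Hb. assert (S := PSeries_correct b (/ r) (CV_radius_inside _ _ Hb)).
    apply (is_lim_seq_ext (sum_n (fun k => scal (pow_n (/ r) k) (b k)))); auto.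
    intros n. apply sum_n_ext. intros k. rewrite pow_n_pow, pow_inv. unfold scal; simpl. unfold
      mult; simpl. ring. }
  assert (P1 := Pt _ (in_disk_fst M r HM Hr a Ha)). assert (P2 := Pt _ (in_disk_snd M r HM Hr a
    Ha)).
  assert (e2 : 0 < eps / 2) by lra.
  apply is_lim_seq_spec in P1. apply is_lim_seq_spec in P2.
  destruct (P1 (mkposreal _ e2)) as (N1 & H1). destruct (P2 (mkposreal _ e2)) as (N2 & H2).
  exists (max N1 N2). intros n Hn. specialize (H1 n ltac:(lia)). specialize (H2 n ltac:(lia)).
    cbn [pos] in H1, H2.
  eapply Rle_lt_trans. apply Cmod_le_abs.
  replace (fst (Cminus _ _)) with (sum_n (fun j => fst (a j) * / r ^ j) n - PSeries (fun n => fst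
    (a n)) (/ r)).
  replace (snd (Cminus _ _)) with (sum_n (fun j => snd (a j) * / r ^ j) n - PSeries (fun n => snd
    (a n)) (/ r)).
  lra.
  - cbn [Cminus Cplus Copp fst snd inv_series]. unfold sum_n. rewrite sum_n_m_snd. unfold Rminus.
    f_equal.
    apply sum_n_m_ext. intros j. simpl. ring.
  - cbn [Cminus Cplus Copp fst snd inv_series]. unfold sum_n. rewrite sum_n_m_fst. unfold Rminus.
    f_equal.
    apply sum_n_m_ext. intros j. simpl. ring.
Qed.

(** * Second angular differences of a Helmholtz solution *)

Section Wave.
Variables kappa rho : R.
Variable U : plane -> Prop.
Variable psi : plane -> C.
Hypothesis Hrho : 0 < rho.
Hypothesis HU : forall p, rho <= enorm p -> U p.
Hypothesis HC : class_C 2 U psi.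
Hypothesis HH : helmholtz kappa U psi.

Let HO p (H : outer rho p) : U p := HU p (Rlt_le _ _ H).

Lemma fst_continuous (f : plane -> C) p : continuous f p -> continuous (fun p => fst (f p)) p.
Proof. intros H. apply (continuous_comp f fst). exact H. apply continuous_fst. Qed.

Lemma snd_continuous (f : plane -> C) p : continuous f p -> continuous (fun p => snd (f p)) p.
Proof. intros H. apply (continuous_comp f snd). exact H. apply continuous_snd. Qed.

Lemma wave_second_difference h p : 0 <= h ->
  exists K1 K2 : R -> C, forall r, rho < r ->
    is_Cderive (fun r => Csecond_average h (fun t => psi (polar r t)) p) r (K1 r) /\
    is_Cderive K1 r (K2 r) /\
    Cplus (Cplus (psi (polar r (p + h))) (Cmult (RtoC (-2)) (psi (polar r p)))) (psi (polar r (p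
      - h)))
     = Cmult (RtoC (- r ^ 2)) (Cplus (K2 r) (Cplus (Cmult (RtoC (/ r)) (K1 r))
         (Cmult (RtoC (kappa ^ 2)) (Csecond_average h (fun t => psi (polar r t)) p)))).
Proof.
  intros Hh.
  destruct HC as (c0 & d0 & (c1 & d1 & (c11 & _) & (c12 & _)) & (c2 & d2 & (c21 & _) & (c22 &
    _))).
  assert (Part : forall f : plane -> C,
    (forall p, U p -> differentiable (fun s => f (s, snd p)) (fst p) /\ differentiable (fun s =>
      f (fst p, s)) (snd p)) ->
    forall p, outer rho p -> is_Cderive (fun s => f (s, snd p)) (fst p) (partial1 f p) /\
      is_Cderive (fun s => f (fst p, s)) (snd p) (partial2 f p)).
  { intros f Hf q Hq. split; apply differentiable_components; now apply (Hf q (HO q Hq)). }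
  assert (A0 := Part _ d0). assert (A1 := Part _ d1). assert (A2 := Part _ d2). clear Part.
  assert (Hf : forall p, outer rho p ->
     fst (partial1 (partial1 psi) p) + fst (partial2 (partial2 psi) p) + kappa ^ 2 * fst (psi p)
       = 0).
  { intros q Hq. assert (E := f_equal fst (HH q (HO q Hq))). revert E. unfold laplacian.
    generalize (partial1 (partial1 psi) q) (partial2 (partial2 psi) q). simpl. intros x y E. lra.
      }
  assert (Hs : forall p, outer rho p ->
     snd (partial1 (partial1 psi) p) + snd (partial2 (partial2 psi) p) + kappa ^ 2 * snd (psi p)
       = 0).
  { intros q Hq. assert (E := f_equal snd (HH q (HO q Hq))). revert E. unfold laplacian.
    generalize (partial1 (partial1 psi) q) (partial2 (partial2 psi) q). simpl. intros x y E. lra.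
      }
  set (w (c : C -> R) (f : plane -> C) := fun p => c (f p)).
  set (k1 c := polar_dr (w c (partial1 psi)) (w c (partial2 psi))).
  set (k2 c := polar_drr (w c (partial1 (partial1 psi))) (w c (partial2 (partial1 psi)))
      (w c (partial1 (partial2 psi))) (w c (partial2 (partial2 psi)))).
  exists (fun r => (second_average h (k1 fst r) p, second_average h (k1 snd r) p)), (fun r =>
    (second_average h (k2 fst r) p, second_average h (k2 snd r) p)).
  intros r Hr.
  assert (J : forall c, (c = fst \/ c = snd) -> polar_continuous rho (polar_fun (w c psi)) /\
    polar_continuous rho (k1 c) /\ polar_continuous rho (k2 c) /\
     (forall r p, rho < r -> is_derive (fun r => polar_fun (w c psi) r p) r (k1 c r p)) /\
     (forall r p, rho < r -> is_derive (fun r => k1 c r p) r (k2 c r p)) /\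
     polar_fun (w c psi) r (p + h) - 2 * polar_fun (w c psi) r p + polar_fun (w c psi) r (p - h) =
      - r ^ 2 * kappa ^ 2 * second_average h (polar_fun (w c psi) r) p + (- r ^ 2 *
        second_average h (k2 c r) p + - r * second_average h (k1 c r) p)).
  { intros c Hc.
    assert (Cw : forall f : plane -> C, (forall q, U q -> continuous f q) -> forall q, outer rho
      q -> continuous (w c f) q).
    { intros f Hf' q Hq. destruct Hc as [->| ->]; [apply fst_continuous | apply snd_continuous];
      now apply Hf', HO. }
    assert (Dw1 : forall f : plane -> C, (forall q, outer rho q -> is_Cderive (fun s => f (s, snd
      q)) (fst q) (partial1 f q) /\ is_Cderive (fun s => f (fst q, s)) (snd q) (partial2 f q)) ->
      forall q, outer rho q -> is_derive (fun s => w c f (s, snd q)) (fst q) (w c (partial1 f)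
        q)).
    { intros f Hf' q Hq. destruct (Hf' q Hq) as [[X Y] _]. destruct Hc as [->| ->]; assumption. }
    assert (Dw2 : forall f : plane -> C, (forall q, outer rho q -> is_Cderive (fun s => f (s, snd
      q)) (fst q) (partial1 f q) /\ is_Cderive (fun s => f (fst q, s)) (snd q) (partial2 f q)) ->
      forall q, outer rho q -> is_derive (fun s => w c f (fst q, s)) (snd q) (w c (partial2 f)
        q)).
    { intros f Hf' q Hq. destruct (Hf' q Hq) as [_ [X Y]]. destruct Hc as [->| ->]; assumption. }
    assert (Hw : forall q, outer rho q -> w c (partial1 (partial1 psi)) q + w c (partial2
      (partial2 psi)) q + kappa ^ 2 * w c psi q = 0).
    { destruct Hc as [->| ->]; assumption. }
    repeat match goal with |- _ /\ _ => split end.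
    - apply polar_fun_continuous; auto.
    - apply polar_dr_continuous; auto.
    - apply polar_drr_continuous; auto.
    - intros; eapply polar_fun_radial; eauto.
    - intros; eapply polar_dr_radial; eauto.
    - eapply polar_second_difference; eauto. }
  destruct (J fst (or_introl eq_refl)) as (a1 & a2 & a3 & a4 & a5 & a6).
  destruct (J snd (or_intror eq_refl)) as (b1 & b2 & b3 & b4 & b5 & b6).
  split; [|split].
  - split; cbn [fst snd].
    + apply (second_average_derive rho (polar_fun (w fst psi)) (k1 fst)); auto.
    + apply (second_average_derive rho (polar_fun (w snd psi)) (k1 snd)); auto.
  - split; cbn [fst snd].
    + apply (second_average_derive rho (k1 fst) (k2 fst)); auto.
    + apply (second_average_derive rho (k1 snd) (k2 snd)); auto.
  - apply injective_projections; cbn [Cplus Cmult fst snd RtoC Csecond_average].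
    + revert a6. unfold polar_fun, w, second_average at 1. fold (second_average h (fun t => fst
      (psi (polar r t))) p).
      generalize (second_average h (fun t => fst (psi (polar r t))) p) (second_average h (k1 fst
        r) p) (second_average h (k2 fst r) p).
      intros x y z E. transitivity (fst (psi (polar r (p + h))) - 2 * fst (psi (polar r p)) + fst
        (psi (polar r (p - h)))).
      ring. rewrite E. field. lra.
    + revert b6. unfold polar_fun, w, second_average at 1. fold (second_average h (fun t => snd
      (psi (polar r t))) p).
      generalize (second_average h (fun t => snd (psi (polar r t))) p) (second_average h (k1 snd
        r) p) (second_average h (k2 snd r) p).
      intros x y z E. transitivity (snd (psi (polar r (p + h))) - 2 * snd (psi (polar r p)) + snd
        (psi (polar r (p - h)))).
      ring. rewrite E. field. lra.
Qed.

Lemma wave_Ccontinuous r : rho < r -> Ccontinuous_fun (fun t => psi (polar r t)).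
Proof.
  intros Hr. destruct HC as (c0 & _). split.
  - apply (polar_continuous_slice rho (fun r t => fst (psi (polar r t))) r); auto.
    apply (polar_continuous_comp rho Hrho (fun p => fst (psi p))). intros q Hq. now apply
      fst_continuous, c0, HO.
  - apply (polar_continuous_slice rho (fun r t => snd (psi (polar r t))) r); auto.
    apply (polar_continuous_comp rho Hrho (fun p => snd (psi p))). intros q Hq. now apply
      snd_continuous, c0, HO.
Qed.
End Wave.

(** * Coefficients of the Karp expansion *)

Section Linearity.
Variables u v : R -> C.

Lemma expansion_lincomb M a b a' b' x y r : 0 < M -> M < r ->
  geometric M a -> geometric M b -> geometric M a' -> geometric M b' ->
  expansion u v (fun n => Cplus (Cmult x (a n)) (Cmult y (a' n))) (fun n => Cplus (Cmult x (b n))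
    (Cmult y (b' n))) r
   = Cplus (Cmult x (expansion u v a b r)) (Cmult y (expansion u v a' b' r)).
Proof.
  intros HM Hr Ha Hb Ha' Hb'. unfold expansion.
  rewrite !(inv_series_plus M), !(inv_series_scal M); solve_geometric; auto. ring.
Qed.
End Linearity.

Lemma pow_lower M N : 0 < M -> exists K, 0 <= K /\ forall j, (j <= N)%nat -> 1 <= K * M ^ j.
Proof.
  intros HM. induction N as [|N (K & HK & H)].
  - exists 1. split. lra. intros j Hj. replace j with O by lia. simpl; lra.
  - assert (P : 0 < M ^ S N) by now apply pow_lt.
    assert (Q : 0 < / M ^ S N) by now apply Rinv_0_lt_compat.
    exists (K + / M ^ S N). split. lra. intros j Hj. rewrite Rmult_plus_distr_r.
    destruct (Nat.eq_dec j (S N)) as [->|].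
    + rewrite Rinv_l by lra. assert (0 <= K * M ^ S N) by (apply Rmult_le_pos; lra). lra.
    + assert (A := H j ltac:(lia)). assert (0 < M ^ j) by now apply pow_lt.
      assert (0 <= / M ^ S N * M ^ j) by (apply Rmult_le_pos; lra). lra.
Qed.

Lemma sum_n_ge_0 (w : nat -> R) n : (forall j, 0 <= w j) -> 0 <= sum_n w n.
Proof.
  intros H. induction n. now rewrite sum_O. rewrite sum_Sn. change (plus ?x ?y) with (x + y).
  specialize (H (S n)). lra.
Qed.

Lemma sum_n_mono (w : nat -> R) m n : (forall j, 0 <= w j) -> (m <= n)%nat -> sum_n w m <= sum_n
  w n.
Proof.
  intros H Hmn. induction Hmn. lra. rewrite sum_Sn. change (plus ?x ?y) with (x + y).
  specialize (H (S m0)). lra.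
Qed.

Lemma term_le_sum_n (w : nat -> R) j n : (forall j, 0 <= w j) -> (j <= n)%nat -> w j <= sum_n w n.
Proof.
  intros H Hj. apply Rle_trans with (sum_n w j). 2: now apply sum_n_mono.
  destruct j. rewrite sum_O; lra. rewrite sum_Sn. change (plus ?x ?y) with (x + y).
  assert (A := sum_n_ge_0 w j H). lra.
Qed.

Section Karp.
Variables kappa rho : R.
Variable U : plane -> Prop.
Variable psi : plane -> C.
Variables F G : nat -> R -> C.
Variables A B : R -> R -> C.
Hypothesis Hk : 0 < kappa.
Hypothesis Hrho : 0 < rho.
Hypothesis HU : forall p, rho <= enorm p -> U p.
Hypothesis HC : class_C 2 U psi.
Hypothesis HH : helmholtz kappa U psi.
Hypothesis HA : converges_pointwise rho F A.
Hypothesis HB : converges_pointwise rho G B.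
Hypothesis HE : forall r phi, rho <= r ->
  psi (polar r phi) = Cplus (Cmult (hankel1 0 (kappa * r)) (A r phi)) (Cmult (hankel1 1 (kappa *
    r)) (B r phi)).
Hypothesis UA : forall rho1, rho < rho1 -> converges_uniformly rho1 F A.
Hypothesis UB : forall rho1, rho < rho1 -> converges_uniformly rho1 G B.

Let u r := hankel1 0 (kappa * r).
Let v r := hankel1 1 (kappa * r).
(* Any ratio larger than [rho] would do; uniform convergence is known only there. *)
Let M := 2 * rho.

Lemma radius_pos : 0 < M. Proof. unfold M; lra. Qed.
Lemma rho_lt_radius : rho < M. Proof. unfold M; lra. Qed.
Local Hint Resolve radius_pos : core.

Lemma u_derive r : 0 < r -> is_Cderive u r (Cmult (RtoC (- kappa)) (v r)).
Proof. intros Hr. now apply hankel_system. Qed.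
Lemma v_derive r : 0 < r -> is_Cderive v r (Cminus (Cmult (RtoC kappa) (u r)) (Cdiv (v r) (RtoC
  r))).
Proof. intros Hr. now apply hankel_system. Qed.
Lemma uv_not_both_zero r : 0 < r -> u r = RtoC 0 -> v r = RtoC 0 -> False.
Proof. intros Hr. apply hankel_not_both_zero. now apply Rmult_lt_0_compat. Qed.

Lemma karp_term_eq (F0 : nat -> R -> C) r phi j : 0 < r ->
  karp_term F0 r phi j = Cmult (F0 j phi) (RtoC (/ r ^ j)).
Proof. intros Hr. unfold karp_term, Cdiv. rewrite RtoC_inv; auto. apply pow_nonzero; lra. Qed.

Lemma karp_sum_inv_series F0 A0 r phi : converges_pointwise rho F0 A0 -> rho <= r ->
  A0 r phi = inv_series (fun n => F0 n phi) r.
Proof.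
  intros H Hr. specialize (H r phi Hr).
  assert (S : forall c : C -> R, (forall x, continuous c x) ->
    (forall x y : C, c (Cplus x y) = c x + c y) -> (forall (x : C) t, c (Cmult x (RtoC t)) = t *
      c x) ->
    PSeries (fun n => c (F0 n phi)) (/ r) = c (A0 r phi)).
  { intros c Hc Hp Hs. apply is_series_unique.
    assert (L : filterlim (fun n => c (sum_n (karp_term F0 r phi) n)) eventually (locally (c (A0
      r phi)))).
    { eapply filterlim_comp. exact H. apply Hc. }
    revert L. apply filterlim_ext. intros n. induction n as [|n IH].
    - rewrite !sum_O, karp_term_eq, Hs by lra. rewrite pow_inv. as_R_eq; ring.
    - rewrite !sum_Sn. rewrite <- IH. change (plus ?x ?y) with (x + y) at 2.
      change (plus (sum_n (karp_term F0 r phi) n) (karp_term F0 r phi (S n))) with (Cplus (sum_n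
        (karp_term F0 r phi) n) (karp_term F0 r phi (S n))).
      rewrite Hp, (karp_term_eq F0 r phi (S n)), Hs, pow_inv by lra. as_R_eq. ring. }
  apply injective_projections; symmetry; simpl.
  - apply (S fst). intros x; apply (continuous_fst (U := R_UniformSpace) (V := R_UniformSpace)).
    reflexivity. intros x t; simpl; ring.
  - apply (S snd). intros x; apply (continuous_snd (U := R_UniformSpace) (V := R_UniformSpace)).
    reflexivity. intros x t; simpl; ring.
Qed.

Lemma wave_expansion r phi : rho <= r -> psi (polar r phi) = expansion u v (fun n => F n phi)
  (fun n => G n phi) r.
Proof.
  intros Hr. rewrite HE by auto. unfold expansion.
  rewrite (karp_sum_inv_series F A), (karp_sum_inv_series G B) by auto. reflexivity.
Qed.

(** Terms of a uniformly convergent series are eventually bounded uniformly in the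
    angle. *)
Lemma uniform_tail F0 A0 : converges_uniformly M F0 A0 ->
  exists N, forall n phi, (N <= n)%nat -> Cmod (F0 n phi) <= 2 * M ^ n.
Proof.
  intros H. destruct (H 1 Rlt_0_1) as (N & HN). exists (S N). intros n phi Hn.
  destruct n as [|n]. lia.
  assert (A1 := HN n M phi ltac:(lia) (Rle_refl M)). assert (A2 := HN (S n) M phi ltac:(lia)
    (Rle_refl M)).
  assert (P := pow_lt M (S n) radius_pos).
  assert (Q : Cmod (karp_term F0 M phi (S n)) <= 2).
  { rewrite sum_Sn in A2.
    replace (karp_term F0 M phi (S n)) with
     (Cplus (Cminus (plus (sum_n (karp_term F0 M phi) n) (karp_term F0 M phi (S n))) (A0 M phi))
       (Copp (Cminus (sum_n (karp_term F0 M phi) n) (A0 M phi)))).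
    eapply Rle_trans. apply Cmod_triangle. rewrite Cmod_opp. lra.
    change (plus ?x ?y) with (Cplus x y). ring. }
  rewrite karp_term_eq, Cmod_mult, Cmod_R, Rabs_pos_eq in Q by (auto; apply Rlt_le,
    Rinv_0_lt_compat; auto).
  apply Rmult_le_reg_r with (/ M ^ S n). now apply Rinv_0_lt_compat.
  eapply Rle_trans. exact Q. rewrite Rmult_assoc, Rinv_r; lra.
Qed.

Lemma common_tail : exists N, forall n phi, (N <= n)%nat ->
  Cmod (F n phi) <= 2 * M ^ n /\ Cmod (G n phi) <= 2 * M ^ n.
Proof.
  destruct (uniform_tail F A (UA M rho_lt_radius)) as (N1 & H1). destruct (uniform_tail G B (UB M
    rho_lt_radius)) as (N2 & H2).
  exists (max N1 N2). intros n phi Hn. split; [apply H1 | apply H2]; lia.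
Qed.

Lemma geometric_F phi : geometric M (fun n => F n phi).
Proof.
  destruct common_tail as (N & H). apply (geometric_of_tail M _ 2 N); auto. intros n Hn. now
    apply H.
Qed.
Lemma geometric_G phi : geometric M (fun n => G n phi).
Proof.
  destruct common_tail as (N & H). apply (geometric_of_tail M _ 2 N); auto. intros n Hn. now
    apply H.
Qed.

(** By [expansion_stable], applied to the differences of the coefficients divided by
    the sum [d phi] of the first ones, along the angles close to [phi0] where [d]
    is not small. *)
Lemma coefficients_continuous phi0 n eps : 0 < eps ->
  locally phi0 (fun phi => sum_n (fun j => Cmod (Cminus (F j phi) (F j phi0)) + Cmod (Cminus (G j
    phi) (G j phi0))) n < eps).
Proof.
  revert n.
  destruct common_tail as (N & HN).
  assert (Key : forall n eps, (N <= n)%nat -> 0 < eps ->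
   locally phi0 (fun phi => sum_n (fun j => Cmod (Cminus (F j phi) (F j phi0)) + Cmod (Cminus (G
     j phi) (G j phi0))) n < eps)).
  { intros n e Hn He.
    set (d phi := sum_n (fun j => Cmod (Cminus (F j phi) (F j phi0)) + Cmod (Cminus (G j phi) (G
      j phi0))) n).
    apply NNPP. intros Neg.
    assert (FF : ProperFilter (within (fun phi => e <= d phi) (locally phi0))).
    { split. 2: apply within_filter, locally_filter.
      intros P HP. apply NNPP. intros NP. apply Neg. unfold within in HP.
      revert HP. apply filter_imp. intros x Hx. apply Rnot_le_lt. intros Hd. apply NP. exists x;
        auto. }
    (* The first normalised differences are at most [1]; the geometric bound must exceed this. *)
    destruct (pow_lower M n radius_pos) as (K1 & HK1 & HK).
    (* The normalised differences, whose first [n + 1] moduli add up to [1]. *)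
    set (a phi j := Cplus (Cmult (RtoC (/ d phi)) (F j phi)) (Cmult (RtoC (- / d phi)) (F j
      phi0))).
    set (b phi j := Cplus (Cmult (RtoC (/ d phi)) (G j phi)) (Cmult (RtoC (- / d phi)) (G j
      phi0))).
    assert (Ea : forall phi j, e <= d phi -> Cmod (a phi j) = / d phi * Cmod (Cminus (F j phi) (F
      j phi0))).
    { intros phi j Hd. replace (a phi j) with (Cmult (RtoC (/ d phi)) (Cminus (F j phi) (F j
      phi0))).
      rewrite Cmod_mult, Cmod_R, Rabs_pos_eq. auto. apply Rlt_le, Rinv_0_lt_compat; lra.
      unfold a. rewrite RtoC_opp. ring. }
    assert (Eb : forall phi j, e <= d phi -> Cmod (b phi j) = / d phi * Cmod (Cminus (G j phi) (G
      j phi0))).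
    { intros phi j Hd. replace (b phi j) with (Cmult (RtoC (/ d phi)) (Cminus (G j phi) (G j
      phi0))).
      rewrite Cmod_mult, Cmod_R, Rabs_pos_eq. auto. apply Rlt_le, Rinv_0_lt_compat; lra.
      unfold b. rewrite RtoC_opp. ring. }
    assert (P0 : forall phi j, 0 <= Cmod (Cminus (F j phi) (F j phi0)) + Cmod (Cminus (G j phi)
      (G j phi0))).
    { intros phi j. apply Rplus_le_le_0_compat; apply Cmod_ge_0. }
    assert (Tm : forall j phi, (j <= n)%nat -> Cmod (Cminus (F j phi) (F j phi0)) + Cmod (Cminus
      (G j phi) (G j phi0)) <= d phi).
    { intros j phi Hj. apply (term_le_sum_n (fun j => Cmod (Cminus (F j phi) (F j phi0)) + Cmod
      (Cminus (G j phi) (G j phi0)))); auto. }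
    assert (e4 : 0 <= 4 / e) by (apply Rdiv_le_0_compat; lra).
    assert (Bound : forall (H : nat -> R -> C) phi j, e <= d phi ->
      (forall n phi, (N <= n)%nat -> Cmod (H n phi) <= 2 * M ^ n) ->
      (forall j, (j <= n)%nat -> Cmod (Cminus (H j phi) (H j phi0)) <= d phi) ->
      / d phi * Cmod (Cminus (H j phi) (H j phi0)) <= (K1 + 4 / e) * M ^ j).
    { intros H phi j Hd H2 H3. assert (dp : 0 < d phi) by lra. assert (Mj := pow_lt M j
      radius_pos).
      rewrite Rmult_plus_distr_r.
      assert (0 <= K1 * M ^ j) by (apply Rmult_le_pos; lra).
      assert (0 <= 4 / e * M ^ j) by (apply Rmult_le_pos; lra).
      destruct (le_lt_dec j n) as [Hj|Hj].
      - assert (X := HK j Hj). apply Rle_trans with 1. 2: lra.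
        rewrite <- (Rinv_l (d phi)) by lra. apply Rmult_le_compat_l; auto.
        apply Rlt_le, Rinv_0_lt_compat; lra.
      - apply Rle_trans with (4 / e * M ^ j). 2: lra.
        unfold Rdiv. rewrite (Rmult_comm 4), Rmult_assoc. apply Rmult_le_compat.
        apply Rlt_le, Rinv_0_lt_compat; lra. apply Cmod_ge_0. now apply Rinv_le_contravar.
        assert (X1 := H2 j phi ltac:(lia)). assert (X2 := H2 j phi0 ltac:(lia)).
        unfold Cminus. eapply Rle_trans. apply Cmod_triangle. rewrite Cmod_opp. lra. }
    apply (expansion_stable kappa u v Hk u_derive v_derive uv_not_both_zero (within (fun phi => e
      <= d phi) (locally phi0)) a b (K1 + 4 / e) M n 1); auto; try lra.
    - unfold within. apply filter_forall. intros phi Hd j. rewrite Ea by auto.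
      apply (Bound F); auto. intros; now apply HN.
      intros i Hi. specialize (Tm i phi Hi). assert (X := Cmod_ge_0 (Cminus (G i phi) (G i
        phi0))). lra.
    - unfold within. apply filter_forall. intros phi Hd j. rewrite Eb by auto.
      apply (Bound G); auto. intros; now apply HN.
      intros i Hi. specialize (Tm i phi Hi). assert (X := Cmod_ge_0 (Cminus (F i phi) (F i
        phi0))). lra.
    - intros r eta Hr Heta. unfold within.
      assert (Hr' : rho < r) by (assert (X := rho_lt_radius); lra).
      destruct (wave_Ccontinuous rho U psi Hrho HU HC r Hr') as [W1 W2].
      assert (ee : 0 < e * eta / 2) by (assert (0 < e * eta) by (apply Rmult_lt_0_compat; lra);
        lra).
      assert (V1 := proj1 (filterlim_locally _ _) (W1 phi0) (mkposreal _ ee)).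
      assert (V2 := proj1 (filterlim_locally _ _) (W2 phi0) (mkposreal _ ee)).
      generalize (filter_and _ _ V1 V2). apply filter_imp. intros phi [X1 X2] Hd.
      change (Rabs (fst (psi (polar r phi)) - fst (psi (polar r phi0))) < e * eta / 2) in X1.
      change (Rabs (snd (psi (polar r phi)) - snd (psi (polar r phi0))) < e * eta / 2) in X2.
      unfold a, b. rewrite (expansion_lincomb u v M); auto using geometric_F, geometric_G.
      rewrite <- !wave_expansion by lra.
      replace (Cplus _ _) with (Cmult (RtoC (/ d phi)) (Cminus (psi (polar r phi)) (psi (polar r
        phi0)))) by (rewrite RtoC_opp; ring).
      assert (dp : 0 < d phi) by lra.
      rewrite Cmod_mult, Cmod_R, Rabs_pos_eq by (apply Rlt_le, Rinv_0_lt_compat; lra).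
      assert (Y : Cmod (Cminus (psi (polar r phi)) (psi (polar r phi0))) < e * eta).
      { eapply Rle_lt_trans. apply Cmod_le_abs. simpl. unfold Rminus in X1, X2. lra. }
      apply Rmult_lt_reg_l with (d phi); auto. rewrite <- Rmult_assoc, Rinv_r, Rmult_1_l by lra.
      eapply Rlt_le_trans. exact Y. apply Rmult_le_compat_r; lra.
    - unfold within. apply filter_forall. intros phi Hd.
      rewrite (sum_n_ext _ (fun j => / d phi * (Cmod (Cminus (F j phi) (F j phi0)) + Cmod (Cminus
        (G j phi) (G j phi0))))).
      rewrite sum_n_Rmult. fold (d phi). rewrite Rinv_l; lra.
      intros j. rewrite Ea, Eb by auto. as_R_eq. ring. }
  intros n He. generalize (Key (max n N) eps ltac:(lia) He). apply filter_imp. intros phi.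
  apply Rle_lt_trans. apply sum_n_mono. 2: lia.
  intros j. apply Rplus_le_le_0_compat; apply Cmod_ge_0.
Qed.

Lemma Ccontinuous_of_small (H : R -> C) : (forall phi0 eps, 0 < eps -> locally phi0 (fun phi =>
  Cmod (Cminus (H phi) (H phi0)) < eps)) -> Ccontinuous_fun H.
Proof.
  intros HS. split; intros phi0; apply filterlim_locally; intros eps.
  - generalize (HS phi0 eps (cond_pos eps)). apply filter_imp. intros phi Hp.
    change (Rabs (fst (H phi) - fst (H phi0)) < eps). eapply Rle_lt_trans. 2: exact Hp.
    eapply Rle_trans. 2: apply fst_le_Cmod. simpl. right; f_equal; ring.
  - generalize (HS phi0 eps (cond_pos eps)). apply filter_imp. intros phi Hp.
    change (Rabs (snd (H phi) - snd (H phi0)) < eps). eapply Rle_lt_trans. 2: exact Hp.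
    eapply Rle_trans. 2: apply snd_le_Cmod. simpl. right; f_equal; ring.
Qed.

Lemma Ccontinuous_FG n : Ccontinuous_fun (F n) /\ Ccontinuous_fun (G n).
Proof.
  assert (X : forall phi0 eps, 0 < eps -> locally phi0 (fun phi => Cmod (Cminus (F n phi) (F n
    phi0)) + Cmod (Cminus (G n phi) (G n phi0)) < eps)).
  { intros phi0 eps He. generalize (coefficients_continuous phi0 n eps He). apply filter_imp.
    intros phi.
    apply Rle_lt_trans.
    apply (term_le_sum_n (fun j => Cmod (Cminus (F j phi) (F j phi0)) + Cmod (Cminus (G j phi) (G
      j phi0)))); auto.
    intros j. apply Rplus_le_le_0_compat; apply Cmod_ge_0. }
  split; apply Ccontinuous_of_small; intros phi0 eps He; generalize (X phi0 eps He); apply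
    filter_imp; intros phi Hp.
  assert (Y := Cmod_ge_0 (Cminus (G n phi) (G n phi0))). lra.
  assert (Y := Cmod_ge_0 (Cminus (F n phi) (F n phi0))). lra.
Qed.

Section Average.
Variables h p : R.
Hypothesis Hh : 0 <= h.
Let f n := Csecond_average h (F n) p.
Let g n := Csecond_average h (G n) p.

Lemma geometric_average : geometric M f /\ geometric M g.
Proof.
  destruct common_tail as (N & H).
  split; apply (geometric_of_tail M _ (4 * h * h * 2) N radius_pos); intros n Hn;
  rewrite (Rmult_assoc (4 * h * h)).
  - exact (Csecond_average_bound h (F n) p _ Hh (proj1 (Ccontinuous_FG n)) (fun t => proj1 (H n t
    Hn))).
  - exact (Csecond_average_bound h (G n) p _ Hh (proj2 (Ccontinuous_FG n)) (fun t => proj2 (H n t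
    Hn))).
Qed.

(** Averaging commutes with the partial sums of the expansion, and uniform
    convergence controls the remainders before and after averaging. *)
Lemma average_expansion r : M < r -> Csecond_average h (fun t => psi (polar r t)) p = expansion u
  v f g r.
Proof.
  intros Hr. assert (Hr' : rho < r) by (assert (X := rho_lt_radius); lra).
  destruct geometric_average as [Gf Gg].
  assert (Small : forall x : C, (forall eps, 0 < eps -> Cmod x <= eps) -> x = RtoC 0).
  { intros x Hx. apply Cmod_eq_0. apply Rle_antisym. 2: apply Cmod_ge_0.
    apply le_epsilon. intros e He. rewrite Rplus_0_l. auto. }
  set (q := Cminus (Csecond_average h (fun t => psi (polar r t)) p) (expansion u v f g r)).
  assert (Z : q = RtoC 0).
  { apply Small. intros eps He.
    set (W := Cmod (u r) + Cmod (v r)).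
    assert (HW : 0 <= W) by (apply Rplus_le_le_0_compat; apply Cmod_ge_0).
    set (D := 4 * h * h * W + W + 1).
    assert (h2 : 0 <= h * h) by now apply Rmult_le_pos.
    assert (h3 : 0 <= 4 * h * h * W) by (replace (4 * h * h * W) with (4 * (h * h * W)) by ring;
      apply Rmult_le_pos; [lra | now apply Rmult_le_pos]).
    assert (HD : 0 < D) by (unfold D; lra).
    set (eta := eps / D).
    assert (He' : 0 < eta) by now apply Rdiv_lt_0_compat.
    destruct (UA M rho_lt_radius eta He') as (N1 & H1). destruct (UB M rho_lt_radius eta He') as
      (N2 & H2).
    destruct (inv_series_partial_sums M f r eta radius_pos Hr Gf He') as (N3 & H3).
    destruct (inv_series_partial_sums M g r eta radius_pos Hr Gg He') as (N4 & H4).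
    set (n := max (max N1 N2) (max N3 N4)).
    set (S1 t := sum_n (fun j => Cmult (F j t) (RtoC (/ r ^ j))) n).
    set (S2 t := sum_n (fun j => Cmult (G j t) (RtoC (/ r ^ j))) n).
    set (s1 := sum_n (fun j => Cmult (f j) (RtoC (/ r ^ j))) n).
    set (s2 := sum_n (fun j => Cmult (g j) (RtoC (/ r ^ j))) n).
    assert (CS1 : Ccontinuous_fun S1) by (apply Ccontinuous_sum; apply Ccontinuous_FG).
    assert (CS2 : Ccontinuous_fun S2) by (apply Ccontinuous_sum; apply Ccontinuous_FG).
    assert (E1 : Csecond_average h S1 p = s1) by (apply Csecond_average_sum; apply
      Ccontinuous_FG).
    assert (E2 : Csecond_average h S2 p = s2) by (apply Csecond_average_sum; apply
      Ccontinuous_FG).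
    assert (T1 : forall t, Cmod (Cminus (S1 t) (A r t)) <= eta).
    { intros t. apply Rlt_le. unfold S1. rewrite <- (sum_n_ext (karp_term F r t)).
      apply H1. unfold n; lia. lra. intros j. apply karp_term_eq; lra. }
    assert (T2 : forall t, Cmod (Cminus (S2 t) (B r t)) <= eta).
    { intros t. apply Rlt_le. unfold S2. rewrite <- (sum_n_ext (karp_term G r t)).
      apply H2. unfold n; lia. lra. intros j. apply karp_term_eq; lra. }
    assert (Cpsi := wave_Ccontinuous rho U psi Hrho HU HC r Hr').
    (* The error of the partial sums of rank [n], before averaging. *)
    set (dif t := Cplus (Cmult (RtoC 1) (psi (polar r t))) (Cmult (RtoC (-1)) (Cplus (Cmult (u r)
      (S1 t)) (Cmult (v r) (S2 t))))).
    assert (Cdif : Ccontinuous_fun dif) by (apply Ccontinuous_lincomb; auto; now apply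
      Ccontinuous_lincomb).
    assert (m1 : RtoC (-1) = Copp (RtoC 1)) by (rewrite <- RtoC_opp; reflexivity).
    assert (Bdif : forall t, Cmod (dif t) <= W * eta).
    { intros t. unfold dif. rewrite HE by lra. fold (u r). fold (v r).
      replace (Cplus _ _) with (Copp (Cplus (Cmult (u r) (Cminus (S1 t) (A r t))) (Cmult (v r)
        (Cminus (S2 t) (B r t)))))
        by (rewrite m1; ring).
      rewrite Cmod_opp. eapply Rle_trans. apply Cmod_triangle. rewrite !Cmod_mult.
      specialize (T1 t). specialize (T2 t). unfold W. rewrite Rmult_plus_distr_r.
      apply Rplus_le_compat; apply Rmult_le_compat_l; auto; apply Cmod_ge_0. }
    assert (Bc := Csecond_average_bound h dif p (W * eta) Hh Cdif Bdif).
    unfold dif in Bc. rewrite Csecond_average_lincomb in Bc by (auto; now apply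
      Ccontinuous_lincomb).
    rewrite Csecond_average_lincomb in Bc by auto. rewrite E1, E2 in Bc.
    specialize (H3 n ltac:(unfold n; lia)). specialize (H4 n ltac:(unfold n; lia)). fold s1 in
      H3. fold s2 in H4.
    replace q with (Cplus (Cplus (Cmult (RtoC 1) (Csecond_average h (fun t => psi (polar r t))
      p)) (Cmult (RtoC (-1)) (Cplus (Cmult (u r) s1) (Cmult (v r) s2))))
      (Cplus (Cmult (u r) (Cminus s1 (inv_series f r))) (Cmult (v r) (Cminus s2 (inv_series g
        r))))) by (unfold q, expansion; rewrite m1; ring).
    eapply Rle_trans. apply Cmod_triangle.
    assert (Bl : Cmod (Cplus (Cmult (u r) (Cminus s1 (inv_series f r))) (Cmult (v r) (Cminus s2
      (inv_series g r)))) <= W * eta).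
    { eapply Rle_trans. apply Cmod_triangle. rewrite !Cmod_mult. unfold W. rewrite
      Rmult_plus_distr_r.
      apply Rplus_le_compat; apply Rmult_le_compat_l; try apply Cmod_ge_0; lra. }
    apply Rle_trans with (4 * h * h * (W * eta) + W * eta). lra.
    replace eps with (D * eta) by (unfold eta; field; lra). unfold D. nra. }
  replace (Csecond_average h (fun t => psi (polar r t)) p) with (Cplus q (expansion u v f g r))
    by (unfold q; ring).
  rewrite Z. ring.
Qed.

(** Both sides of [wave_second_difference] are expansions in [r]; uniqueness equates
    their coefficients. *)
Lemma difference_recursion n :
  Cplus (Cplus (F n (p + h)) (Cmult (RtoC (-2)) (F n p))) (F n (p - h)) =
    Cplus (Cmult (RtoC (2 * kappa * INR (n + 1))) (g (S n))) (Cmult (RtoC (- INR n ^ 2)) (f n)) /\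
  Cplus (Cplus (G n (p + h)) (Cmult (RtoC (-2)) (G n p))) (G n (p - h)) =
    Cplus (Cmult (RtoC (- (2 * kappa * INR (n + 1)))) (f (S n))) (Cmult (RtoC (- INR (n + 1) ^
      2)) (g n)).
Proof.
  destruct geometric_average as [Gf Gg].
  destruct (wave_second_difference kappa rho U psi Hrho HU HC HH h p Hh) as (K1 & K2 & HK).
  set (f1 := deriv_u kappa f g). set (g1 := deriv_v kappa f g).
  set (f2 := deriv_u kappa f1 g1). set (g2 := deriv_v kappa f1 g1).
  assert (Gf1 : geometric (2 * M) f1) by now apply geometric_deriv_u.
  assert (Gg1 : geometric (2 * M) g1) by now apply geometric_deriv_v.
  assert (M2 : 0 < 2 * M) by (assert (X := radius_pos); lra).
  assert (Gf2 : geometric (2 * (2 * M)) f2) by now apply geometric_deriv_u.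
  assert (Gg2 : geometric (2 * (2 * M)) g2) by now apply geometric_deriv_v.
  set (L := 2 * (2 * M)) in *.
  assert (EK1 : forall r, 2 * M < r -> K1 r = expansion u v f1 g1 r).
  { intros r Hr. assert (X := rho_lt_radius). assert (X' := radius_pos). destruct (HK r
    ltac:(lra)) as [E _].
    apply (Cderive_unique _ _ _ _ E). apply (Cderive_ext_gt (expansion u v f g) _ M). lra.
    intros s Hs. symmetry. now apply average_expansion.
    apply (expansion_derive kappa u v u_derive v_derive M); auto. }
  assert (EK2 : forall r, L < r -> K2 r = expansion u v f2 g2 r).
  { intros r Hr. assert (X := rho_lt_radius). assert (X' := radius_pos). unfold L in Hr. destruct
    (HK r ltac:(lra)) as [_ [E _]].
    apply (Cderive_unique _ _ _ _ E). apply (Cderive_ext_gt (expansion u v f1 g1) _ (2 * M)). lra.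
    intros s Hs. symmetry. now apply EK1.
    apply (expansion_derive kappa u v u_derive v_derive (2 * M)); auto. }
  set (dF n := Cplus (Cplus (F n (p + h)) (Cmult (RtoC (-2)) (F n p))) (F n (p - h))).
  set (dG n := Cplus (Cplus (G n (p + h)) (Cmult (RtoC (-2)) (G n p))) (G n (p - h))).
  assert (L0 : 0 < L) by (unfold L; lra).
  assert (ML : forall a, geometric M a -> geometric L a).
  { intros a. apply geometric_mono. assert (X := radius_pos). unfold L; lra. }
  assert (GF : forall t, geometric L (fun n => F n t)) by (intros; apply ML, geometric_F).
  assert (GG : forall t, geometric L (fun n => G n t)) by (intros; apply ML, geometric_G).
  assert (GdF : geometric L dF) by (unfold dF; solve_geometric; auto).
  assert (GdG : geometric L dG) by (unfold dG; solve_geometric; auto).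
  assert (Gf1' : geometric L f1) by (apply (geometric_mono (2 * M)); auto; unfold L; lra).
  assert (Gg1' : geometric L g1) by (apply (geometric_mono (2 * M)); auto; unfold L; lra).
  assert (Sh : forall a, geometric L a -> geometric L (shift a)) by (intros; now apply
    geometric_shift).
  (* Dividing the equation by [r ^ 2] shifts [dF] twice; its rank [n] is read at rank [n + 2]. *)
  set (X n := Cplus (shift (shift dF) n) (Cplus (f2 n) (Cplus (shift f1 n) (Cmult (RtoC (kappa ^
    2)) (f n))))).
  set (Y n := Cplus (shift (shift dG) n) (Cplus (g2 n) (Cplus (shift g1 n) (Cmult (RtoC (kappa ^
    2)) (g n))))).
  assert (XY : forall n, X n = RtoC 0 /\ Y n = RtoC 0).
  { apply (expansion_unique kappa u v Hk u_derive v_derive uv_not_both_zero L); auto. unfold X;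
    solve_geometric; auto. unfold Y; solve_geometric; auto.
    intros r Hr.
    assert (R0 : rho < r /\ M < r /\ 2 * M < r).
    { assert (X' := radius_pos). assert (X'' := rho_lt_radius). unfold L in Hr. lra. }
    destruct R0 as (R1 & R2 & R3).
    destruct (HK r R1) as (_ & _ & E).
    rewrite EK1, EK2, average_expansion in E by auto.
    rewrite !wave_expansion in E by lra.
    unfold X, Y, expansion in *.
    unfold dF, dG.
    assert (CD : forall H : nat -> R -> C, (forall t, geometric L (fun n => H n t)) ->
      inv_series (fun n => Cplus (Cplus (H n (p + h)) (Cmult (RtoC (-2)) (H n p))) (H n (p - h)))
        r =
      Cplus (Cplus (inv_series (fun n => H n (p + h)) r) (Cmult (RtoC (-2)) (inv_series (fun n =>
        H n p) r))) (inv_series (fun n => H n (p - h)) r)).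
    { intros H GH. rewrite !(inv_series_plus L), (inv_series_scal L); solve_geometric; auto. }
    rewrite !(inv_series_plus L), !(inv_series_scal L), !inv_series_shift; solve_geometric; auto.
    rewrite (CD F), (CD G) by auto.
    assert (r0 : RtoC r <> RtoC 0) by (intros E'; apply RtoC_inj in E'; lra).
    match type of E with ?lhs = ?rhs =>
      transitivity (Cplus (Cmult (Cmult (RtoC (/ r)) (RtoC (/ r))) (Cminus lhs rhs)) (RtoC 0))
        end.
    2: rewrite E; ring.
    rewrite !RtoC_opp, !RtoC_pow, !RtoC_inv by lra. field. auto. }
  assert (In : RtoC (INR (n + 1)) = Cplus (RtoC (INR n)) (RtoC 1)) by (rewrite plus_INR,
    RtoC_plus; reflexivity).
  destruct (XY (S (S n))) as [EX EY]. unfold X in EX. unfold Y in EY.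
  unfold f2, g2, f1, g1, deriv_u, deriv_v, inv_deriv, shift in EX, EY.
  fold (dF n). fold (dG n).
  rewrite S_INR in EX, EY.
  assert (m1 : RtoC (-1) = Copp (RtoC 1)) by (rewrite <- RtoC_opp; reflexivity).
  rewrite !RtoC_opp, !RtoC_plus, !RtoC_pow, m1 in EX, EY.
  rewrite !RtoC_opp, !RtoC_mult, !RtoC_pow, In.
  split.
  - match type of EX with ?lhs = _ => transitivity (Cminus (dF n) lhs) end. rewrite EX; ring.
    simpl; ring.
  - match type of EY with ?lhs = _ => transitivity (Cminus (dG n) lhs) end. rewrite EY; ring.
    simpl; ring.
Qed.
End Average.

Lemma coefficient_derivatives n : exists F1 G1 : R -> C,
  (forall t, is_Cderive (F n) t (F1 t)) /\
  (forall t, is_Cderive F1 t (Cplus (Cmult (RtoC (2 * kappa * INR (n + 1))) (G (S n) t)) (Cmult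
    (RtoC (- INR n ^ 2)) (F n t)))) /\
  (forall t, is_Cderive (G n) t (G1 t)) /\
  (forall t, is_Cderive G1 t (Cplus (Cmult (RtoC (- (2 * kappa * INR (n + 1)))) (F (S n) t))
    (Cmult (RtoC (- INR (n + 1) ^ 2)) (G n t)))).
Proof.
  assert (Conv : forall q Q : R -> C, Ccontinuous_fun q -> Ccontinuous_fun Q ->
    (forall p h, 0 < h -> Cplus (Cplus (q (p + h)) (Cmult (RtoC (-2)) (q p))) (q (p - h)) =
      Csecond_average h Q p) ->
    exists q1, (forall t, is_Cderive q t (q1 t)) /\ (forall t, is_Cderive q1 t (Q t))).
  { intros q Q [A1 A2] [B1 B2] H.
    destruct (second_difference_converse (fun t => fst (q t)) (fun t => fst (Q t)) A1 B1) as (x &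
      X1 & X2).
    { intros p h Hh. transitivity (fst (Csecond_average h Q p)). rewrite <- (H p h Hh). simpl.
      ring. reflexivity. }
    destruct (second_difference_converse (fun t => snd (q t)) (fun t => snd (Q t)) A2 B2) as (y &
      Y1 & Y2).
    { intros p h Hh. transitivity (snd (Csecond_average h Q p)). rewrite <- (H p h Hh). simpl.
      ring. reflexivity. }
    exists (fun t => (x t, y t)). split; intros t; split; simpl; auto. }
  destruct (Ccontinuous_FG n) as [CF CG]. destruct (Ccontinuous_FG (S n)) as [CF' CG'].
  destruct (Conv (F n) (fun t => Cplus (Cmult (RtoC (2 * kappa * INR (n + 1))) (G (S n) t))
    (Cmult (RtoC (- INR n ^ 2)) (F n t)))) as (F1 & P1 & P2); auto.
  now apply Ccontinuous_lincomb.
  { intros p h Hh. rewrite Csecond_average_lincomb by auto. now apply difference_recursion,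
    Rlt_le. }
  destruct (Conv (G n) (fun t => Cplus (Cmult (RtoC (- (2 * kappa * INR (n + 1)))) (F (S n) t))
    (Cmult (RtoC (- INR (n + 1) ^ 2)) (G n t)))) as (G1 & Q1 & Q2); auto.
  now apply Ccontinuous_lincomb.
  { intros p h Hh. rewrite Csecond_average_lincomb by auto. now apply difference_recursion,
    Rlt_le. }
  exists F1, G1. auto.
Qed.
End Karp.

Theorem lemma2 (kappa rho : R) (U : plane -> Prop) (psi : plane -> C)
    (F G : nat -> R -> C)
    (hkappa : 0 < kappa)
    (hU : exterior_region U)
    (hpsi : radiation_solution kappa U psi)
    (hrho : 0 < rho)
    (hrhoU : forall p : plane, rho <= enorm p -> U p)
    (hFG : karp_expansion kappa rho psi F G) :
  forall n : nat,
    twice_differentiable (F n) /\ twice_differentiable (G n) /\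
    forall phi : R,
      F (S n) phi =
        Cdiv (Copp (Cplus (Cmult (RtoC (INR (n + 1) ^ 2)) (G n phi))
                          (CDerive (CDerive (G n)) phi)))
             (RtoC (2 * kappa * INR (n + 1))) /\
      G (S n) phi =
        Cdiv (Cplus (Cmult (RtoC (INR n ^ 2)) (F n phi))
                    (CDerive (CDerive (F n)) phi))
             (RtoC (2 * kappa * INR (n + 1))).
Proof.
  destruct hpsi as (HC & HH & _).
  destruct hFG as (_ & _ & A & B & HA & HB & HE & HU).
  intros n.
  destruct (coefficient_derivatives kappa rho U psi F G A B) with (n := n) as (F1 & G1 & P1 & P2
    & Q1 & Q2); auto.
  { intros rho1 H. apply (HU rho1 H). }
  { intros rho1 H. apply (HU rho1 H). }
  destruct (twice_of_Cderive _ _ _ P1 P2) as [TF EF]. destruct (twice_of_Cderive _ _ _ Q1 Q2) as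
    [TG EG].
  split; [|split]; auto. intros phi. rewrite EF, EG.
  assert (K0 : RtoC (2 * kappa * INR (n + 1)) <> RtoC 0).
  { intros E. apply RtoC_inj in E. assert (0 < INR (n + 1)) by (apply lt_0_INR; lia).
    assert (0 < kappa * INR (n + 1)) by now apply Rmult_lt_0_compat. lra. }
  rewrite !RtoC_opp. split; field; auto.
Qed.
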